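(* Let $Y\subset\mathbb{P}^3_{\mathbb{Q}}$ be the quadric surface $y_0y_1=y_2y_3$, let $X\subset\mathbb{P}^3_{\mathbb{Q}}\times\mathbb{P}^3_{\mathbb{Q}}$ be the variety defined by $$y_0x_0^2+y_1x_1^2+y_2x_2^2+y_3x_3^2=0,\qquad y_0y_1=y_2y_3,$$ and let $\pi\colon X\to Y$ be the projection $(x,y)\mapsto y$. Let $\tilde X\to X$ be a desingularisation and let $\tilde\pi\colon\tilde X\to Y$ be its composition with $\pi$. Then $$B\ll N_{\mathrm{loc}}(\tilde\pi,B)\ll B \qquad\text{as } B\to\infty;$$ that is, there are constants $c_1,c_2>0$ such that $c_1B\le N_{\mathrm{loc}}(\tilde\pi,B)\le c_2B$ for all sufficiently large $B$.
   Context: A desingularisation $\tilde X\to X$ is a proper birational morphism from a smooth variety $\tilde X$ which is an isomorphism over the smooth locus of $X$. Height: a point $y\in\mathbb{P}^3(\mathbb{Q})$ is represented by a primitive integer vector $\mathbf{y}=(y_0,y_1,y_2,y_3)\in\mathbb{Z}^4$ (unique up to sign); put $|\mathbf{y}|=\max_{0\le i\le 3}|y_i|$. The anticanonical height on $Y(\mathbb{Q})$ is $H(y)=|\mathbf{y}|^2$. Counting function: with $\mathbf{A}_{\mathbb{Q}}$ the ring of ad\`eles of $\mathbb{Q}$, $$N_{\mathrm{loc}}(\tilde\pi,B)=\#\{y\in Y(\mathbb{Q})\cap\tilde\pi(\tilde X(\mathbf{A}_{\mathbb{Q}}))\colon H(y)\le B\}.$$ That is, it counts the $y\in Y(\mathbb{Q})$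 with $H(y)\le B$ for which the fibre $\tilde\pi^{-1}(y)$ has a $\mathbb{Q}_v$-point for every place $v$ of $\mathbb{Q}$ (including $\mathbb{Q}_\infty=\mathbb{R}$). *)

(* Defs.v *)
From HB Require Import structures.
From mathcomp Require Import all_boot all_order all_algebra.
From mathcomp Require Import all_classical all_reals topology normedtype.
From mathcomp Require Import finmap ring lra.
Set Implicit Arguments. Unset Strict Implicit. Unset Printing Implicit Defensive.
Import Order.TTheory GRing.Theory Num.Theory.
Local Open Scope classical_set_scope.
Local Open Scope ring_scope.

Definition padic_abs (p : nat) (x : rat) : rat :=
  if x == 0 then 0
  else p%:R ^ ((logn p `|denq x|)%:Z - (logn p `|numq x|)%:Z).

Definition padic_cauchy (p : nat) (u : nat -> rat) :=
  forall e : rat, 0 < e ->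
  exists N, forall m n, (N <= m)%N -> (N <= n)%N -> padic_abs p (u m - u n) < e.

Definition padic_null (p : nat) (u : nat -> rat) :=
  forall e : rat, 0 < e ->
  exists N, forall n, (N <= n)%N -> padic_abs p (u n) < e.

Section PadicAbs.
Variable p : nat.
Local Notation "|[ x ]|" := (padic_abs p x).

Lemma padic_abs0 : |[0]| = 0.
Proof. by rewrite /padic_abs eqxx. Qed.

Lemma padic_abs1 : |[1]| = 1.
Proof.
rewrite -[in LHS](rmorph1 intr) /padic_abs intr_eq0 oner_eq0.
by rewrite denq_int numq_int /= logn1.
Qed.

Lemma padic_absN x : |[- x]| = |[x]|.
Proof. by rewrite /padic_abs oppr_eq0 denqN numqN abszN. Qed.

Lemma padic_abs_ge0 x : 0 <= |[x]|.
Proof. by rewrite /padic_abs; case: ifP => // _; apply: exprz_ge0. Qed.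

Lemma padic_absM x y : |[x * y]| = |[x]| * |[y]|.
Proof.
have [->|x0] := eqVneq x 0; first by rewrite mul0r padic_abs0 mul0r.
have [->|y0] := eqVneq y 0; first by rewrite mulr0 padic_abs0 mulr0.
rewrite /padic_abs mulf_eq0 (negPf x0) (negPf y0) /=.
have [->|p0] := eqVneq p 0%N; first by rewrite /= !subrr mul1r.
have pr0 : p%:R != 0 :> rat by rewrite pnatr_eq0.
rewrite -expfzDr //; congr (_ ^ _).
have E : numq (x * y) * denq x * denq y = numq x * numq y * denq (x * y).
  apply: (@intr_inj rat); rewrite !rmorphM /=.
  have := divq_num_den (x * y); have := divq_num_den x; have := divq_num_den y.
  have := denq_neq0 x; have := denq_neq0 y; have := denq_neq0 (x * y).
  rewrite -!(intr_eq0 rat) => d1 d2 d3 e2 e3 e1.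
  have {}e1 : (numq (x*y))%:~R = x * y * (denq (x*y))%:~R :> rat.
    by rewrite -{2}e1 divfK.
  have {}e2 : (numq y)%:~R = y * (denq y)%:~R :> rat by rewrite -{2}e2 divfK.
  have {}e3 : (numq x)%:~R = x * (denq x)%:~R :> rat by rewrite -{2}e3 divfK.
  by rewrite e1 e2 e3; ring.
have := congr1 (fun z => logn p `|z|) E; rewrite /= !abszM.
have H z : z != 0 -> (0 < `|z|)%N by rewrite absz_gt0.
have nx : numq x != 0 by rewrite numq_eq0.
have ny : numq y != 0 by rewrite numq_eq0.
have nxy : numq (x * y) != 0 by rewrite numq_eq0 mulf_neq0.
rewrite !lognM ?muln_gt0 ?H ?denq_neq0 // => /(congr1 Posz); rewrite !PoszD; lra.
Qed.

Lemma padic_abs_int (m : int) : |[m%:~R]| <= 1.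
Proof.
rewrite /padic_abs; case: ifP => // _.
rewrite denq_int numq_int /= logn1 sub0r.
have [->|p0] := posnP p; first by [].
have p1 : 1 <= p%:R :> rat by rewrite ler1n.
by rewrite -exprz_inv -exprnP exprn_ile1 ?invr_ge0 ?invf_le1 ?ler0n // ltr0n.
Qed.

Lemma padic_absD1 z : |[z]| <= 1 -> |[1 + z]| <= 1.
Proof.
have [->|z0] := eqVneq z 0; first by rewrite addr0 padic_abs1.
move=> zle.
have dz : |[(denq z)%:~R]| = 1.
  move: zle; rewrite /padic_abs (negPf z0) intr_eq0 (negPf (denq_neq0 _)).
  rewrite denq_int numq_int /= logn1 sub0r.
  have [pp|np] := boolP (prime p); last first.
    by rewrite /logn (negPf np) /=.
  have [d0|d1] := posnP (logn p `|denq z|); first by rewrite d0.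
  have p1 : 1 < p%:R :> rat by rewrite ltr1n prime_gt1.
  have pd : (p %| `|denq z|)%N by apply: contraTT d1 => /negP h; rewrite logn_gt0 mem_primes pp absz_gt0 denq_neq0; apply/negP.
  have n0 : logn p `|numq z| = 0%N.
    apply/eqP; rewrite -leqn0 leqNgt logn_gt0 mem_primes pp absz_gt0 numq_eq0 z0 /=.
    apply/negP => pn; have := coprime_num_den z.
    rewrite /coprime => /eqP g; have : (p %| gcdn `|numq z| `|denq z|)%N by rewrite dvdn_gcd pn.
    by rewrite g dvdn1 => /eqP p1'; move: pp; rewrite p1'.
  rewrite n0 subr0 -exprnP => le1; exfalso; move: le1.
  by rewrite leNgt exprn_egt1 // -lt0n d1.
have E : 1 + z = (denq z + numq z)%:~R / (denq z)%:~R.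
  have d0 : (denq z)%:~R != 0 :> rat by rewrite intr_eq0 denq_neq0.
  by rewrite rmorphD /= mulrDl divff // divq_num_den.
have d0 : (denq z)%:~R != 0 :> rat by rewrite intr_eq0 denq_neq0.
have F : |[1 + z]| * |[(denq z)%:~R]| = |[(denq z + numq z)%:~R]|.
  by rewrite -padic_absM E divfK.
by move: F; rewrite dz mulr1 => ->; apply: padic_abs_int.
Qed.

Lemma padic_abs_max x y : |[y]| <= |[x]| -> |[x + y]| <= |[x]|.
Proof.
have [->|x0] := eqVneq x 0; first by rewrite add0r.
have ax : 0 < |[x]|.
  rewrite lt_neqAle padic_abs_ge0 andbT eq_sym; apply/eqP => ax0.
  have := padic_absM x x^-1; rewrite divff // padic_abs1 ax0 mul0r.
  by move/eqP; rewrite oner_eq0.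
have -> : x + y = x * (1 + y / x) by field.
move=> yx; rewrite padic_absM ler_piMr ?padic_abs_ge0 //; apply: padic_absD1.
by rewrite -(ler_pM2l ax) -padic_absM mulr1 mulrC divfK.
Qed.

Lemma padic_absD x y : |[x + y]| <= |[x]| + |[y]|.
Proof.
have := padic_abs_ge0 x; have := padic_abs_ge0 y.
have [h|h] := leP (|[y]|) (|[x]|).
  by have := padic_abs_max h; lra.
by have := padic_abs_max (ltW h); rewrite addrC; lra.
Qed.

Lemma padic_absB x y : |[x - y]| <= |[x]| + |[y]|.
Proof. by rewrite -(padic_absN y) padic_absD. Qed.

Lemma padic_cauchy_cst (c : rat) : padic_cauchy p (fun=> c).
Proof. by move=> e e0; exists 0%N => m n _ _; rewrite subrr padic_abs0. Qed.

Lemma padic_cauchyB u v :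
  padic_cauchy p u -> padic_cauchy p v -> padic_cauchy p (u - v).
Proof.
move=> cu cv e e0; have e2 : 0 < e / 2 by lra.
have [M hM] := cu _ e2; have [N hN] := cv _ e2.
exists (maxn M N) => m n; rewrite !geq_max => /andP[a b] /andP[c d].
rewrite !fctE; have -> : u m - v m - (u n - v n) = (u m - u n) - (v m - v n) by ring.
apply: le_lt_trans (padic_absB _ _) _.
by have := hM _ _ a c; have := hN _ _ b d; lra.
Qed.

Lemma padic_cauchy_bounded u : padic_cauchy p u ->
  exists C, 0 < C /\ exists N, forall n, (N <= n)%N -> |[u n]| <= C.
Proof.
move=> cu; have [N hN] := cu 1 ltr01.
exists (1 + |[u N]|); split; first by have := padic_abs_ge0 (u N); lra.
exists N => n Nn; rewrite -[u n](subrK (u N)).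
by apply: le_trans (padic_absD _ _) _; rewrite lerD2r ltW ?hN.
Qed.

Lemma padic_cauchyM u v :
  padic_cauchy p u -> padic_cauchy p v -> padic_cauchy p (u * v).
Proof.
move=> cu cv e e0.
have [C [C0 [K hK]]] := padic_cauchy_bounded cu.
have [D [D0 [L hL]]] := padic_cauchy_bounded cv.
have eD : 0 < e / 2 / D by rewrite !divr_gt0.
have eC : 0 < e / 2 / C by rewrite !divr_gt0.
have [M hM] := cu _ eD; have [N hN] := cv _ eC.
exists (maxn (maxn K L) (maxn M N)) => m n; rewrite !geq_max.
move=> /andP[/andP[m1 m2] /andP[m3 m4]] /andP[/andP[n1 n2] /andP[n3 n4]].
rewrite !fctE.
have -> : u m * v m - u n * v n = u m * (v m - v n) + (u m - u n) * v n by ring.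
apply: le_lt_trans (padic_absD _ _) _; rewrite !padic_absM.
have h1 : |[u m]| * |[v m - v n]| < e / 2.
  apply: le_lt_trans (_ : C * |[v m - v n]| < _).
    by rewrite ler_wpM2r ?padic_abs_ge0 ?hK.
  by rewrite mulrC -ltr_pdivlMr // hN.
have h2 : |[u m - u n]| * |[v n]| < e / 2.
  apply: le_lt_trans (_ : |[u m - u n]| * D < _).
    by rewrite ler_wpM2l ?padic_abs_ge0 ?hL.
  by rewrite -ltr_pdivlMr // hM.
lra.
Qed.

End PadicAbs.

Definition padic_cauchy_pred p : {pred nat -> rat} := [pred u | `[< padic_cauchy p u >]].

Lemma padic_cauchy_subring p : subring_closed (padic_cauchy_pred p).
Proof.
split; first by apply/asboolP; apply: padic_cauchy_cst.
- by move=> u v /asboolP cu /asboolP cv; apply/asboolP; apply: padic_cauchyB.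
- by move=> u v /asboolP cu /asboolP cv; apply/asboolP; apply: padic_cauchyM.
Qed.

HB.instance Definition _ p :=
  GRing.isSubringClosed.Build _ (padic_cauchy_pred p) (padic_cauchy_subring p).

Record cauchy_seq (p : nat) :=
  CauchySeq { cauchy_val :> nat -> rat; _ : cauchy_val \in padic_cauchy_pred p }.
HB.instance Definition _ p := [isSub for @cauchy_val p].
HB.instance Definition _ p := [Choice of cauchy_seq p by <:].
HB.instance Definition _ p := [SubChoice_isSubComNzRing of cauchy_seq p by <:].

Definition null_seq (p : nat) : {pred cauchy_seq p} :=
  [pred u : cauchy_seq p | `[< padic_null p (u : nat -> rat) >]].

Lemma null_seq_ideal p : idealr_closed (@null_seq p).
Proof.
split.
- by apply/asboolP => e e0; exists 0%N => n _; rewrite padic_abs0.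
- apply/asboolP => /(_ 1 ltr01)[N /(_ N (leqnn N))].
  by rewrite padic_abs1 ltxx.
- move=> a u v /asboolP nu /asboolP nv; apply/asboolP => e e0.
  have ca : padic_cauchy p a by case: (a) => f /= /asboolP.
  have [C [C0 [K hK]]] := padic_cauchy_bounded ca.
  have eC : 0 < e / 2 / C by rewrite !divr_gt0.
  have e2 : 0 < e / 2 by rewrite divr_gt0.
  have [M hM] := nu _ eC; have [N hN] := nv _ e2.
  exists (maxn K (maxn M N)) => n; rewrite !geq_max => /and3P[n1 n2 n3].
  rewrite [X in padic_abs _ X](_ : _ = cauchy_val a n * cauchy_val u n + cauchy_val v n) //.
  apply: le_lt_trans (padic_absD _ _ _) _; rewrite padic_absM.
  have h1 : padic_abs p (a n) * padic_abs p (u n) < e / 2.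
    apply: le_lt_trans (_ : C * padic_abs p (u n) < _).
      by rewrite ler_wpM2r ?padic_abs_ge0 ?hK.
    by rewrite mulrC -ltr_pdivlMr // hM.
  by have := hN _ n3; lra.
Qed.

HB.instance Definition _ p :=
  isIdealr.Build (cauchy_seq p) (@null_seq p) (@null_seq_ideal p).

(* The completion of Q for the p-adic absolute value: Cauchy sequences of
   rationals modulo null sequences. *)
Definition Qp (p : nat) := {ideal_quot (@null_seq p)}.

Lemma cst_cauchy p (c : rat) : (fun=> c) \in padic_cauchy_pred p.
Proof. by apply/asboolP; apply: padic_cauchy_cst. Qed.

Definition rat_cauchy p (c : rat) : cauchy_seq p := CauchySeq (cst_cauchy p c).
Definition rat_Qp p (c : rat) : Qp p := (\pi_(Qp p) (rat_cauchy p c))%qT.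

Lemma rat_Qp_zmod p : zmod_morphism (@rat_Qp p).
Proof.
by move=> x y; rewrite /rat_Qp -rmorphB; congr (\pi _)%qT; apply: val_inj.
Qed.
Lemma rat_Qp_monoid p : monoid_morphism (@rat_Qp p).
Proof.
split; first by rewrite /rat_Qp -[RHS](rmorph1 (\pi_(Qp p))%qT); congr (\pi _)%qT; apply: val_inj.
by move=> x y; rewrite /rat_Qp -rmorphM; congr (\pi _)%qT; apply: val_inj.
Qed.
HB.instance Definition _ p := GRing.isZmodMorphism.Build rat (Qp p) (@rat_Qp p) (@rat_Qp_zmod p).
HB.instance Definition _ p := GRing.isMonoidMorphism.Build rat (Qp p) (@rat_Qp p) (@rat_Qp_monoid p).

#[local] Obligation Tactic := idtac.

(* A Q-algebra: a commutative ring, possibly zero, with a ring map from Q.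
   That map is unique when it exists, so ring morphisms between Q-algebras are
   automatically Q-linear. *)
Record qalg := QAlg {
  qalg_sort :> comPzRingType;
  qalg_map : {rmorphism rat -> qalg_sort}
}.

Definition Qalg : qalg := QAlg (idfun : {rmorphism rat -> rat}).

Definition structure_map (A : qalg) : {rmorphism Qalg -> A} := qalg_map A.

Definition is_field (A : qalg) :=
  (1 : A) <> 0 /\ forall a : A, a <> 0 -> exists b, a * b = 1.

(* Schemes over Q are treated through their functors of points (Demazure and
   Gabriel, Groupes algebriques, I.1): a scheme is a functor from Q-algebras
   to sets which is a Zariski sheaf and is covered by open affine subfunctors. *)
Record qfunctor := QFunctor {
  points :> qalg -> Type;
  pmap : forall A B : qalg, {rmorphism A -> B} -> points A -> points B;
  pmap_id : forall (A : qalg) (f : {rmorphism A -> A}) x,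
    f =1 id -> pmap f x = x;
  pmap_comp : forall (A B C : qalg) (f : {rmorphism A -> B})
      (g : {rmorphism B -> C}) (h : {rmorphism A -> C}) x,
    h =1 g \o f -> pmap h x = pmap g (pmap f x)
}.

Record qmor (X Y : qfunctor) := QMor {
  mor :> forall A : qalg, X A -> Y A;
  mor_nat : forall (A B : qalg) (f : {rmorphism A -> B}) (x : X A),
    mor (pmap f x) = pmap f (mor x)
}.

Record subfunctor (X : qfunctor) := SubFunctor {
  mem_sub :> forall A : qalg, X A -> Prop;
  mem_sub_map : forall (A B : qalg) (f : {rmorphism A -> B}) (x : X A),
    mem_sub x -> mem_sub (pmap f x)
}.
Arguments SubFunctor {X} mem_sub mem_sub_map.

Program Definition mor_comp (X Y Z : qfunctor) (g : qmor Y Z) (f : qmor X Y) :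
  qmor X Z := QMor (mor := fun A x => g A (f A x)) _.
Next Obligation. by move=> X Y Z g f A B u x /=; rewrite !mor_nat. Qed.

Program Definition sub_qfunctor (X : qfunctor) (U : subfunctor X) : qfunctor :=
  @QFunctor (fun A => {x : X A | U A x})
    (fun A B f x => exist _ (pmap f (sval x)) (mem_sub_map f (svalP x))) _ _.
Next Obligation.
by move=> X U A f [x xU] fid; apply: eq_exist => /=; apply: pmap_id.
Qed.
Next Obligation.
by move=> X U A B C f g h [x xU] hE; apply: eq_exist => /=; apply: pmap_comp.
Qed.

Program Definition prod_qfunctor (X Y : qfunctor) : qfunctor :=
  @QFunctor (fun A => (X A * Y A)%type)
    (fun A B f z => (pmap f z.1, pmap f z.2)) _ _.
Next Obligation. by move=> X Y A f [x y] fid /=; rewrite !pmap_id. Qed.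
Next Obligation.
by move=> X Y A B C f g h [x y] hE /=; rewrite -!(pmap_comp _ hE).
Qed.

Program Definition fibre_cond (X Y S : qfunctor) (h : qmor X S) (g : qmor Y S) :
  subfunctor (prod_qfunctor X Y) :=
  SubFunctor (X := prod_qfunctor X Y) (fun A z => h A z.1 = g A z.2) _.
Next Obligation. by move=> X Y S h g A B f [x y] /= e; rewrite !mor_nat e. Qed.

Definition fibre_product (X Y S : qfunctor) (h : qmor X S) (g : qmor Y S) :=
  sub_qfunctor (fibre_cond h g).

Program Definition fibre_snd (X Y S : qfunctor) (h : qmor X S) (g : qmor Y S) :
  qmor (fibre_product h g) Y :=
  @QMor (fibre_product h g) Y (fun A z => (sval z).2) _.
Next Obligation. by []. Qed.

Program Definition diagonal (X S : qfunctor) (h : qmor X S) :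
  subfunctor (fibre_product h h) :=
  SubFunctor (X := fibre_product h h) (fun A z => (sval z).1 = (sval z).2) _.
Next Obligation. by move=> X S h A B f [[x y] hxy] /= ->. Qed.

Program Definition SpecQ : qfunctor :=
  @QFunctor (fun=> unit) (fun _ _ _ _ => tt) _ _.
Next Obligation. by move=> A f []. Qed.
Next Obligation. by []. Qed.

Program Definition structure_mor (X : qfunctor) : qmor X SpecQ :=
  @QMor X SpecQ (fun _ _ => tt) _.
Next Obligation. by []. Qed.

Definition unit_ideal (A : qalg) (J : set A) :=
  exists n (s c : 'I_n -> A), (forall i, J (s i)) /\ \sum_i c i * s i = 1.

(* The preimage of [U] in Spec A under each point of [X A] has to be the open
   subscheme of Spec A whose complement is the zero locus of a set [J]. *)
Definition is_open (X : qfunctor) (U : subfunctor X) :=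
  forall (A : qalg) (x : X A), exists J : set A,
  forall (B : qalg) (f : {rmorphism A -> B}),
    U B (pmap f x) <-> unit_ideal (f @` J).

Definition is_closed (X : qfunctor) (Z : subfunctor X) :=
  forall (A : qalg) (x : X A), exists J : set A,
  forall (B : qalg) (f : {rmorphism A -> B}),
    Z B (pmap f x) <-> forall a, J a -> f a = 0.

(* [U] is isomorphic to Spec A, with [u] as universal point. *)
Definition represented_by (X : qfunctor) (U : subfunctor X) (A : qalg)
    (u : X A) :=
  U A u /\
  forall (B : qalg) (x : X B), U B x ->
    exists f : {rmorphism A -> B}, pmap f u = x /\
      forall g : {rmorphism A -> B}, pmap g u = x -> g =1 f.

Definition affine_open (X : qfunctor) (U : subfunctor X) (A : qalg) (u : X A) :=
  is_open U /\ represented_by U u.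

Definition is_localization (A B : qalg) (f : A) (phi : {rmorphism A -> B}) :=
  [/\ exists b, phi f * b = 1,
      forall b, exists a n, phi f ^+ n * b = phi a
    & forall a, phi a = 0 -> exists n, f ^+ n * a = 0].

(* In the compatibility condition it would be enough to take for [B] the
   localization of [A] at [f i * f j]: it is the universal such [B]. *)
Definition zariski_sheaf (X : qfunctor) :=
  forall (A : qalg) n (f : 'I_n -> A) (D : 'I_n -> qalg)
    (phi : forall i, {rmorphism A -> D i}),
    (exists c : 'I_n -> A, \sum_i c i * f i = 1) ->
    (forall i, is_localization (f i) (phi i)) ->
  forall x : (forall i, X (D i)),
    (forall i j (B : qalg) (u : {rmorphism D i -> B})
        (v : {rmorphism D j -> B}),
      (forall a, u (phi i a) = v (phi j a)) -> pmap u (x i) = pmap v (x j)) ->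
  exists! x0 : X A, forall i, pmap (phi i) x0 = x i.

Definition is_scheme (X : qfunctor) :=
  zariski_sheaf X /\
  forall (K : qalg) (x : X K), is_field K ->
    exists (U : subfunctor X) (A : qalg) (u : X A), affine_open U u /\ U K x.

Definition nonempty (X : qfunctor) (U : subfunctor X) :=
  exists (K : qalg) (x : X K), is_field K /\ U K x.

Definition meets (X : qfunctor) (U V : subfunctor X) :=
  exists (K : qalg) (x : X K), [/\ is_field K, U K x & V K x].

Definition is_irreducible (X : qfunctor) :=
  (exists K : qalg, is_field K /\ inhabited (X K)) /\
  forall U V : subfunctor X, is_open U -> is_open V ->
    nonempty U -> nonempty V -> meets U V.

Definition is_reduced (X : qfunctor) :=
  forall (U : subfunctor X) (A : qalg) (u : X A), affine_open U u ->
  forall (a : A) n, a ^+ n = 0 -> a = 0.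

Definition finitely_generated (A B : qalg) (f : {rmorphism A -> B}) :=
  exists n (s : 'I_n -> B), forall P : set B,
    (forall a, P (f a)) -> (forall i, P (s i)) ->
    (forall a b, P a -> P b -> P (a + b)) ->
    (forall a b, P a -> P b -> P (a * b)) ->
  forall b, P b.

Definition finite_type (X S : qfunctor) (h : qmor X S) :=
  forall (V : subfunctor S) (A : qalg) (v : S A), affine_open V v ->
  exists n (U : 'I_n -> subfunctor X),
    (forall i, exists (B : qalg) (u : X B) (f : {rmorphism A -> B}),
       [/\ affine_open (U i) u, h B u = pmap f v & finitely_generated f]) /\
    forall (K : qalg) (x : X K), is_field K -> V K (h K x) ->
      exists i, U i K x.

Definition separated_mor (X S : qfunctor) (h : qmor X S) :=
  is_closed (diagonal h).

Definition closed_map (X S : qfunctor) (h : qmor X S) :=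
  forall Z : subfunctor X, is_closed Z ->
  exists W : subfunctor S, is_closed W /\
  forall (K : qalg) (s : S K), is_field K ->
    (W K s <->
     exists (L : qalg) (g : {rmorphism K -> L}) (z : X L),
       [/\ is_field L, Z L z & h L z = pmap g s]).

Definition universally_closed (X S : qfunctor) (h : qmor X S) :=
  forall (T : qfunctor) (t : qmor T S), is_scheme T ->
    closed_map (fibre_snd h t).

Definition proper_mor (X S : qfunctor) (h : qmor X S) :=
  [/\ separated_mor h, finite_type h & universally_closed h].

Definition is_variety (X : qfunctor) :=
  [/\ is_scheme X, is_irreducible X, is_reduced X, separated_mor (structure_mor X)
    & finite_type (structure_mor X)].

(* Over Q finite generation is the same as finite presentation. *)
Definition smooth_algebra (A : qalg) :=
  finitely_generated (structure_map A) /\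
  forall (B C : qalg) (q : {rmorphism B -> C}),
    (forall c, exists b, q b = c) ->
    (forall a b, q a = 0 -> q b = 0 -> a * b = 0) ->
  forall g : {rmorphism A -> C}, exists g' : {rmorphism A -> B}, g =1 q \o g'.

Definition smooth_at (X : qfunctor) (K : qalg) (x : X K) :=
  exists (U : subfunctor X) (A : qalg) (u : X A),
    [/\ affine_open U u, smooth_algebra A & U K x].

Definition is_smooth (X : qfunctor) :=
  forall (K : qalg) (x : X K), is_field K -> smooth_at x.

(* An [A]-point lies in an open subscheme as soon as all the field-valued
   points of Spec A are mapped into it. *)
Program Definition smooth_locus (X : qfunctor) : subfunctor X :=
  SubFunctor (fun A x => forall (K : qalg) (f : {rmorphism A -> K}),
    is_field K -> smooth_at (pmap f x)) _.
Next Obligation.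
move=> X A B f x xs K g Kf.
by rewrite -(@pmap_comp _ _ _ _ f g (g \o f : {rmorphism A -> K})) //; apply: xs.
Qed.

Definition iso_between (X Y : qfunctor) (h : qmor X Y)
    (U : subfunctor X) (V : subfunctor Y) :=
  (forall (A : qalg) (x : X A), U A x -> V A (h A x)) /\
  forall (A : qalg) (y : Y A), V A y -> exists! x : X A, U A x /\ h A x = y.

Program Definition preimage_sub (X Y : qfunctor) (h : qmor X Y)
  (V : subfunctor Y) : subfunctor X := SubFunctor (fun A x => V A (h A x)) _.
Next Obligation.
by move=> X Y h V A B f x /= Vx; rewrite mor_nat; apply: mem_sub_map.
Qed.

Definition dense_open (X : qfunctor) (U : subfunctor X) :=
  is_open U /\
  forall V : subfunctor X, is_open V -> nonempty V -> meets U V.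

Definition birational (X Y : qfunctor) (h : qmor X Y) :=
  exists (U : subfunctor X) (V : subfunctor Y),
    [/\ dense_open U, dense_open V & iso_between h U V].

Definition desingularisation (X' X : qfunctor) (rho : qmor X' X) :=
  [/\ is_variety X', is_smooth X', proper_mor rho, birational rho
    & iso_between rho (preimage_sub rho (smooth_locus X)) (smooth_locus X)].

(* An element of P^(n-1)(A) is a direct summand of rank 1 of A^n, that is, the
   image of an idempotent matrix whose rank is 1 at every point of Spec A. *)
Definition is_line (A : comPzRingType) n (L : set 'rV[A]_n) :=
  exists e : 'M[A]_n,
    [/\ e *m e = e, L = range (fun u : 'rV[A]_n => u *m e)
      & forall (K : fieldType) (f : {rmorphism A -> K}),
          \rank (map_mx f e) = 1%N].

Definition base_change (A B : comPzRingType) (f : {rmorphism A -> B}) n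
    (L : set 'rV[A]_n) : set 'rV[B]_n :=
  [set w | exists k (c : 'I_k -> B) (u : 'I_k -> 'rV[A]_n),
     (forall i, L (u i)) /\ w = \sum_i c i *: map_mx f (u i)].

Lemma base_change_range (A B : comPzRingType) (f : {rmorphism A -> B}) n
    (e : 'M[A]_n) :
  base_change f (range (fun u : 'rV[A]_n => u *m e)) =
  range (fun w : 'rV[B]_n => w *m map_mx f e).
Proof.
apply/seteqP; split=> w.
- case=> k [c [u [uL ->]]].
  have /choice[z zE] : forall i, exists z : 'rV[A]_n, z *m e = u i.
    by move=> i; case: (uL i) => z _ zE; exists z.
  exists (\sum_i c i *: map_mx f (z i)) => //.
  rewrite mulmx_suml; apply: eq_bigr => i _.
  by rewrite -scalemxAl -map_mxM zE.
- case=> z _ <-; exists n, (z 0), (fun i => row i e); split.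
    by move=> i; exists (delta_mx 0 i) => //; rewrite -rowE.
  by rewrite mulmx_sum_row; apply: eq_bigr => i _; rewrite map_row.
Qed.

Lemma is_line_base_change (A B : comPzRingType) (f : {rmorphism A -> B}) n
    (L : set 'rV[A]_n) : is_line L -> is_line (base_change f L).
Proof.
case=> e [ee -> rk]; exists (map_mx f e); split.
- by rewrite -map_mxM ee.
- exact: base_change_range.
- move=> K g; rewrite -(rk K (g \o f : {rmorphism A -> K})); congr (\rank _).
  by apply/matrixP => i j; rewrite !mxE.
Qed.

Program Definition P3 : qfunctor :=
  @QFunctor (fun A => {L : set 'rV[A]_4 | is_line L})
    (fun A B f L => exist _ (base_change f (sval L))
                            (is_line_base_change f (svalP L))) _ _.
Next Obligation.
move=> A f [L lL] fid; apply: eq_exist => /=.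
case: lL => e [_ -> _]; rewrite base_change_range.
by have -> : map_mx f e = e by apply/matrixP => i j; rewrite mxE fid.
Qed.
Next Obligation.
move=> A B C f g h [L lL] hE; apply: eq_exist => /=.
case: lL => e [_ -> _]; rewrite !base_change_range.
have -> // : map_mx h e = map_mx g (map_mx f e).
by apply/matrixP => i j; rewrite !mxE hE.
Qed.

Definition on_Y (A : comPzRingType) (M : set 'rV[A]_4) :=
  forall y, M y -> y 0 0 * y 0 1 = y 0 2 * y 0 3.

Definition on_X (A : comPzRingType) (L M : set 'rV[A]_4) :=
  (forall x y, L x -> M y ->
     y 0 0 * x 0 0 ^+ 2 + y 0 1 * x 0 1 ^+ 2 +
     y 0 2 * x 0 2 ^+ 2 + y 0 3 * x 0 3 ^+ 2 = 0) /\
  on_Y M.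

Lemma base_change_ind (A B : comPzRingType) (f : {rmorphism A -> B}) n
    (L : set 'rV[A]_n) (P : 'rV[B]_n -> Prop) :
  P 0 -> (forall u v, P u -> P v -> P (u + v)) ->
  (forall c u, P u -> P (c *: u)) -> (forall u, L u -> P (map_mx f u)) ->
  forall w, base_change f L w -> P w.
Proof.
move=> P0 PD PZ PL w [k [c [u [uL ->]]]].
by apply: (big_ind P) => // i _; apply: PZ; apply: PL.
Qed.

Lemma is_lineD (A : comPzRingType) n (L : set 'rV[A]_n) u v :
  is_line L -> L u -> L v -> L (u + v).
Proof.
case=> e [_ -> _] [u' _ <-] [v' _ <-].
by exists (u' + v') => //; rewrite mulmxDl.
Qed.

Lemma qalg_half (A : qalg) (a : A) : a + a = 0 -> a = 0.
Proof.
move=> a0; have E : qalg_map A 2^-1 * (a + a) = a.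
  rewrite -mulr2n -[a *+ 2]mulr_natl mulrA -(rmorph_nat (qalg_map A)) -rmorphM.
  by rewrite mulVf // rmorph1 mul1r.
by rewrite -E a0 mulr0.
Qed.

Lemma on_Y_base_change (A B : qalg) (f : {rmorphism A -> B}) (M : set 'rV[A]_4) :
  is_line M -> on_Y M -> on_Y (base_change f M).
Proof.
move=> lM hM.
pose b (C : comPzRingType) (y z : 'rV[C]_4) :=
  y 0 0 * z 0 1 + z 0 0 * y 0 1 - (y 0 2 * z 0 3 + z 0 2 * y 0 3).
have b0 y z : M y -> M z -> b A y z = 0.
  move=> My Mz; have := hM _ (is_lineD lM My Mz); have := hM _ My; have := hM _ Mz.
  rewrite /b !mxE => e1 e2 e3.
  have H (p q r s t u v w : A) : p * q = r * s -> t * u = v * w ->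
      (p + t) * (q + u) = (r + v) * (s + w) ->
      p * u + t * q - (r * w + v * s) = 0.
    move=> h1 h2 h3; apply/eqP; rewrite subr_eq0; apply/eqP.
    move: h3; rewrite !mulrDl !mulrDr h1 h2 !addrA => /addIr.
    by rewrite -!addrA => /addrI.
  exact: H e2 e1 e3.
have b1 y z : base_change f M y -> M z -> b B y (map_mx f z) = 0.
  move=> My Mz; elim/base_change_ind: y / My => [|u v hu hv|c u hu|u Lu].
  - by rewrite /b !mxE; ring.
  - by rewrite -[RHS](addr0 0) -{1}hu -hv /b !mxE; ring.
  - by rewrite -[RHS](mulr0 c) -hu /b !mxE; ring.
  - by rewrite -(rmorph0 f) -(b0 _ _ Lu Mz) /b !mxE !(rmorphB, rmorphD, rmorphM).
have b2 y z : base_change f M y -> base_change f M z -> b B y z = 0.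
  move=> My Mz; elim/base_change_ind: z / Mz => [|u v hu hv|c u hu|u Lu].
  - by rewrite /b !mxE; ring.
  - by rewrite -[RHS](addr0 0) -{1}hu -hv /b !mxE; ring.
  - by rewrite -[RHS](mulr0 c) -hu /b !mxE; ring.
  - exact: b1.
move=> y My; apply/eqP; rewrite -subr_eq0; apply/eqP; apply: qalg_half.
by rewrite -[RHS](b2 _ _ My My) /b; ring.
Qed.

Lemma on_X_base_change (A B : qalg) (f : {rmorphism A -> B})
    (L M : set 'rV[A]_4) :
  is_line L -> is_line M -> on_X L M -> on_X (base_change f L) (base_change f M).
Proof.
move=> lL lM [hLM hM]; split; last exact: on_Y_base_change.
pose b (C : comPzRingType) (y x z : 'rV[C]_4) :=
  y 0 0 * (x 0 0 * z 0 0) + y 0 1 * (x 0 1 * z 0 1) +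
  y 0 2 * (x 0 2 * z 0 2) + y 0 3 * (x 0 3 * z 0 3).
have b0 y x z : M y -> L x -> L z -> b A y x z = 0.
  move=> My Lx Lz; apply: qalg_half.
  have := hLM _ _ (is_lineD lL Lx Lz) My.
  have := hLM _ _ Lx My; have := hLM _ _ Lz My.
  rewrite !mxE /b => e1 e2 e3.
  transitivity (0 - 0 - 0 : A); last by rewrite !subr0.
  by rewrite -{1}e3 -{1}e2 -e1; ring.
have b1 y x z : base_change f M y -> L x -> L z ->
    b B y (map_mx f x) (map_mx f z) = 0.
  move=> My Lx Lz; elim/base_change_ind: y / My => [|u v hu hv|c u hu|u Lu].
  - by rewrite /b !mxE; ring.
  - by rewrite -[RHS](addr0 0) -{1}hu -hv /b !mxE; ring.
  - by rewrite -[RHS](mulr0 c) -hu /b !mxE; ring.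
  - by rewrite -(rmorph0 f) -(b0 _ _ _ Lu Lx Lz) /b !mxE !(rmorphD, rmorphM).
have b2 y x z : base_change f M y -> base_change f L x -> L z ->
    b B y x (map_mx f z) = 0.
  move=> My Lx Lz; elim/base_change_ind: x / Lx => [|u v hu hv|c u hu|u Lu].
  - by rewrite /b !mxE; ring.
  - by rewrite -[RHS](addr0 0) -{1}hu -hv /b !mxE; ring.
  - by rewrite -[RHS](mulr0 c) -hu /b !mxE; ring.
  - exact: b1.
have b3 y x z : base_change f M y -> base_change f L x -> base_change f L z ->
    b B y x z = 0.
  move=> My Lx Lz; elim/base_change_ind: z / Lz => [|u v hu hv|c u hu|u Lu].
  - by rewrite /b !mxE; ring.
  - by rewrite -[RHS](addr0 0) -{1}hu -hv /b !mxE; ring.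
  - by rewrite -[RHS](mulr0 c) -hu /b !mxE; ring.
  - exact: b2.
by move=> x y Lx My; rewrite !expr2; apply: b3.
Qed.

Program Definition Y : qfunctor :=
  sub_qfunctor (X := P3) (SubFunctor (fun A M => on_Y (sval M)) _).
Next Obligation.
by move=> A B f [M lM] /=; apply: on_Y_base_change.
Qed.

Program Definition X : qfunctor :=
  sub_qfunctor (X := prod_qfunctor P3 P3)
    (SubFunctor (X := prod_qfunctor P3 P3)
       (fun A LM => on_X (sval LM.1) (sval LM.2)) _).
Next Obligation.
by move=> A B f [[L lL] [M lM]] /=; apply: on_X_base_change.
Qed.

Program Definition pi_XY : qmor X Y :=
  @QMor X Y (fun A z => exist _ (sval z).2 (svalP z).2) _.
Next Obligation. by move=> A B f [[L M] h]; apply: eq_exist. Qed.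

Definition real_qalg (R : realType) : qalg :=
  QAlg (ratr : {rmorphism rat -> R}).

Definition padic_qalg (p : nat) : qalg :=
  QAlg (@rat_Qp p : {rmorphism rat -> Qp p}).

Inductive place := RealPlace | FinitePlace (p : nat) of prime p.

Definition completion (R : realType) (v : place) : qalg :=
  match v with
  | RealPlace => real_qalg R
  | FinitePlace p _ => padic_qalg p
  end.

(* [y] is in the image of the adelic points of [X']: the fibre of [h] over [y]
   has a Q_v-point for every place v. *)
Definition everywhere_locally_soluble (R : realType) (X' : qfunctor)
    (h : qmor X' Y) (y : Y Qalg) :=
  forall v : place, exists x : X' (completion R v),
    h _ x = pmap (structure_map (completion R v)) y.

Definition primitive_repr (y : Y Qalg) (v : 'rV[int]_4) :=
  \big[gcdn/0%N]_(i < 4) absz (v 0 i) = 1%N /\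
  sval (sval y) = [set c *: map_mx intr v | c in [set: rat]].

(* [primitive_repr y] consists of two opposite vectors. *)
Definition height (y : Y Qalg) : nat :=
  ((\max_(i < 4) absz (xget 0%R (primitive_repr y) 0%R i)) ^ 2)%N.

(* [fset_set] is empty on infinite sets; these ones are finite. *)
Definition N_loc (R : realType) (X' : qfunctor) (h : qmor X' Y) (B : R) : nat :=
  #|` fset_set [set y : {classic Y Qalg} |
        (height y)%:R <= B /\ everywhere_locally_soluble R h y]|.

(* Main.v *)
From HB Require Import structures.
Require Import Defs.
From mathcomp Require Import all_boot all_order all_algebra.
From mathcomp Require Import all_classical all_reals topology normedtype.
From mathcomp Require Import finmap ring lra zify.
Set Implicit Arguments. Unset Strict Implicit. Unset Printing Implicit Defensive.
Import Order.TTheory GRing.Theory Num.Theory.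
Local Open Scope ring_scope.

(** The surface [Y] is a product of two projective lines, through
    [y = (a c, b d, a d, b c)], and the height of [y] is the square of
    [max (|a|, |b|) max (|c|, |d|)] for coprime [a, b] and coprime [c, d].  The
    fibre over [y] is the quadric
    [a c x_0^2 + b d x_1^2 + a d x_2^2 + b c x_3^2 = 0], whose discriminant is a
    square, so that its local solubility is governed by the quaternion algebra
    [(- a b, - c d)].

    Lower bound.  Over the four lines [a b c d = 0] the fibre is a pair of
    planes, for instance [d x_1^2 + c x_3^2 = 0] when [a = 0, b = 1], and
    [x = (1, 0, 0, 0)] is a rational point of it at which the total space [X] is
    smooth: where [x_0 = y_1 = 1], the equation of [X] reads
    [y_2 (y_3 + x_2^2) + x_1^2 + y_3 x_3^2 = 0], and it can be solved for [y_2]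
    as soon as [t = y_3 + x_2^2] is invertible, which makes this open set the
    spectrum of [Q[x_1, x_2, x_3, t, 1 / t]] ([chart_smooth]).  A
    desingularisation is an isomorphism over such a point, hence the fibre of
    the desingularisation has a rational point over [y = (0, d, 0, c)]
    ([smooth_point_soluble]), and one pair [c, d] in four at least is coprime
    ([sum_coprime_pairs]).

    Upper bound.  The points of the four lines are [O(B)] in number
    ([line_count]).  For the others only a consequence of [p]-adic solubility is
    kept: if [p] divides [a] exactly once and does not divide [b c d], then
    [- c d] is a square modulo [p], and similarly with the roles of the
    variables exchanged ([local_zero_not_bad]).  This excludes a proportion of
    about [2 / p] of the quadruples ([density_bad_ge]).  In the box where [a, b]
    are at most [2^i] and [c, d] at most [2^j], Brun's sieve then saves at least a
    constant times [k^(9/8)], where [k = min (i, j)] ([box_bound]).  The quadruples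
    of height at most [B] lie in boxes with [4^(i + j) << B].  There are about
    [log B] boxes of the largest size, hence [B log B] quadruples without the
    condition, but the savings have a convergent sum over [k], and [O(B)]
    quadruples satisfy it ([unobstructed_bound]). *)

(** * Truncated inclusion-exclusion *)

(** The elementary symmetric functions of a list. The recursion on the list lets
    the sieve below be proved by adding one condition at a time. *)
Fixpoint elsym (xs : seq rat) (j : nat) : rat :=
  if j is i.+1 then
    if xs is x :: xs' then elsym xs' j + x * elsym xs' i else 0
  else 1.

Definition bonferroni (xs : seq rat) (r : nat) : rat :=
  \sum_(j < r.+1) (-1) ^+ j * elsym xs j.

Lemma elsym0 xs : elsym xs 0 = 1.
Proof. by case: xs. Qed.

Lemma elsym_ge0 xs j : {in xs, forall x, 0 <= x} -> 0 <= elsym xs j.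
Proof.
elim: xs j => [|x xs IH] [|j] //= xs0.
have h i : 0 <= elsym xs i by apply: IH => y yx; apply: xs0; rewrite inE yx orbT.
by rewrite addr_ge0 ?mulr_ge0 ?h // xs0 // inE eqxx.
Qed.

Lemma bonferroniS xs r :
  bonferroni xs r.+1 = bonferroni xs r + (-1) ^+ r.+1 * elsym xs r.+1.
Proof. by rewrite /bonferroni big_ord_recr. Qed.

Lemma bonferroni0 xs : bonferroni xs 0 = 1.
Proof. by rewrite /bonferroni big_ord1 expr0 mul1r elsym0. Qed.

Lemma bonferroni_cons x xs r :
  bonferroni (x :: xs) r.+1 = bonferroni xs r.+1 - x * bonferroni xs r.
Proof.
elim: r => [|r IH]; first by rewrite !bonferroniS !bonferroni0 /= elsym0 !expr1; ring.
rewrite [in LHS]bonferroniS IH (bonferroniS xs r.+1) (bonferroniS xs r) [elsym (_ :: _) _]/= !exprS; ring.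
Qed.

(** When the first entry is [1], the sum telescopes to the last symmetric function of
    the other entries, whose sign is that of [(-1) ^ r]. *)
Lemma bonferroni_upper (bs : seq bool) r : ~~ odd r ->
  (all negb bs)%:R <= bonferroni [seq b%:R | b : bool <- bs] r.
Proof.
move=> re; elim: bs => [|b bs IH] /=.
  rewrite /bonferroni big_ord_recl /= mul1r big1 ?addr0 // => i _.
  by rewrite mulr0.
case: r re IH => [|r] re IH; first by rewrite !bonferroni0; case: b => //=; case: all.
rewrite bonferroni_cons; case: b => /=; last by rewrite mul0r subr0.
rewrite mul1r bonferroniS addrAC subrr add0r -signr_odd /= in re *.
rewrite (negPf re) mul1r; apply: elsym_ge0 => x /mapP[b _ ->]; exact: ler0n.
Qed.

(** The left side is a part of the expansion of the product. The value [t = 1] bounds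
    the sum of the error terms of the sieve, and [t = 2] the terms left out. *)
Lemma elsym_gen_le (t : rat) xs r : 0 <= t -> {in xs, forall x, 0 <= x} ->
  \sum_(j < r) t ^+ j * elsym xs j <= \prod_(x <- xs) (1 + t * x).
Proof.
move=> t0; elim: xs r => [|x xs IH] r xs0.
  rewrite big_nil; case: r => [|r]; first by rewrite big_ord0.
  rewrite big_ord_recl /= mul1r big1 ?addr0 // => i _; exact: mulr0.
have x0 : 0 <= x by apply: xs0; rewrite inE eqxx.
have {}xs0 : {in xs, forall y, 0 <= y} by move=> y yx; apply: xs0; rewrite inE yx orbT.
rewrite big_cons; case: r => [|r].
  rewrite big_ord0 mulr_ge0 ?addr_ge0 ?mulr_ge0 //.
  by apply: le_trans (IH 0%N xs0); rewrite big_ord0.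
have -> : \sum_(j < r.+1) t ^+ j * elsym (x :: xs) j =
   \sum_(j < r.+1) t ^+ j * elsym xs j + t * x * \sum_(j < r) t ^+ j * elsym xs j.
  rewrite !big_ord_recl /= elsym0 -addrA; congr (_ + _).
  rewrite mulr_sumr -big_split; apply: eq_bigr => i _ /=.
  by rewrite /bump /= add1n exprS; ring.
rewrite mulrDl mul1r lerD ?IH // ler_wpM2l ?mulr_ge0 ?IH //.
Qed.

(** Truncation costs at most the first term left out: the recursion on the list that
    computes this term also bounds the difference. *)
Lemma bonferroni_approx xs r : {in xs, forall x, 0 <= x <= 1} ->
  `|bonferroni xs r - \prod_(x <- xs) (1 - x)| <= elsym xs r.+1.
Proof.
elim: xs r => [|x xs IH] r xs0.
  rewrite big_nil /bonferroni big_ord_recl /= mul1r big1 ?addr0 ?subrr ?normr0 // => i _.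
  exact: mulr0.
have /andP[x0 x1] : 0 <= x <= 1 by apply: xs0; rewrite inE eqxx.
have {}xs0 : {in xs, forall y, 0 <= y <= 1} by move=> y yx; apply: xs0; rewrite inE yx orbT.
have p0 : 0 <= \prod_(x <- xs) (1 - x).
  by rewrite big_seq prodr_ge0 // => y /xs0 /andP[]; lra.
have p1 : \prod_(x <- xs) (1 - x) <= 1.
  by rewrite big_seq prodr_ile1 // => y /xs0 /andP[]; lra.
rewrite big_cons; case: r => [|r].
  rewrite bonferroni0 /= elsym0 mulr1.
  have := IH 0%N xs0; rewrite bonferroni0 !ler_norml => /andP[h1 h2].
  nra.
rewrite bonferroni_cons [elsym _ _]/=.
set P := \prod_(_ <- _) _.
have -> : bonferroni xs r.+1 - x * bonferroni xs r - (1 - x) * P =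
  (bonferroni xs r.+1 - P) - x * (bonferroni xs r - P) by ring.
apply: le_trans (ler_normB _ _) _; rewrite normrM (ger0_norm x0).
by rewrite lerD ?IH // ler_wpM2l ?IH.
Qed.

(** * Brun's sieve *)

Section BrunSieve.
Variables (I : eqType) (T : finType) (bad : I -> pred T) (g : I -> rat).
Variables (eps : rat) (P : seq I) (r : nat).
Hypotheses (g01 : {in P, forall i, 0 <= g i <= 1}) (uP : uniq P).
Hypothesis equidistributed : forall D : seq I, uniq D -> {subset D <= P} ->
  (size D <= r)%N ->
  `|#|[pred w | all (bad^~ w) D]|%:R - #|T|%:R * \prod_(i <- D) g i|
    <= eps * (#|T|%:R * \prod_(i <- D) g i).

Let x (i : I) (w : T) : rat := (bad i w)%:R.

Lemma prod_indicator D w : \prod_(i <- D) x i w = (all (bad^~ w) D)%:R.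
Proof.
elim: D => [|i D IH]; first by rewrite big_nil.
by rewrite big_cons IH /x /=; case: bad; rewrite ?mul1r ?mul0r.
Qed.

(** The conditions in [D] are those already imposed: carrying them along turns the
    recursion of [elsym] into an induction on the list [Q] of the other conditions. *)
Lemma sum_elsym_approx D Q j : uniq (D ++ Q) -> {subset D ++ Q <= P} ->
  (size D + j <= r)%N ->
  `|\sum_w \prod_(i <- D) x i w * elsym [seq x i w | i <- Q] j
     - #|T|%:R * (\prod_(i <- D) g i * elsym [seq g i | i <- Q] j)|
    <= eps * (#|T|%:R * (\prod_(i <- D) g i * elsym [seq g i | i <- Q] j)).
Proof.
elim: Q D j => [|q Q IH] D j.
  rewrite cats0 => uD sD sz; case: j sz => [|j] sz /=; last first.
    by rewrite !mulr0 subr0 big1 ?normr0 // => w _; rewrite mulr0.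
  rewrite !mulr1; under eq_bigr do rewrite mulr1 prod_indicator.
  rewrite -natr_sum -[X in X%:R - _]big_mkcond sum1_card.
  by apply: equidistributed => //; rewrite -[size D]addn0.
move=> uqDQ sDQ sz.
have {}uqDQ : uniq (q :: D ++ Q) by rewrite -cat1s uniq_catCA.
have {}sDQ : {subset q :: D ++ Q <= P}.
  move=> i h; apply: sDQ; move: h.
  by rewrite !(inE, mem_cat) => /or3P[] ->; rewrite ?orbT.
have uDQ : uniq (D ++ Q) by case/andP: uqDQ.
have sDQ2 : {subset D ++ Q <= P} by move=> i h; apply: sDQ; rewrite inE h orbT.
case: j sz => [|j] sz.
  have e0 : \sum_w \prod_(i <- D) x i w * elsym [seq x i w | i <- q :: Q] 0
    = \sum_w \prod_(i <- D) x i w * elsym [seq x i w | i <- Q] 0.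
    by apply: eq_bigr => w _; rewrite !elsym0.
  by have := IH D 0%N uDQ sDQ2 sz; rewrite e0 !elsym0.
have h1 := IH D j.+1 uDQ sDQ2 sz.
have h2 : _ := IH (q :: D) j uqDQ sDQ _.
rewrite /= addSn -addnS in h2; have {}h2 := h2 sz.
have eS : \sum_w \prod_(i <- D) x i w * elsym [seq x i w | i <- q :: Q] j.+1
  = \sum_w \prod_(i <- D) x i w * elsym [seq x i w | i <- Q] j.+1
    + \sum_w \prod_(i <- q :: D) x i w * elsym [seq x i w | i <- Q] j.
  rewrite -big_split; apply: eq_bigr => w _ /=.
  by rewrite big_cons mulrDr; congr (_ + _); ring.
rewrite eS map_cons [elsym (_ :: _) _]/=; move: h1 h2; rewrite big_cons.
by rewrite !ler_norml; lra.
Qed.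

(** Brun's pure sieve. Only the sets of at most [r] conditions occur, for which
    equidistribution is assumed. As the error [eps] is relative to the expected
    cardinal, the errors add up to [eps] times a product. *)
Lemma brun_sieve : ~~ odd r -> 0 <= eps ->
  #|[pred w | all (fun i => ~~ bad i w) P]|%:R <=
  #|T|%:R * (\prod_(i <- P) (1 - g i) + elsym [seq g i | i <- P] r.+1
             + eps * \prod_(i <- P) (1 + g i)).
Proof.
move=> re eps0.
have -> : #|[pred w | all (fun i => ~~ bad i w) P]|%:R =
   \sum_w (all negb [seq bad i w | i <- P])%:R :> rat.
  rewrite -natr_sum -sum1_card [in LHS]big_mkcond; congr (_%:R).
  apply: eq_bigr => w _; rewrite inE all_map.
  by rewrite (eq_all (a2 := fun i => ~~ bad i w)) //; case: all.
apply: le_trans (_ : \sum_w bonferroni [seq x i w | i <- P] r <= _).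
  apply: ler_sum => w _; have := bonferroni_upper [seq bad i w | i <- P] re.
  by rewrite -map_comp.
have g0 : {in [seq g i | i <- P], forall y, 0 <= y <= 1}.
  by move=> y /mapP[i /g01 h ->].
have g0' : {in [seq g i | i <- P], forall y, 0 <= y} by move=> y /g0 /andP[].
have B : \sum_w bonferroni [seq x i w | i <- P] r <=
   #|T|%:R * bonferroni [seq g i | i <- P] r
   + eps * #|T|%:R * \sum_(j < r.+1) elsym [seq g i | i <- P] j.
  rewrite /bonferroni exchange_big /= !mulr_sumr -big_split; apply: ler_sum => j _ /=.
  have := @sum_elsym_approx [::] P j uP (fun=> id) _; rewrite add0n -ltnS => /(_ (ltn_ord j)).
  have -> : \sum_w \prod_(i <- [::]) x i w * elsym [seq x i w | i <- P] j
    = \sum_w elsym [seq x i w | i <- P] j.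
    by apply: eq_bigr => w _; rewrite big_nil mul1r.
  rewrite big_nil mul1r -mulr_sumr ler_norml => /andP[h1 h2].
  by rewrite -signr_odd; case: odd; rewrite ?expr1 ?expr0; lra.
apply: le_trans B _.
have := bonferroni_approx r g0; rewrite ler_norml => /andP[_ h1].
have h2 := @elsym_gen_le 1 _ r.+1 ler01 g0'.
rewrite (eq_bigr (fun j : 'I__ => elsym [seq g i | i <- P] j)) in h2; last first.
  by move=> j _; rewrite expr1n mul1r.
rewrite !big_map in h1 h2.
rewrite (eq_bigr (fun i => 1 + g i)) in h2; last by move=> i _; rewrite mul1r.
rewrite -mulrA [eps * (_ * _)]mulrCA -mulrDr ler_wpM2l ?ler0n //.
rewrite lerD ?ler_wpM2l //; lra.
Qed.
End BrunSieve.

(** * Residue classes in four variables *)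

Local Open Scope nat_scope.

Lemma sum_periodic_mul m q (f : nat -> nat) :
  (forall n, f (n %% m) = f n) ->
  \sum_(n < q * m) f n = q * \sum_(n < m) f n.
Proof.
move=> fm; elim: q => [|q IH]; first by rewrite mul0n big_ord0.
rewrite mulSn addnC big_split_ord /= IH mulSn addnC; congr addn.
by apply: eq_bigr => i _; rewrite -fm modnMDl fm.
Qed.

Lemma sum_periodic m N (f : nat -> nat) : 0 < m ->
  (forall n, f (n %% m) = f n) ->
  N %/ m * \sum_(n < m) f n <= \sum_(n < N) f n
    <= (N %/ m).+1 * \sum_(n < m) f n.
Proof.
move=> m0 fm; rewrite -!sum_periodic_mul //.
have mono n1 n2 : n1 <= n2 -> \sum_(n < n1) f n <= \sum_(n < n2) f n.
  by move=> /subnKC <-; rewrite big_split_ord leq_addr.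
by rewrite !mono ?leq_divM // ltnW // ltn_ceil.
Qed.

Lemma sum_crt m1 m2 (F : nat -> nat -> nat) : coprime m1 m2 -> 0 < m1 -> 0 < m2 ->
  \sum_(n < m1 * m2) F (n %% m1) (n %% m2) =
  \sum_(i < m1) \sum_(j < m2) F i j.
Proof.
move=> co m10 m20; rewrite pair_big /=.
pose h (n : 'I_(m1 * m2)) : 'I_m1 * 'I_m2 :=
  (Ordinal (ltn_pmod n m10), Ordinal (ltn_pmod n m20)).
have hi : injective h.
  move=> n n' [e1 e2]; apply: val_inj => /=.
  have := chinese_remainder co n n'; rewrite e1 e2 !eqxx !modn_small //.
  by move/eqP.
have hb : bijective h by apply: inj_card_bij; rewrite // card_prod !card_ord.
by rewrite (reindex h) //; case: hb => k hk kh; exists k => x _.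
Qed.

Definition sum4 (N M : nat) (f : nat -> nat -> nat -> nat -> nat) : nat :=
  \sum_(a < N) \sum_(b < N) \sum_(c < M) \sum_(d < M) f a b c d.

Definition periodic4 (T : Type) (m : nat) (f : nat -> nat -> nat -> nat -> T) :=
  forall a b c d, f (a %% m) (b %% m) (c %% m) (d %% m) = f a b c d.

Lemma periodic4_dvd (T : Type) m m' (f : nat -> nat -> nat -> nat -> T) : m %| m' ->
  periodic4 m f -> periodic4 m' f.
Proof.
by move=> mm' fm a b c d; rewrite -fm -[RHS]fm !modn_dvdm.
Qed.

Lemma sum4_periodic m N M f : 0 < m -> periodic4 m f ->
  (N %/ m) ^ 2 * (M %/ m) ^ 2 * sum4 m m f <= sum4 N M f
    <= (N %/ m).+1 ^ 2 * (M %/ m).+1 ^ 2 * sum4 m m f.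
Proof.
move=> m0 fm; rewrite /sum4.
pose f1 a b c := \sum_(d < m) f a b c d.
pose f2 a b := \sum_(c < m) f1 a b c.
pose f3 a := \sum_(b < m) f2 a b.
have fd a b c d : f a b c (d %% m) = f a b c d by rewrite -fm modn_mod fm.
have f1m a b c : f1 a b (c %% m) = f1 a b c.
  by apply: eq_bigr => i _; rewrite -fm modn_mod fm.
have f2m a b : f2 a (b %% m) = f2 a b.
  by do 2!apply: eq_bigr => ? _; rewrite -fm modn_mod fm.
have f3m a : f3 (a %% m) = f3 a.
  by do 3!apply: eq_bigr => ? _; rewrite -fm modn_mod fm.
have p0 := fun a b c => sum_periodic M m0 (fd a b c).
have p1 := fun a b => sum_periodic M m0 (f1m a b).
have p2 := fun a => sum_periodic N m0 (f2m a).
have p3 := sum_periodic N m0 f3m.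
apply/andP; split.
  apply: (@leq_trans (\sum_(a < N) \sum_(b < N) \sum_(c < M) (M %/ m) * f1 a b c)); last first.
    by apply: leq_sum => a _; apply: leq_sum => b _; apply: leq_sum => c _; case/andP: (p0 a b c).
  apply: (@leq_trans (\sum_(a < N) \sum_(b < N) (M %/ m) * ((M %/ m) * f2 a b))); last first.
    apply: leq_sum => a _; apply: leq_sum => b _; rewrite -big_distrr leq_mul2l; apply/orP; right.
    by case/andP: (p1 a b).
  apply: (@leq_trans (\sum_(a < N) (M %/ m) * ((M %/ m) * ((N %/ m) * f3 a)))); last first.
    apply: leq_sum => a _; rewrite -!big_distrr !leq_mul2l; do 2!(apply/orP; right).
    by case/andP: (p2 a).
  rewrite -!big_distrr -/(f3 _) /=; case/andP: p3 => p3 _.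
  rewrite [X in X <= _](_ : _ = M %/ m * (M %/ m * (N %/ m * (N %/ m * \sum_(n < m) f3 n)))).
    by rewrite !leq_mul2l p3 !orbT.
  by rewrite -!mulnn /f3 /f2 /f1; move: (\sum_(n < m) _) => S; ring.
apply: (@leq_trans (\sum_(a < N) \sum_(b < N) \sum_(c < M) (M %/ m).+1 * f1 a b c)).
  by apply: leq_sum => a _; apply: leq_sum => b _; apply: leq_sum => c _; case/andP: (p0 a b c).
apply: (@leq_trans (\sum_(a < N) \sum_(b < N) (M %/ m).+1 * ((M %/ m).+1 * f2 a b))).
  apply: leq_sum => a _; apply: leq_sum => b _; rewrite -big_distrr leq_mul2l; apply/orP; right.
  by case/andP: (p1 a b).
apply: (@leq_trans (\sum_(a < N) (M %/ m).+1 * ((M %/ m).+1 * ((N %/ m).+1 * f3 a)))).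
  apply: leq_sum => a _; rewrite -!big_distrr !leq_mul2l; do 2!(apply/orP; right).
  by case/andP: (p2 a).
rewrite -!big_distrr -/(f3 _) /=; case/andP: p3 => _ p3.
rewrite [X in _ <= X](_ : _ = (M %/ m).+1 * ((M %/ m).+1 * ((N %/ m).+1 * ((N %/ m).+1 * \sum_(n < m) f3 n)))).
  by rewrite !leq_mul2l p3 !orbT.
by rewrite -!mulnn /f3 /f2 /f1; move: (\sum_(n < m) _) => S; ring.
Qed.

(** The Chinese remainder theorem, applied to one variable after the other. *)
Lemma sum4_crt m1 m2 f h : coprime m1 m2 -> 0 < m1 -> 0 < m2 ->
  periodic4 m1 f -> periodic4 m2 h ->
  sum4 (m1 * m2) (m1 * m2) (fun a b c d => f a b c d * h a b c d) =
  sum4 m1 m1 f * sum4 m2 m2 h.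
Proof.
move=> co m10 m20 pf ph; rewrite /sum4.
have crt F := sum_crt F co m10 m20.
transitivity (\sum_(a1 < m1) \sum_(a2 < m2) \sum_(b1 < m1) \sum_(b2 < m2)
   \sum_(c1 < m1) \sum_(c2 < m2) \sum_(d1 < m1) \sum_(d2 < m2)
    f a1 b1 c1 d1 * h a2 b2 c2 d2).
  rewrite -(crt (fun a1 a2 => \sum_(b1 < m1) \sum_(b2 < m2)
   \sum_(c1 < m1) \sum_(c2 < m2) \sum_(d1 < m1) \sum_(d2 < m2)
    f a1 b1 c1 d1 * h a2 b2 c2 d2)); apply: eq_bigr => a _.
  rewrite -(crt (fun b1 b2 => 
   \sum_(c1 < m1) \sum_(c2 < m2) \sum_(d1 < m1) \sum_(d2 < m2)
    f (a %% m1) b1 c1 d1 * h (a %% m2) b2 c2 d2)); apply: eq_bigr => b _.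
  rewrite -(crt (fun c1 c2 => 
   \sum_(d1 < m1) \sum_(d2 < m2)
    f (a %% m1) (b %% m1) c1 d1 * h (a %% m2) (b %% m2) c2 d2)); apply: eq_bigr => c _.
  rewrite -(crt (fun d1 d2 => 
    f (a %% m1) (b %% m1) (c %% m1) d1 * h (a %% m2) (b %% m2) (c %% m2) d2)).
  by apply: eq_bigr => d _; rewrite pf ph.
rewrite big_distrl; apply: eq_bigr => a1 _; rewrite big_distrr; apply: eq_bigr => a2 _.
rewrite big_distrl; apply: eq_bigr => b1 _; rewrite big_distrr; apply: eq_bigr => b2 _.
rewrite big_distrl; apply: eq_bigr => c1 _; rewrite big_distrr; apply: eq_bigr => c2 _.
by rewrite big_distrl; apply: eq_bigr => d1 _; rewrite big_distrr.
Qed.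

Section Density.
Variable bad : nat -> nat -> nat -> nat -> nat -> bool.
Hypothesis bad_periodic : forall p, periodic4 (p ^ 2) (bad p).

Definition density (p : nat) : rat :=
  ((sum4 (p ^ 2) (p ^ 2) (bad p))%:R / (p ^ 8)%:R)%R.

(** The conditions at distinct primes are independent. *)
Lemma sum4_all_bad D : uniq D -> all prime D ->
  [/\ periodic4 (\prod_(p <- D) p ^ 2) (fun a b c d => all (fun p => bad p a b c d) D),
   0 < \prod_(p <- D) p ^ 2 &
  ((sum4 (\prod_(p <- D) p ^ 2) (\prod_(p <- D) p ^ 2)
     (fun a b c d => all (fun p => bad p a b c d) D))%:R =
   (\prod_(p <- D) p ^ 2)%:R ^+ 4 * \prod_(p <- D) density p :> rat)%R].
Proof.
elim: D => [|p D IH] /=.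
  by rewrite !big_nil /sum4 !big_ord1.
move=> /andP[pD uD] /andP[pp aD]; have [P0 P1 P2] := IH uD aD.
have p20 : 0 < p ^ 2 by rewrite expn_gt0 prime_gt0.
have co : coprime (p ^ 2) (\prod_(p <- D) p ^ 2).
  rewrite coprimeXl // big_seq; apply: (big_ind (coprime p)) => [|m n cm cn|q qD].
  - exact: coprimen1.
  - by rewrite coprimeMr cm.
  rewrite coprimeXr //.
  rewrite prime_coprime // dvdn_prime2 ?(allP aD q qD) //.
  by apply: contraNneq pD => ->.
rewrite !big_cons; split.
- have h1 := periodic4_dvd (dvdn_mulr (\prod_(p <- D) p ^ 2) (dvdnn (p ^ 2))) (bad_periodic p).
  have h2 := periodic4_dvd (dvdn_mull (p ^ 2) (dvdnn (\prod_(p <- D) p ^ 2))) P0.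
  by move=> a b c d; rewrite h1 h2.
- by rewrite muln_gt0 p20.
have e : sum4 (p ^ 2 * \prod_(p <- D) p ^ 2) (p ^ 2 * \prod_(p <- D) p ^ 2)
   (fun a b c d => bad p a b c d && all (fun p => bad p a b c d) D) =
   sum4 (p ^ 2 * \prod_(p <- D) p ^ 2) (p ^ 2 * \prod_(p <- D) p ^ 2)
   (fun a b c d => bad p a b c d * all (fun p => bad p a b c d) D).
  by do 4!apply: eq_bigr => ? _; rewrite mulnb.
rewrite {}e (@sum4_crt _ _ (fun a b c d => bad p a b c d) 
  (fun a b c d => all (fun p => bad p a b c d) D)) //; last first.
- by move=> a b c d; rewrite P0.
- by move=> a b c d; rewrite bad_periodic.
rewrite natrM P2 natrM /density.
have p0 : (p%:R != 0 :> rat)%R by rewrite pnatr_eq0 -lt0n prime_gt0.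
rewrite exprMn (natrX _ p 2) (natrX _ p 8) -exprM.
by field.
Qed.
End Density.

Local Open Scope ring_scope.

(** * The sieve in a box *)

Lemma sum4_card N M (A : nat -> nat -> nat -> nat -> bool) :
  sum4 N M A = #|[pred w : 'I_N * 'I_N * 'I_M * 'I_M | A w.1.1.1 w.1.1.2 w.1.2 w.2]|.
Proof.
rewrite -sum1_card big_mkcond /= /sum4 !pair_big /=.
by apply: eq_bigr => w _; rewrite inE; case: A.
Qed.

Lemma density_ge0 bad p : 0 <= density bad p.
Proof. by rewrite divr_ge0 ?ler0n. Qed.

(** In each variable the number of full periods differs from the expected one by a
    factor between [1 - d] and [1 + d], where [d = m / K], and [(1 + d) ^ 4 <= 1 + 15 d]. *)
Lemma sum4_equidistributed m K N M A (g : rat) : (0 < m)%N -> periodic4 m A ->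
  (m <= K)%N -> (K <= N)%N -> (K <= M)%N -> 0 <= g ->
  (sum4 m m A)%:R = m%:R ^+ 4 * g ->
  `|(sum4 N M A)%:R - (N ^ 2 * M ^ 2)%:R * g|
     <= 15 * (m%:R / K%:R) * ((N ^ 2 * M ^ 2)%:R * g).
Proof.
move=> m0 pA mK KN KM g0 eF.
have /andP[] := sum4_periodic N M m0 pA.
have nE q q' x : (q ^ 2 * q' ^ 2 * x)%:R = q%:R ^+ 2 * q'%:R ^+ 2 * x%:R :> rat.
  by rewrite natrM natrM (natrX _ q) (natrX _ q').
rewrite -!(ler_nat rat) !nE eF.
move=> lo hi.
have mr : 0 < m%:R :> rat by rewrite ltr0n.
have Kr : 0 < K%:R :> rat by rewrite ltr0n (leq_trans m0).
pose d : rat := m%:R / K%:R.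
have d0 : 0 < d by rewrite divr_gt0.
have d1 : d <= 1 by rewrite ler_pdivrMr // mul1r ler_nat.
have quot n : (K <= n)%N -> exists l : rat,
   [/\ n%:R = l * m%:R, 0 <= l, l * (1 - d) <= (n %/ m)%:R &
      (n %/ m).+1%:R <= l * (1 + d)].
  move=> Kn; exists (n%:R / m%:R).
  have ml : 1 <= n%:R / m%:R * d.
    rewrite /d mulrA divfK ?gt_eqF // ler_pdivlMr // mul1r ler_nat //.
  have e : n%:R = (n %/ m)%:R * m%:R + (n %% m)%:R :> rat.
    by rewrite -natrM -natrD -divn_eq.
  have r0 : 0 <= (n %% m)%:R / m%:R :> rat by rewrite divr_ge0.
  have r1 : (n %% m)%:R / m%:R <= 1 :> rat.
    by rewrite ler_pdivrMr // mul1r ler_nat ltnW // ltn_mod.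
  have e2 : n%:R / m%:R = (n %/ m)%:R + (n %% m)%:R / m%:R :> rat.
    by rewrite {1}e mulrDl mulfK ?gt_eqF.
  split; first by rewrite divfK ?gt_eqF.
  - by rewrite divr_ge0.
  - by rewrite mulrBr mulr1; lra.
  - by rewrite mulrDr mulr1 -natr1; lra.
have [l [el l0 ll lu]] := quot N KN.
have [k [ek k0 kl ku]] := quot M KM.
have {}lo : (l * (1 - d)) ^+ 2 * (k * (1 - d)) ^+ 2 * (m%:R ^+ 4 * g) <= (sum4 N M A)%:R.
  apply: le_trans lo; rewrite ler_wpM2r ?mulr_ge0 ?exprn_ge0 //.
  by rewrite ler_pM ?lerXn2r ?exprn_ge0 ?nnegrE ?mulr_ge0 ?subr_ge0 ?ler0n.
have {}hi : (sum4 N M A)%:R <= (l * (1 + d)) ^+ 2 * (k * (1 + d)) ^+ 2 * (m%:R ^+ 4 * g).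
  apply: le_trans hi _; rewrite ler_wpM2r ?mulr_ge0 ?exprn_ge0 //.
  have h : 0 <= 1 + d by lra.
  by rewrite ler_pM ?lerXn2r ?exprn_ge0 ?nnegrE ?mulr_ge0 ?ler0n.
rewrite ler_norml -[(N ^ 2 * M ^ 2)%N]muln1 nE mulr1 el ek -/d.
set V := l ^+ 2 * k ^+ 2 * (m%:R ^+ 4 * g).
have V0 : 0 <= V by rewrite !mulr_ge0 ?exprn_ge0.
have E1 : (l * (1 - d)) ^+ 2 * (k * (1 - d)) ^+ 2 * (m%:R ^+ 4 * g) = V * (1 - d) ^+ 4.
  by rewrite /V; ring.
have E2 : (l * (1 + d)) ^+ 2 * (k * (1 + d)) ^+ 2 * (m%:R ^+ 4 * g) = V * (1 + d) ^+ 4.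
  by rewrite /V; ring.
have E3 : (l * m%:R) ^+ 2 * (k * m%:R) ^+ 2 * g = V by rewrite /V; ring.
rewrite E1 in lo; rewrite E2 in hi; rewrite E3.
have b1 : 1 - 15 * d <= (1 - d) ^+ 4.
  have : 0 <= d * d by rewrite mulr_ge0 // ltW.
  rewrite (_ : (1 - d) ^+ 4 = (1 - 2 * d + d * d) ^+ 2); last by ring.
  nra.
have b2 : (1 + d) ^+ 4 <= 1 + 15 * d.
  have h2 : d ^+ 2 <= d by rewrite expr2 ler_piMr // ltW.
  have h3 : d ^+ 3 <= d by rewrite exprS ler_piMr ?exprn_ile1 // ltW.
  have h4 : d ^+ 4 <= d by rewrite exprS ler_piMr ?exprn_ile1 // ltW.
  rewrite (_ : (1 + d) ^+ 4 = 1 + 4 * d + 6 * d ^+ 2 + 4 * d ^+ 3 + d ^+ 4); last by ring.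
  lra.
have c1 := ler_wpM2l V0 b1; have c2 := ler_wpM2l V0 b2.
by apply/andP; split; lra.
Qed.

Section Box.
Variable bad : nat -> nat -> nat -> nat -> nat -> bool.
Hypothesis bad_periodic : forall p, periodic4 (p ^ 2) (bad p).

Lemma density_le1 p : density bad p <= 1.
Proof.
have [->|p0] := posnP p; first by rewrite /density exp0n // invr0 mulr0.
rewrite ler_pdivrMr ?ltr0n ?expn_gt0 ?p0 // mul1r ler_nat sum4_card.
apply: leq_trans (max_card _) _; rewrite !card_prod !card_ord.
by rewrite -!expnD.
Qed.

Lemma brun_box (P : seq nat) r z K N M : uniq P ->
  {in P, forall p, prime p && (p <= z)%N} -> ~~ odd r ->
  (0 < z)%N -> (z ^ (2 * r) <= K)%N -> (K <= N)%N -> (K <= M)%N ->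
  (sum4 N M (fun a b c d => all (fun p => ~~ bad p a b c d) P))%:R <=
  (N ^ 2 * M ^ 2)%:R * (\prod_(p <- P) (1 - density bad p)
      + elsym [seq density bad p | p <- P] r.+1
      + 15 * ((z ^ (2 * r))%:R / K%:R) * \prod_(p <- P) (1 + density bad p)).
Proof.
move=> uP Pz re z0 zK KN KM.
rewrite sum4_card.
pose T : finType := ('I_N * 'I_N * 'I_M * 'I_M)%type.
have cT : #|T| = (N ^ 2 * M ^ 2)%N by rewrite !card_prod !card_ord -!mulnn mulnA.
pose bb p (w : T) := bad p w.1.1.1 w.1.1.2 w.1.2 w.2.
have := @brun_sieve _ T bb (density bad) (15 * ((z ^ (2 * r))%:R / K%:R)) P r _ uP _ re _.
rewrite cT; apply; last by rewrite mulr_ge0 ?divr_ge0 ?ler0n.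
- by move=> p _; rewrite density_ge0 density_le1.
- move=> D uD sD szD.
  have aD : all prime D by apply/allP => p /sD /Pz /andP[].
  have [p0 p1 p2] := sum4_all_bad bad_periodic uD aD.
  have mz : (\prod_(p <- D) p ^ 2 <= z ^ (2 * r))%N.
    apply: (@leq_trans (\prod_(p <- D) z ^ 2)).
      rewrite big_seq [X in (_ <= X)%N]big_seq; apply: leq_prod => p /sD /Pz /andP[_ pz].
      by rewrite leq_exp2r.
    by rewrite big_const_seq count_predT iter_muln_1 -expnM leq_pexp2l // leq_mul2l.
  have g0 : 0 <= \prod_(p <- D) density bad p by apply: prodr_ge0 => p _; exact: density_ge0.
  have {}p0 : periodic4 (\prod_(p <- D) p ^ 2)
      (fun a b c d => nat_of_bool (all (fun p => bad p a b c d) D)).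
    by move=> a b c d; rewrite p0.
  have := sum4_equidistributed p1 p0 (leq_trans mz zK) KN KM g0 p2.
  rewrite (sum4_card N M (fun a b c d => all (fun p => bad p a b c d) D)) => h.
  apply: le_trans h _; rewrite ler_wpM2r ?mulr_ge0 ?ler0n //.
  by rewrite ler_wpM2l // ler_wpM2r ?invr_ge0 // ler_nat.
Qed.
End Box.

(** * Density of the local obstruction *)

Local Open Scope nat_scope.

Definition nonresidue (p n : nat) : bool := [forall s : 'I_p, ~~ (p %| s ^ 2 + n)].

(** Here [p] divides [a] exactly once and divides none of the other variables: the
    fibre can then have a [p]-adic point only if minus the product of [c] and [d], taken
    with their signs, is a square modulo [p]. The variables are absolute values, and [u]
    stands for the product of the signs of [c] and [d]. *)
Definition obstructed (p u a b c d : nat) : bool :=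
  [&& p %| a, ~~ (p ^ 2 %| a), ~~ (p %| b), ~~ (p %| c), ~~ (p %| d)
    & nonresidue p (u * (c * d))].

(** The class of [-1] modulo [p] when [e] holds, as a natural number. *)
Definition twist (e : bool) (p : nat) : nat := if e then p.-1 else 1.

(** The booleans say whether the signed variables [c, d], and [a, b], have opposite
    signs. *)
Definition bad (e1 e2 : bool) (p a b c d : nat) : bool :=
  [|| obstructed p (twist e1 p) a b c d, obstructed p (twist e1 p) b a c d,
      obstructed p (twist e2 p) c d a b | obstructed p (twist e2 p) d c a b].

Lemma nonresidue_mod p m n : m = n %[mod p] -> nonresidue p m = nonresidue p n.
Proof.
by move=> e; apply: eq_forallb => s; rewrite /dvdn -modnDmr e modnDmr.
Qed.

Lemma obstructed_periodic p u : periodic4 (p ^ 2) (obstructed p u).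
Proof.
move=> a b c d; have pp : p %| p ^ 2 by exact: dvdn_mulr.
rewrite /obstructed {2}/dvdn modn_mod.
have e x : (p %| x %% p ^ 2) = (p %| x) by rewrite /dvdn modn_dvdm.
rewrite !e (@nonresidue_mod _ _ (u * (c * d))) //.
have e2 : (c %% p ^ 2) * (d %% p ^ 2) = c * d %[mod p].
  by rewrite -modnMm !modn_dvdm // modnMm.
by rewrite -modnMmr e2 modnMmr.
Qed.

Lemma bad_periodic e1 e2 p : periodic4 (p ^ 2) (bad e1 e2 p).
Proof. by move=> a b c d; rewrite /bad !obstructed_periodic. Qed.

Lemma sum4_prod N M f g h : sum4 N M (fun a b c d => f a * g b * h c d) =
  (\sum_(a < N) f a) * (\sum_(b < N) g b) * \sum_(c < M) \sum_(d < M) h c d.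
Proof.
rewrite /sum4 -mulnA big_distrl; apply: eq_bigr => a _.
rewrite big_distrl big_distrr; apply: eq_bigr => b _.
rewrite [RHS]mulnA big_distrr; apply: eq_bigr => c _.
by rewrite big_distrr; apply: eq_bigr.
Qed.

Lemma dvdn_periodic p n : (p %| n %% p) = (p %| n).
Proof. by rewrite /dvdn modn_mod. Qed.

Lemma sum_dvdn p : 0 < p -> \sum_(a < p) (p %| a : nat) = 1.
Proof.
case: p => // p _; rewrite big_ord_recl dvdn0 big1 // => i _.
by rewrite gtnNdvd // ltnS.
Qed.

Lemma sum_Ndvdn p : 0 < p -> \sum_(a < p) (~~ (p %| a) : nat) = p.-1.
Proof.
case: p => // p _; rewrite big_ord_recl dvdn0 add0n.
rewrite (eq_bigr (fun=> 1)) ?sum1_card ?card_ord // => i _.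
by rewrite gtnNdvd // ltnS.
Qed.

Lemma sum_dvdn_sq p : 0 < p -> \sum_(a < p ^ 2) (p %| a : nat) = p.
Proof.
move=> p0; rewrite -mulnn (@sum_periodic_mul _ _ (fun a => p %| a : nat)).
  by rewrite sum_dvdn ?muln1.
by move=> n; rewrite dvdn_periodic.
Qed.

Lemma sum_Ndvdn_sq p : 0 < p -> \sum_(a < p ^ 2) (~~ (p %| a) : nat) = p * p.-1.
Proof.
move=> p0; rewrite -mulnn (@sum_periodic_mul _ _ (fun a => ~~ (p %| a) : nat)).
  by rewrite sum_Ndvdn.
by move=> n; rewrite dvdn_periodic.
Qed.

Lemma sum_exact_dvdn p : 0 < p ->
  \sum_(a < p ^ 2) ((p %| a) && ~~ (p ^ 2 %| a) : nat) = p.-1.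
Proof.
move=> p0.
have : \sum_(a < p ^ 2) (p %| a : nat) =
   \sum_(a < p ^ 2) ((p %| a) && ~~ (p ^ 2 %| a) : nat) + \sum_(a < p ^ 2) (p ^ 2 %| a : nat).
  rewrite -big_split; apply: eq_bigr => a _ /=.
  have [h|h] := boolP (p ^ 2 %| a); last by rewrite andbT addn0.
  by rewrite (dvdn_trans _ h) // dvdn_mulr.
by rewrite sum_dvdn_sq // sum_dvdn ?expn_gt0 ?p0 //; lia.
Qed.

(** If [p = t + s], then [t] and [s] have the same square modulo [p]. *)
Lemma reflect_square_id t s w p : p = t + s ->
  t ^ 2 + w + p * s = p * t + (s ^ 2 + w).
Proof. by move=> ->; ring. Qed.

(** A class [d] with [s ^ 2 + w d = 0] is determined by the square of [s], so that at
    most half of the nonzero classes are of this form. *)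
Lemma sum_nonresidue p w : prime p -> odd p -> ~~ (p %| w) ->
  p./2 <= \sum_(d < p) (~~ (p %| d) && nonresidue p (w * d) : nat).
Proof.
move=> pp op pw; have p0 := prime_gt0 pp.
have e := sum_Ndvdn p0.
have ep : p = p./2.*2.+1 by rewrite -[LHS]odd_double_half op.
pose R (s d : nat) := p %| s.+1 ^ 2 + w * d.
have h : \sum_(d < p) (~~ (p %| d) : nat) <=
   \sum_(d < p) (~~ (p %| d) && nonresidue p (w * d) : nat)
   + \sum_(d < p) \sum_(s < p./2) (R s d : nat).
  rewrite -big_split; apply: leq_sum => d _ /=.
  have [|pd] := boolP (p %| d) => //=.
  have [//|/forallPn /= [s /negPn hs]] := boolP (nonresidue p (w * d)).
  rewrite add0n.
  have ps : ~~ (p %| s).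
    apply: contra pd => ps; move: hs; rewrite dvdn_addr ?dvdn_exp //.
    by rewrite Euclid_dvdM // (negPf pw).
  have s0 : 0 < s by rewrite lt0n; apply: contraNneq ps => ->.
  (* One of s and p - s, which have the same square, is at most p / 2. *)
  have [t [tp t0 ht]] : exists t : nat, [/\ t <= p./2, 0 < t & p %| t ^ 2 + w * d].
    have [sp|sp] := leqP s p./2; first by exists s.
    have sp' := ltn_ord s.
    exists (p - s); split; [lia|lia|].
    have -> : p %| (p - s) ^ 2 + w * d = (p %| (p - s) ^ 2 + w * d + p * s).
      by rewrite (dvdn_addl _ (dvdn_mulr s (dvdnn p))).
    rewrite (@reflect_square_id (p - s) s (w * d) p) ?subnK 1?ltnW //.
    by rewrite dvdn_add // dvdn_mulr.
  have tp' : t.-1 < p./2 by rewrite prednK.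
  by rewrite (bigD1 (Ordinal tp')) //= /R prednK // ht.
rewrite e exchange_big /= in h.
have h2 : \sum_(s < p./2) \sum_(d < p) (R s d : nat) <= \sum_(s < p./2) 1.
  apply: leq_sum => s _.
  rewrite -[X in X <= _](_ : #|[pred d : 'I_p | R s d]| = _); last first.
    by rewrite -sum1_card big_mkcond; apply: eq_bigr => d _; rewrite inE; case: (R s d).
  apply/card_le1_eqP => d1 d2; rewrite !inE /R => r1 r2; apply: val_inj => /=.
  wlog le : d1 d2 r1 r2 / d1 <= d2.
    by move=> H; case: (leqP d1 d2) => [|/ltnW] le; [exact: H|rewrite (H d2 d1)].
  have : p %| (s.+1 ^ 2 + w * d2) - (s.+1 ^ 2 + w * d1) by rewrite dvdn_sub.
  rewrite subnDl -mulnBr Euclid_dvdM // (negPf pw) /= => pd.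
  apply/eqP; rewrite eqn_leq le /= -subn_eq0; apply/eqP.
  case: (posnP (d2 - d1)) => // /dvdn_leq /(_ pd).
  by rewrite leqNgt (leq_ltn_trans (leq_subr _ _)).
rewrite sum1_card card_ord in h2.
have := leq_trans h (leq_add (leqnn _) h2); rewrite {1}ep /= -addnn.
by rewrite leq_add2r.
Qed.

Lemma sum_nonresidue_pairs p u : prime p -> odd p -> ~~ (p %| u) ->
  p * p.-1 * (p * p./2) <= \sum_(c < p ^ 2) \sum_(d < p ^ 2)
     ([&& ~~ (p %| c), ~~ (p %| d) & nonresidue p (u * (c * d))] : nat).
Proof.
move=> pp op pu; have p0 := prime_gt0 pp.
rewrite -(sum_Ndvdn_sq p0) big_distrl; apply: leq_sum => c _ /=.
have [//|pc] := boolP (p %| c); rewrite mul1n /=.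
move: (nat_of_ord c) pc => {}c pc.
rewrite -mulnn (@sum_periodic_mul _ _ (fun d => ~~ (p %| d) && nonresidue p (u * (c * d)) : nat)).
  rewrite leq_mul2l; apply/orP; right.
  under eq_bigr do rewrite mulnA.
  by apply: sum_nonresidue; rewrite // Euclid_dvdM // negb_or pu.
move=> d; rewrite dvdn_periodic (@nonresidue_mod _ _ (u * (c * d))) //.
by rewrite !mulnA modnMmr.
Qed.

Lemma twist_unit e p : prime p -> ~~ (p %| twist e p).
Proof.
move=> pp; have := prime_gt1 pp; case: e => /= p1; last by rewrite gtnNdvd.
by rewrite gtnNdvd //; lia.
Qed.

Lemma sum4_obstructed p u : prime p -> odd p -> ~~ (p %| u) ->
  p.-1 * (p * p.-1) * (p * p.-1 * (p * p./2)) <= sum4 (p ^ 2) (p ^ 2) (obstructed p u).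
Proof.
move=> pp op pu; have p0 := prime_gt0 pp.
have -> : sum4 (p ^ 2) (p ^ 2) (obstructed p u) = sum4 (p ^ 2) (p ^ 2) (fun a b c d =>
   ((p %| a) && ~~ (p ^ 2 %| a) : nat) * (~~ (p %| b) : nat) *
   ([&& ~~ (p %| c), ~~ (p %| d) & nonresidue p (u * (c * d))] : nat)).
  by do 4!apply: eq_bigr => ? _; rewrite /obstructed !mulnb !andbA.
rewrite (@sum4_prod _ _ (fun a => (p %| a) && ~~ (p ^ 2 %| a) : nat)
  (fun b => ~~ (p %| b) : nat)
  (fun c d => [&& ~~ (p %| c), ~~ (p %| d) & nonresidue p (u * (c * d))] : nat)).
by rewrite sum_exact_dvdn // sum_Ndvdn_sq // leq_mul2l sum_nonresidue_pairs ?orbT.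
Qed.

Lemma sum4_swap12 N M f : sum4 N M (fun a b c d => f b a c d) = sum4 N M f.
Proof. by rewrite /sum4 exchange_big. Qed.

Lemma sum4_swap N f : sum4 N N (fun a b c d => f c d a b) = sum4 N N f.
Proof.
rewrite /sum4 !pair_big /= (reindex_inj (h := fun w : 'I_N * 'I_N * 'I_N * 'I_N =>
  (w.1.2, w.2, w.1.1.1, w.1.1.2))) //.
by move=> [[[a b] c] d] [[[a' b'] c'] d'] /= [-> -> -> ->].
Qed.

Lemma sum4D N M f g : sum4 N M (fun a b c d => f a b c d + g a b c d) =
  sum4 N M f + sum4 N M g.
Proof.
rewrite /sum4 -big_split; apply: eq_bigr => a _; rewrite -big_split; apply: eq_bigr => b _.
by rewrite -big_split; apply: eq_bigr => c _; rewrite -big_split.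
Qed.

Lemma leq_sum4 N M f g : (forall a b c d, f a b c d <= g a b c d) ->
  sum4 N M f <= sum4 N M g.
Proof. by move=> fg; do 4!apply: leq_sum => ? _. Qed.

(** The four cases of [bad] exclude each other, since they differ by the variable that
    [p] divides, and [sum4_obstructed] applies to each of them. *)
Lemma sum4_bad_ge e1 e2 p : prime p -> odd p ->
  4 * (p.-1 * (p * p.-1) * (p * p.-1 * (p * p./2)))
    <= sum4 (p ^ 2) (p ^ 2) (bad e1 e2 p).
Proof.
move=> pp op; set Q := _ * _ * _.
set f := obstructed p (twist e1 p); set g := obstructed p (twist e2 p).
have hf : Q <= sum4 (p ^ 2) (p ^ 2) f by apply: sum4_obstructed => //; apply: twist_unit.
have hg : Q <= sum4 (p ^ 2) (p ^ 2) g by apply: sum4_obstructed => //; apply: twist_unit.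
apply: (@leq_trans (sum4 (p ^ 2) (p ^ 2) (fun a b c d =>
  (f a b c d + f b a c d) + (g c d a b + g d c a b)))).
  rewrite !sum4D (@sum4_swap12 _ _ f) (@sum4_swap _ g).
  rewrite (@sum4_swap12 _ _ (fun a b c d => g b a c d)).
  rewrite (@sum4_swap _ (fun a b c d => g b a c d)) (@sum4_swap12 _ _ g); lia.
apply: leq_sum4 => a b c d; rewrite /f /g /bad /obstructed.
by case: (p %| a); case: (p %| b); case: (p %| c); case: (p %| d) => //=;
  rewrite ?andbF ?orbF ?orFb ?addn0 ?add0n.
Qed.

Lemma sum4_bad_le e1 e2 p : 0 < p ->
  sum4 (p ^ 2) (p ^ 2) (bad e1 e2 p) <= 4 * p ^ 7.
Proof.
move=> p0.
pose f (a b c d : nat) : nat := p %| a.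
have sf : sum4 (p ^ 2) (p ^ 2) f = p ^ 7.
  rewrite /sum4 /f; under eq_bigr do rewrite !sum_nat_const !card_ord.
  by rewrite -!big_distrr /= sum_dvdn_sq //; ring.
apply: (@leq_trans (sum4 (p ^ 2) (p ^ 2) (fun a b c d =>
  (f a b c d + f b a c d) + (f c d a b + f d c a b)))).
  apply: leq_sum4 => a b c d; rewrite /f /bad /obstructed.
  by case: (p %| a); case: (p %| b); case: (p %| c); case: (p %| d) => //=;
    rewrite ?andbF ?orbF ?orFb ?addn0 ?add0n ?leq_b1.
rewrite !sum4D (@sum4_swap12 _ _ f) (@sum4_swap _ f).
rewrite (@sum4_swap12 _ _ (fun a b c d => f b a c d)).
rewrite (@sum4_swap _ (fun a b c d => f b a c d)) (@sum4_swap12 _ _ f); lia.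
Qed.

Local Open Scope ring_scope.

(** If a quadruple is bad at [p], then [p] divides one of the four variables. *)
Lemma density_bad_le e1 e2 p : (8 <= p)%N -> density (bad e1 e2) p <= 1 / 2.
Proof.
move=> p8; have p0 : 0 < p%:R :> rat by rewrite ltr0n; lia.
rewrite /density natrX ler_pdivrMr ?exprn_gt0 //.
have := sum4_bad_le e1 e2 (ltn_trans (ltn0Sn 6) p8).
rewrite -(ler_nat rat) natrM natrX => h; apply: le_trans h _.
rewrite (_ : 1 / 2 * p%:R ^+ 8 = p%:R / 2 * p%:R ^+ 7); last by ring.
rewrite ler_wpM2r ?exprn_ge0 ?ler0n //.
have : 8 <= p%:R :> rat by rewrite ler_nat. lra.
Qed.

(** The density is [2 / p] up to a factor close to [1], so that the sieve has dimension
    [2]. Dimension [3 / 2] is claimed in order to absorb this factor. *)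
Lemma density_bad_ge e1 e2 p : prime p -> (32 <= p)%N ->
  (1 - density (bad e1 e2) p) ^+ 2 <= (1 - p%:R^-1) ^+ 3.
Proof.
move=> pp p32.
have op : odd p by case: (even_prime pp) => // p2; move: p32; rewrite p2.
have p0 : 0 < p%:R :> rat by rewrite ltr0n; lia.
have ep : p%:R = p./2%:R * 2 + 1 :> rat.
  by rewrite -[p in LHS]odd_double_half op natrD -muln2 natrM addrC.
set x := p%:R^-1; have x0 : 0 < x by rewrite invr_gt0.
have px : p%:R * x = 1 by rewrite /x mulfV ?gt_eqF.
have x1 : x <= 1 / 32.
  have h32 : 32 <= p%:R :> rat by rewrite ler_nat.
  by have := ler_wpM2r (ltW x0) h32; rewrite px; lra.
have g1 := density_le1 (bad e1 e2) p.
have g2 : 2 * x * (1 - x) ^+ 4 <= density (bad e1 e2) p.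
  rewrite /density natrX ler_pdivlMr ?exprn_gt0 //.
  have := sum4_bad_ge e1 e2 pp op; rewrite -(ler_nat rat); apply: le_trans.
  rewrite !natrM -subn1 natrB ?prime_gt0 //.
  have hx : p./2%:R = (p%:R - 1) / 2 :> rat by lra.
  rewrite hx.
  have -> : 2 * x * (1 - x) ^+ 4 * p%:R ^+ 8 =
     2 * (p%:R * x) * (p%:R - p%:R * x) ^+ 4 * p%:R ^+ 3 by ring.
  by rewrite px le_eqVlt; apply/orP; left; apply/eqP; field.
have y0 : 0 <= 1 - density (bad e1 e2) p by lra.
have hy : 1 - density (bad e1 e2) p <= 1 - 2 * x * (1 - x) ^+ 4 by lra.
apply: le_trans (_ : (1 - 2 * x * (1 - x) ^+ 4) ^+ 2 <= _).
  by rewrite lerXn2r // nnegrE //; lra.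
have b : 1 - 4 * x <= (1 - x) ^+ 4.
  have -> : (1 - x) ^+ 4 = 1 - 4 * x + x ^+ 2 * (6 - 4 * x + x ^+ 2) by ring.
  have : 0 <= x ^+ 2 by rewrite exprn_ge0 // ltW.
  by move=> h; rewrite lerDl mulr_ge0 //; lra.
have h1 : 1 - 2 * x * (1 - x) ^+ 4 <= 1 - 7 / 4 * x.
  have := ler_wpM2l (ltW x0) b; nra.
have h0 : 0 <= 1 - 2 * x * (1 - x) ^+ 4 by lra.
apply: le_trans (_ : (1 - 7 / 4 * x) ^+ 2 <= _).
  by rewrite lerXn2r // nnegrE; lra.
rewrite (_ : (1 - x) ^+ 3 = 1 - 3 * x + 3 * x ^+ 2 - x ^+ 3); last by ring.
rewrite (_ : x ^+ 3 = x * x * x); last by ring.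
rewrite !expr2; nra.
Qed.

(** * Sieving primes *)

Definition smooth_over (P : seq nat) (n : nat) : bool :=
  (0 < n)%N && all (mem P) (primes n).

Definition smooth_harmonic (P : seq nat) (z : nat) : rat :=
  \sum_(n < z.+1 | smooth_over P n) n%:R^-1.

(** A multiple of [p] that is smooth over [p :: P] is [p m] with [m] smooth over
    [p :: P]. *)
Lemma smooth_harmonic_cons p P z : prime p ->
  smooth_harmonic (p :: P) z * (1 - p%:R^-1) <= smooth_harmonic P z.
Proof.
move=> pp; have p0 := prime_gt0 pp.
rewrite mulrBr mulr1 lerBlDr {1}/smooth_harmonic (bigID (fun n : 'I__ => p %| n)%N) /=.
rewrite addrC lerD //.
  rewrite big_mkcond [X in _ <= X]big_mkcond; apply: ler_sum => n _ /=.
  case: ifP => [/andP[/andP[n0 sn] pn]|_]; last by case: ifP => // _; rewrite invr_ge0.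
  rewrite ifT // /smooth_over n0; apply/allP => q qn.
  have /= := allP sn q qn; rewrite inE => /orP[/eqP qp|//].
  by move: qn pn; rewrite mem_primes qp => /and3P[_ _ ->].
rewrite (reindex_onto (fun m : 'I_z.+1 => inord (p * m) : 'I_z.+1)
   (fun n : 'I_z.+1 => inord (n %/ p) : 'I_z.+1)) /=; last first.
  move=> n /andP[_ pn]; apply: val_inj => /=.
  have nz : (n %/ p < z.+1)%N by rewrite (leq_ltn_trans (leq_div _ _)).
  by rewrite [X in inord X](_ : _ = n :> nat) ?inord_val // inordK // mulnC divnK.
rewrite mulr_suml big_mkcond [X in _ <= X]big_mkcond; apply: ler_sum => m _ /=.
case: ifP => [/andP[/andP[/andP[n0 sn] pn] _]|_]; last first.
  by case: ifP => // _; rewrite mulr_ge0 ?invr_ge0.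
have [pm|pm] := leqP (p * m) z; last first.
  by move: n0; rewrite /inord /insubd insubN // -leqNgt.
move: n0 sn pn; rewrite !inordK // muln_gt0 p0 /= => m0 sn _.
rewrite ifT; first by rewrite natrM invfM mulrC.
rewrite /smooth_over m0; apply/allP => q; rewrite mem_primes => /and3P[qp _ qm].
by apply: (allP sn); rewrite mem_primes qp muln_gt0 p0 m0 dvdn_mull.
Qed.

Lemma euler_product P z : all prime P ->
  smooth_harmonic P z * \prod_(p <- P) (1 - p%:R^-1) <= 1.
Proof.
elim: P => [_|p P IH /= /andP[pp /IH h]].
  rewrite big_nil mulr1 /smooth_harmonic.
  case: z => [|z]; first by rewrite big_mkcond big_ord1.
  rewrite big_mkcond big_ord_recl big_ord_recl /= add0r invr1 big1 ?addr0 // => i _.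
  rewrite /smooth_over /=; case: ifP => // /allP ap.
  have := ap _ (_ : pdiv (bump 0 (bump 0 i)) \in _).
  by rewrite mem_primes pdiv_prime // pdiv_dvd => /(_ isT).
apply: le_trans h; rewrite big_cons mulrA ler_wpM2r ?smooth_harmonic_cons //.
apply: prodr_ge0 => q _; rewrite subr_ge0.
by case: q => [|q]; rewrite ?invr0 // invf_le1 // ler1n.
Qed.

Lemma harmonic_ge L : L%:R / 2 <= \sum_(n < (2 ^ L).+1 | (0 < n)%N) n%:R^-1 :> rat.
Proof.
elim: L => [|L IH]; first by rewrite mul0r sumr_ge0 // => i _; rewrite invr_ge0.
have e : (2 ^ L.+1).+1 = ((2 ^ L).+1 + 2 ^ L)%N by rewrite expnS; lia.
rewrite e big_mkcond big_split_ord /= -big_mkcond -natr1 mulrDl lerD //.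
have pL : 0 < (2 ^ L.+1)%:R :> rat by rewrite ltr0n expn_gt0.
apply: le_trans (_ : \sum_(i < 2 ^ L) ((2 ^ L.+1)%:R)^-1 <= _).
  rewrite sumr_const card_ord -[leRHS]mulr_natr.
  have -> : (2 ^ L.+1)%:R = 2 * (2 ^ L)%:R :> rat by rewrite expnS natrM.
  have : (2 ^ L)%:R != 0 :> rat by rewrite pnatr_eq0 -lt0n expn_gt0.
  by move: (2 ^ L)%:R => t t0; rewrite le_eqVlt; apply/orP; left; apply/eqP; field.
apply: ler_sum => i _; rewrite lef_pV2 ?posrE ?ltr0n ?expn_gt0 // ler_nat expnS.
by have := ltn_ord i; lia.
Qed.

Definition sieving_primes (N z : nat) : seq nat :=
  [seq p <- iota 0 z.+1 | prime p && (N <= p)%N].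

Lemma one_sub_invn_ge0 (p : nat) : 0 <= 1 - p%:R^-1 :> rat.
Proof. by rewrite subr_ge0; case: p => [|q]; rewrite ?invr0 // invf_le1 // ler1n. Qed.

Lemma prod_primes_ge (s : seq nat) N : {in s, forall p, prime p} ->
  (size s <= N)%N -> (2 ^+ N)^-1 <= \prod_(p <- s) (1 - p%:R^-1) :> rat.
Proof.
move=> sp sN; apply: le_trans (_ : 2^-1 ^+ size s <= _).
  by rewrite exprVn lef_pV2 ?posrE ?exprn_gt0 // ler_weXn2l // ler1n.
elim: s sp {sN} => [|p s IH] sp; first by rewrite big_nil.
rewrite big_cons /= exprS ler_pM ?exprn_ge0 ?invr_ge0 //; last first.
  by apply: IH => q qs; apply: sp; rewrite inE qs orbT.
have p1 := prime_gt1 (sp _ (mem_head _ _)).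
have : p%:R^-1 <= 2^-1 :> rat by rewrite lef_pV2 ?posrE ?ltr0n ?ler_nat // ltnW.
by lra.
Qed.

(** All the integers up to [2 ^ L] are smooth over the primes up to [2 ^ L], so that the
    product over these primes is at most [2 / L]; leaving out the primes below [N] costs a
    factor [2 ^ N] at most. *)
Lemma prod_sieving_primes N L :
  \prod_(p <- sieving_primes N (2 ^ L)) (1 - p%:R^-1) * L%:R <= 2 * 2 ^+ N :> rat.
Proof.
pose P := [seq p <- iota 0 (2 ^ L).+1 | prime p].
have aP : all prime P by rewrite filter_all.
have := euler_product (2 ^ L) aP.
have -> : smooth_harmonic P (2 ^ L) = \sum_(n < (2 ^ L).+1 | (0 < n)%N) n%:R^-1.
  apply: eq_bigl => n; rewrite /smooth_over; case: posnP => //= n0.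
  apply/allP => p; rewrite mem_primes => /and3P[pp _ pn].
  rewrite /= mem_filter pp mem_iota /= add0n ltnS.
  by rewrite (leq_trans (dvdn_leq n0 pn)) // -ltnS.
pose s := [seq p <- iota 0 (2 ^ L).+1 | prime p && ~~ (N <= p)%N].
have -> : \prod_(p <- P) (1 - p%:R^-1) = \prod_(p <- sieving_primes N (2 ^ L)) (1 - p%:R^-1)
   * \prod_(p <- s) (1 - p%:R^-1) :> rat.
  by rewrite (bigID (fun p => (N <= p)%N)) /= /P !big_filter !big_filter_cond.
have ss : (size s <= N)%N.
  have : {subset s <= iota 0 N}.
    by move=> p; rewrite mem_filter !mem_iota -ltnNge => /andP[/andP[_ ->]].
  move/uniq_leq_size; rewrite size_iota; apply.
  by rewrite filter_uniq // iota_uniq.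
have low : (2 ^+ N)^-1 <= \prod_(p <- s) (1 - p%:R^-1) :> rat.
  by apply: prod_primes_ge ss => p; rewrite mem_filter => /andP[/andP[]].
have hL := harmonic_ge L.
have t0 : 0 < 2 ^+ N :> rat by rewrite exprn_gt0.
have q0 : 0 <= \prod_(p <- sieving_primes N (2 ^ L)) (1 - p%:R^-1) :> rat.
  by apply: prodr_ge0 => p _; exact: one_sub_invn_ge0.
move: (\prod_(p <- sieving_primes _ _) _) (\prod_(p <- s) _) q0 low => Q S Q0 low.
move: (\sum_(_ < _ | _) _) hL => H hL.
move: (2 ^+ N) t0 low => t t0 low h.
have h1 : L%:R / 2 * (Q * t^-1) <= 1.
  apply: le_trans h; rewrite ler_pM ?mulr_ge0 ?invr_ge0 ?(ltW t0) //.
  by rewrite ler_wpM2l.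
have -> : Q * L%:R = (L%:R / 2 * (Q * t^-1)) * (2 * t).
  by field; rewrite gt_eqF.
by rewrite ler_piMl // mulr_ge0 // ltW.
Qed.

(** A prefix is enlarged until its product falls below [c]; as the last factor is at
    least [1 / 2], the product does not fall below [c / 2]. Controlling it from both sides
    keeps the densities of the sieving primes from adding up to too much. *)
Lemma greedy_product (I : eqType) (f : I -> rat) (P : seq I) (c : rat) :
  c <= 1 -> 0 <= c -> {in P, forall i, 1 / 2 <= f i <= 1} ->
  \prod_(i <- P) f i <= c ->
  exists2 Q, subseq Q P & c / 2 <= \prod_(i <- Q) f i <= c.
Proof.
move=> c1 c0; elim/last_ind: P => [|P i IH] fP Pc.
  by exists [::] => //; rewrite !big_nil in Pc *; rewrite Pc andbT; lra.
have sP : subseq P (rcons P i) by rewrite -cats1 prefix_subseq.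
have [le|lt] := leP (\prod_(i <- P) f i) c.
  have [|Q sQ hQ] := IH _ le; first by move=> j jP; apply: fP; rewrite mem_rcons inE jP orbT.
  by exists Q => //; apply: subseq_trans sP.
exists (rcons P i); rewrite ?subseq_refl // Pc andbT.
rewrite -cats1 big_cat big_seq1 /=.
have /andP[fi _] : 1 / 2 <= f i <= 1 by apply: fP; rewrite mem_rcons mem_head.
move: (\prod_(_ <- _) _) lt => V lt; nra.
Qed.

(** * The saving in a box *)

(** The product is [O(2 ^ (- 21 n / 2))] because the sieve has dimension [3 / 2], and
    [n > N] absorbs the constant. *)
Lemma sieving_primes_density e1 e2 N n : (32 <= N)%N -> (N < n)%N ->
  \prod_(p <- sieving_primes N (2 ^ (2 ^ (7 * n)))) (1 - density (bad e1 e2) p)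
    <= (2 ^+ (9 * n))^-1.
Proof.
move=> N32 nN; set P := sieving_primes _ _; set V := \prod_(_ <- _) _.
pose U : rat := \prod_(p <- P) (1 - p%:R^-1).
have U0 : 0 <= U by apply: prodr_ge0 => p _; exact: one_sub_invn_ge0.
have V0 : 0 <= V by apply: prodr_ge0 => p _; rewrite subr_ge0 density_le1.
have VU : V ^+ 2 <= U ^+ 3.
  rewrite /V /U -!prodrXl big_seq [leRHS]big_seq; apply: ler_prod => p.
  rewrite mem_filter => /andP[/andP[pp pN] _].
  by rewrite exprn_ge0 ?subr_ge0 ?density_le1 // density_bad_ge // (leq_trans N32).
have pos k : 0 < 2 ^+ k :> rat by rewrite exprn_gt0.
have hU : U <= (2 ^+ (6 * n))^-1.
  have := prod_sieving_primes N (2 ^ (7 * n)); rewrite -/P -/U natrX => hU.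
  rewrite -[leRHS]mul1r ler_pdivlMr // -(ler_pM2r (pos n)) mul1r -mulrA -exprD.
  have -> : (6 * n + n = 7 * n)%N by lia.
  by apply: le_trans hU _; rewrite -exprS; apply: ler_weXn2l; rewrite ?ler1n.
have c0 : 0 <= (2 ^+ (9 * n))^-1 :> rat by rewrite invr_ge0 ltW.
rewrite -ler_sqr ?nnegrE //; apply: le_trans VU _.
apply: le_trans (_ : ((2 ^+ (6 * n))^-1) ^+ 3 <= _).
  by rewrite lerXn2r ?nnegrE // invr_ge0 ltW.
by rewrite -!exprVn -!exprM; have -> : (6 * n * 3 = 9 * n * 2)%N by lia.
Qed.

Lemma linear_le_exp n : (10 <= n)%N -> (56 * n + 5 <= 2 ^ n)%N.
Proof.
elim: n => // n IH; rewrite leq_eqVlt => /orP[/eqP <- //|]; rewrite ltnS => n10.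
by have := IH n10; rewrite expnS; lia.
Qed.

(** A product of the squares of [r = 28 n + 2] primes up to [z = 2 ^ (2 ^ (7 n))] is at most
    [z ^ (2 r)]. As [56 n + 5 <= 2 ^ n], it is smaller than the sides of the box by the
    margin that the error term needs. *)
Lemma sieve_level n k : (10 <= n)%N -> (2 ^ (8 * n) <= k)%N ->
  (30 * (2 ^ (9 * n)) ^ 2 * (2 ^ (2 ^ (7 * n))) ^ (2 * (28 * n + 2)) <= 2 ^ k)%N.
Proof.
move=> n10 nk; have h := linear_le_exp n10.
apply: (@leq_trans (2 ^ 5 * 2 ^ (9 * n * 2) * 2 ^ (2 ^ (7 * n) * (2 * (28 * n + 2))))).
  by rewrite -!expnM !leq_mul.
rewrite -!expnD leq_exp2l // (leq_trans _ nk) //.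
have -> : (8 * n = 7 * n + n)%N by lia.
rewrite expnD; have h7 : (56 * n + 5 <= 2 ^ (7 * n))%N.
  by rewrite (leq_trans h) // leq_exp2l //; lia.
apply: (@leq_trans (2 ^ (7 * n) * (56 * n + 5))); last by rewrite leq_mul2l h orbT.
have -> : (2 ^ (7 * n) * (56 * n + 5) =
  2 ^ (7 * n) + 2 ^ (7 * n) * (2 * (28 * n + 2)))%N by ring.
by rewrite leq_add2r; lia.
Qed.

Lemma tail_level n : (2 ^ (2 + 9 * n * 3) <= 2 ^ (28 * n + 2).+1)%N.
Proof. by rewrite leq_exp2l //; lia. Qed.

(** The sieving primes go up to [z = 2 ^ (2 ^ (7 n))] and are chosen so that the product
    of the [1 - g p] is between [1 / (2 a)] and [1 / a], where [a = 2 ^ (9 n)]. The three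
    terms of [brun_box] are then at most [1 / a] each. *)
Lemma box_bound e1 e2 n k N M (A : nat -> nat -> nat -> nat -> bool) :
  (33 <= n)%N -> (2 ^ (8 * n) <= k)%N -> (2 ^ k <= N)%N -> (2 ^ k <= M)%N ->
  (forall a b c d, A a b c d ->
     forall p, prime p -> (32 <= p)%N -> ~~ bad e1 e2 p a b c d) ->
  (sum4 N M A)%:R <= (N ^ 2 * M ^ 2)%:R * (3 / 2 ^+ (9 * n)) :> rat.
Proof.
move=> n33 nk kN kM hA.
pose g := density (bad e1 e2); pose a : rat := 2 ^+ (9 * n).
pose z := (2 ^ (2 ^ (7 * n)))%N; pose r := (28 * n + 2)%N.
have a1 : 1 <= a by apply: exprn_ege1; rewrite ler1n.
have a0 : 0 < a by lra.
have V := sieving_primes_density e1 e2 (leqnn 32) n33; rewrite -/a -/z -/g in V.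
have g1 p : 0 <= g p <= 1 by rewrite density_ge0 density_le1.
have P32 : {in sieving_primes 32 z, forall p, [&& prime p, (32 <= p)%N & (p <= z)%N]}.
  by move=> p; rewrite mem_filter mem_iota add0n ltnS -andbA => /and3P[-> -> /andP[_ ->]].
have gP : {in sieving_primes 32 z, forall p, 1 / 2 <= 1 - g p <= 1}.
  move=> p /P32 /and3P[pp p32 _]; have := density_bad_le e1 e2 (leq_trans (isT : 8 <= 32)%N p32).
  by have := g1 p; rewrite -/g; lra.
have a10 : 0 <= a^-1 by rewrite invr_ge0 ltW.
have a11 : a^-1 <= 1 by rewrite invf_le1.
have [Q sQ /andP[VQ0 VQ1]] := greedy_product a11 a10 gP V.
have QP : {subset Q <= sieving_primes 32 z} := mem_subseq sQ.
have uQ : uniq Q by rewrite (subseq_uniq sQ) // filter_uniq // iota_uniq.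
have aa : a * a^-1 = 1 by rewrite divff ?gt_eqF.
have VQpos : 0 < \prod_(p <- Q) (1 - g p) by apply: lt_le_trans VQ0; rewrite divr_gt0 ?invr_gt0.
(* Here (1 + g) (1 - g) <= 1, and the product of the 1 - g is at least 1 / (2 a). *)
have G1 : \prod_(p <- Q) (1 + g p) <= 2 * a.
  have : \prod_(p <- Q) (1 + g p) * \prod_(p <- Q) (1 - g p) <= 1.
    rewrite -big_split /=; apply: prodr_ile1 => p _; have := g1 p; nra.
  have G0 : 0 <= \prod_(p <- Q) (1 + g p) by apply: prodr_ge0 => p _; have := g1 p; lra.
  move: (\prod_(p <- Q) (1 + g p)) G0 => G G0 h.
  have := ler_wpM2l G0 VQ0; nra.
(* 2 ^ (r + 1) e_(r + 1) <= prod (1 + 2 g) <= prod (1 + g) ^ 2 <= (2 a) ^ 2,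
   while 4 a ^ 3 <= 2 ^ (r + 1). *)
have e_small : elsym [seq g p | p <- Q] r.+1 <= a^-1.
  have g0 : {in [seq g p | p <- Q], forall x, 0 <= x} by move=> x /mapP[p _ ->]; case/andP: (g1 p).
  have := @elsym_gen_le 2 _ r.+2 (ler0n _ 2) g0.
  rewrite big_ord_recr /= big_map => h.
  have h2 : 2 ^+ r.+1 * elsym [seq g p | p <- Q] r.+1 <= \prod_(p <- Q) (1 + 2 * g p).
    apply: le_trans h; rewrite lerDr; apply: sumr_ge0 => i _.
    by rewrite mulr_ge0 ?exprn_ge0 // elsym_ge0.
  have h3 : \prod_(p <- Q) (1 + 2 * g p) <= (2 * a) ^+ 2.
    apply: le_trans (_ : (\prod_(p <- Q) (1 + g p)) ^+ 2 <= _).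
      rewrite -prodrXl; apply: ler_prod => p _; have := g1 p; nra.
    apply: lerXn2r => //; rewrite nnegrE; last by rewrite mulr_ge0 // ltW.
    by apply: prodr_ge0 => p _; have := g1 p; lra.
  have h4 : 4 * a ^+ 3 <= 2 ^+ r.+1 :> rat.
    have := tail_level n; rewrite -/r.
    rewrite -(ler_nat rat) natrX natrX exprD exprM -/a; apply: le_trans.
    by rewrite ler_wpM2r ?exprn_ge0 ?(ltW a0) //; lra.
  move: (elsym_ge0 r.+1 g0) h2 h4; move: (elsym _ _) (2 ^+ r.+1) => E t E0 h2 h4.
  have h5 : 4 * a ^+ 3 * E <= (2 * a) ^+ 2.
    by apply: le_trans (ler_wpM2r E0 h4) _; apply: le_trans h2 h3.
  have h6 : 4 * a ^+ 2 * (a * E) <= 4 * a ^+ 2 * 1.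
    by rewrite mulr1; move: h5; congr (_ <= _); ring.
  have {}h6 : a * E <= 1 by rewrite ler_pM2l // in h6; rewrite mulr_gt0 ?exprn_gt0.
  by rewrite -[leRHS]mul1r ler_pdivlMr // mulrC.
have r_even : ~~ odd r by rewrite /r oddD oddM.
have z0 : (0 < z)%N by rewrite expn_gt0.
have lev := sieve_level (leq_trans (isT : 10 <= 33)%N n33) nk; rewrite -/z -/r in lev.
have zk : (z ^ (2 * r) <= 2 ^ k)%N.
  by apply: leq_trans lev; rewrite leq_pmull // muln_gt0 expn_gt0 expn_gt0.
have Qz : {in Q, forall p, prime p && (p <= z)%N}.
  by move=> p /QP /P32 /and3P[-> _ ->].
have := brun_box (bad_periodic e1 e2) uQ Qz r_even z0 zk kN kM.
rewrite -/g => bb.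
apply: le_trans (_ : _ <= (sum4 N M (fun a b c d => all (fun p => ~~ bad e1 e2 p a b c d) Q))%:R) _.
  rewrite ler_nat; apply: leq_sum4 => a' b c d; case E: A => //.
  rewrite lt0b; apply/allP => p /QP /P32 /and3P[pp p32 _]; exact: hA E p pp p32.
apply: le_trans bb _; rewrite ler_wpM2l ?ler0n //.
have e3 : 15 * ((z ^ (2 * r))%:R / (2 ^ k)%:R) * \prod_(p <- Q) (1 + g p) <= a^-1.
  have K0 : 0 < (2 ^ k)%:R :> rat by rewrite ltr0n expn_gt0.
  have lev' : 30 * a ^+ 2 * (z ^ (2 * r))%:R <= (2 ^ k)%:R.
    by move: lev; rewrite -(ler_nat rat) natrM natrM natrX natrX -/a.
  have q0 : 0 <= (z ^ (2 * r))%:R / (2 ^ k)%:R :> rat by rewrite divr_ge0 ?ler0n.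
  move: (z ^ (2 * r))%:R (2 ^ k)%:R K0 lev' q0 => Z K K0 lev' q0.
  apply: le_trans (ler_wpM2l (mulr_ge0 (ler0n _ 15) q0) G1) _.
  rewrite -[leRHS]mul1r (ler_pdivlMr _ _ a0).
  have -> : 15 * (Z / K) * (2 * a) * a = 30 * a ^+ 2 * Z / K by ring.
  by rewrite (ler_pdivrMr _ _ K0) mul1r.
rewrite -/a; lra.
Qed.

(** * Summation over dyadic boxes *)

(** For [k] between [2 ^ (8 n)] and [2 ^ (8 n + 8)] the value is [3 / 2 ^ (9 n)], of the
    order of [k] to the power [- 9 / 8], which is summable. *)
Definition saving (n0 k : nat) : rat :=
  if (k < 2 ^ (8 * n0))%N then 1 else 3 / 2 ^+ (9 * trunc_log (2 ^ 8) k).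

Lemma saving_ge0 n0 k : 0 <= saving n0 k.
Proof. by rewrite /saving; case: ifP => // _; rewrite divr_ge0 ?exprn_ge0. Qed.

Lemma sum_saving_block n0 n q (c : rat) : (2 ^ 8 = q.+1)%N -> 3 * q%:R <= c -> (n0 <= n)%N ->
  \sum_(k < 2 ^ (8 * n)) saving n0 k <= (2 ^ (8 * n0))%:R + c * 2 - c * 2 / 2 ^+ n.
Proof.
move=> eq8 qc.
have c0 : 0 <= c by apply: le_trans qc; rewrite mulr_ge0.
have p0 m : 0 < 2 ^+ m :> rat by rewrite exprn_gt0.
have y1 m : (2 ^+ m)^-1 <= 1 :> rat by rewrite (invf_le1 (p0 m)); apply: exprn_ege1; rewrite ler1n.
move=> /subnK <-; elim: (n - n0)%N => {n} [|m IH].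
  rewrite add0n (eq_bigr (fun=> 1)).
    rewrite sumr_const card_ord -addrA lerDl.
    by move: (y1 n0); move: (2 ^+ n0)^-1 => y hy; nra.
  by move=> k _; rewrite /saving ltn_ord.
move: IH; rewrite addSn; move: (m + n0)%N (leq_addl m n0) => n n0n IH.
have e : (2 ^ (8 * n.+1) = 2 ^ (8 * n) + q * 2 ^ (8 * n))%N.
  by rewrite mulnSr expnD mulnC eq8 mulSn.
rewrite e big_split_ord /=.
have h : \sum_(i < q * 2 ^ (8 * n)) saving n0 (2 ^ (8 * n) + i) <= c / 2 ^+ n.
  rewrite (eq_bigr (fun=> 3 / 2 ^+ (9 * n))) => [|i _]; last first.
    have le8 : (2 ^ (8 * n0) <= 2 ^ (8 * n) + i)%N.
      by rewrite (@leq_trans (2 ^ (8 * n))) ?leq_addr // leq_exp2l // leq_mul2l n0n orbT.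
    rewrite /saving ltnNge le8 /=.
    rewrite (@trunc_log_eq (2 ^ 8) n) // -!expnM leq_addr /=.
    by rewrite e ltn_add2l.
  rewrite sumr_const card_ord -[leLHS]mulr_natr natrM natrX.
  have -> : 3 / 2 ^+ (9 * n) * (q%:R * 2 ^+ (8 * n)) = 3 * q%:R / 2 ^+ n :> rat.
    rewrite (_ : 9 * n = 8 * n + n)%N; last by lia.
    by rewrite exprD; field; rewrite !gt_eqF.
  have : 0 < (2 ^+ n)^-1 :> rat by rewrite invr_gt0.
  by move=> y0; rewrite (ler_pM2r y0).
have : 0 < (2 ^+ n)^-1 :> rat by rewrite invr_gt0.
rewrite exprS invfM mulrA; move: h IH; move: (\sum_(_ < _) _) (\sum_(_ < _) _) => s1 s2.
move: ((2 ^ (8 * n0))%:R) => t; set y := (2 ^+ n)^-1 => *; lra.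
Qed.

Lemma sum_saving n0 K q (c : rat) : (2 ^ 8 = q.+1)%N -> 3 * q%:R <= c ->
  \sum_(k < K) saving n0 k <= (2 ^ (8 * n0))%:R + c * 2.
Proof.
move=> eq8 qc; have c0 : 0 <= c by apply: le_trans qc; rewrite mulr_ge0.
apply: le_trans (_ : \sum_(k < 2 ^ (8 * (n0 + K))) saving n0 k <= _).
  have h : (K <= 2 ^ (8 * (n0 + K)))%N.
    by rewrite (leq_trans (ltnW (ltn_expl K (ltnSn 1)))) // leq_exp2l //; lia.
  rewrite -(subnKC h) big_split_ord /= lerDl sumr_ge0 // => i _; exact: saving_ge0.
apply: le_trans (sum_saving_block eq8 qc (leq_addr K n0)) _.
by rewrite gerDl oppr_le0 divr_ge0 ?mulr_ge0 ?exprn_ge0.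
Qed.

(** The sieve is limited by the shorter sides of the box, that is, by [minn i j]. *)
Lemma box_saving n0 e1 e2 i j (A : nat -> nat -> nat -> nat -> bool) :
  (33 <= n0)%N ->
  (forall a b c d, A a b c d ->
     forall p, prime p -> (32 <= p)%N -> ~~ bad e1 e2 p a b c d) ->
  (sum4 (2 ^ i.+1) (2 ^ j.+1) A)%:R
    <= 16 * 4 ^+ i * 4 ^+ j * (saving n0 i + saving n0 j).
Proof.
move=> n33 hA.
have e : ((2 ^ i.+1) ^ 2 * (2 ^ j.+1) ^ 2)%:R = 16 * 4 ^+ i * 4 ^+ j :> rat.
  have p4 k : ((2 ^ k.+1) ^ 2)%N = (4 * 4 ^ k)%N.
    by rewrite -expnM mulnC expnM expnS.
  by rewrite !p4 !natrM !natrX; ring.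
apply: le_trans (_ : ((2 ^ i.+1) ^ 2 * (2 ^ j.+1) ^ 2)%:R * saving n0 (minn i j) <= _).
  rewrite /saving; case: ltnP => [_|k0].
    rewrite mulr1 ler_nat sum4_card; apply: leq_trans (max_card _) _.
    by rewrite !card_prod !card_ord -!mulnn mulnA.
  have n0k : (n0 <= trunc_log (2 ^ 8) (minn i j))%N.
    by apply: trunc_log_max; rewrite // -expnM.
  apply: (@box_bound e1 e2 _ (minn i j)) => //.
  - exact: leq_trans n33 n0k.
  - rewrite expnM; apply: trunc_logP => //.
    by rewrite (leq_trans _ k0) // expn_gt0.
  - by rewrite leq_exp2l // (leq_trans (geq_minl _ _)).
  - by rewrite leq_exp2l // (leq_trans (geq_minr _ _)).
rewrite e ler_wpM2l ?mulr_ge0 ?exprn_ge0 //.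
by have := saving_ge0 n0 i; have := saving_ge0 n0 j; case: (leqP i j) => _; lra.
Qed.

Lemma sum_geometric4 m : \sum_(j < m.+1) 4 ^+ j <= 4 / 3 * 4 ^+ m :> rat.
Proof.
elim: m => [|m IH]; first by rewrite big_ord1; lra.
by rewrite big_ord_recr /= exprS; lra.
Qed.

Lemma sum4_restrict N M N' M' f (P : nat -> nat -> nat -> nat -> bool) :
  (forall a b c d, P a b c d -> [/\ a < N', b < N', c < M' & d < M']%N) ->
  (sum4 N M (fun a b c d => P a b c d * f a b c d) <= sum4 N' M' f)%N.
Proof.
move=> hP.
have trunc K K' (h : nat -> nat) : (forall x, (K' <= x)%N -> h x = 0%N) ->
    (\sum_(x < K) h x <= \sum_(x < K') h x)%N.
  move=> h0; have [KK|KK] := leqP K K'.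
    by rewrite -(subnKC KK) big_split_ord leq_addr.
  rewrite -(subnKC (ltnW KK)) big_split_ord /= [X in (_ + X)%N]big1 ?addn0 // => i _.
  by rewrite h0 // leq_addr.
have z a b c d : ~ [/\ a < N', b < N', c < M' & d < M']%N -> (P a b c d * f a b c d = 0)%N.
  by move=> n; case E: (P a b c d) => //; case: n; apply: hP.
pose F a b c d := (P a b c d * f a b c d)%N.
rewrite /sum4 -/F; apply: leq_trans (trunc N N' (fun a => \sum_(b < N) \sum_(c < M) \sum_(d < M) F a b c d)%N _) _.
  by move=> a a0; do 3!(apply: big1 => ? _); apply: z => -[]; lia.
apply: leq_sum => a _; apply: leq_trans (trunc N N' (fun b => \sum_(c < M) \sum_(d < M) F a b c d)%N _) _.
  by move=> b b0; do 2!(apply: big1 => ? _); apply: z => -[]; lia.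
apply: leq_sum => b _; apply: leq_trans (trunc M M' (fun c => \sum_(d < M) F a b c d)%N _) _.
  by move=> c c0; apply: big1 => ? _; apply: z => -[]; lia.
apply: leq_sum => c _; apply: leq_trans (trunc M M' (F a b c) _) _.
  by move=> d d0; apply: z => -[]; lia.
by apply: leq_sum => d _; rewrite /F; case: (P a b c d); rewrite ?mul1n ?mul0n.
Qed.

(** A quadruple lies in the box of index [(i, j)] where [2 ^ i] and [2 ^ j] are the
    largest powers of [2] below the two maxima, so that [i + j <= log_2 T]. The boxes
    with a given [i] contribute a geometric sum, and [saving] is summable over [i]. *)
Lemma unobstructed_bound : exists C : nat, forall e1 e2 T
    (A : nat -> nat -> nat -> nat -> bool), (0 < T)%N ->
  (forall a b c d, A a b c d ->
     [/\ 0 < maxn a b, 0 < maxn c d & maxn a b * maxn c d <= T]%N /\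
     forall p, prime p -> (32 <= p)%N -> ~~ bad e1 e2 p a b c d) ->
  (sum4 T.+1 T.+1 A <= C * T ^ 2)%N.
Proof.
have [n0 n33] : exists n0, (33 <= n0)%N by exists 33.
have [q eq8] : exists q, (2 ^ 8 = q.+1)%N by exists 255.
pose m := (3 * q)%N; have mq : 3 * q%:R <= m%:R :> rat by rewrite natrM.
exists (43 * (2 ^ (8 * n0) + m * 2))%N => e1 e2 T A T0 hA.
pose n := trunc_log 2 T.
pose Q i j a b c d := [&& a < 2 ^ i.+1, b < 2 ^ i.+1, c < 2 ^ j.+1 & d < 2 ^ j.+1]%N.
have dyadic : (sum4 T.+1 T.+1 A <= \sum_(i < n.+1) \sum_(j < (n - i).+1)
    sum4 (2 ^ i.+1) (2 ^ j.+1) A)%N.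
  apply: (@leq_trans (\sum_(i < n.+1) \sum_(j < (n - i).+1)
    sum4 T.+1 T.+1 (fun a b c d => Q i j a b c d * A a b c d)%N)); last first.
    apply: leq_sum => i _; apply: leq_sum => j _.
    by apply: sum4_restrict => a b c d /and4P[].
  have ex : (\sum_(i < n.+1) \sum_(j < (n - i).+1)
    sum4 T.+1 T.+1 (fun a b c d => Q i j a b c d * A a b c d) =
    sum4 T.+1 T.+1 (fun a b c d => \sum_(i < n.+1) \sum_(j < (n - i).+1) Q i j a b c d * A a b c d))%N.
    have e4 (I : Type) (s : seq I) (f : I -> nat -> nat -> nat -> nat -> nat) :
       (\sum_(i <- s) sum4 T.+1 T.+1 (f i) = sum4 T.+1 T.+1 (fun a b c d => \sum_(i <- s) f i a b c d))%N.
      rewrite /sum4 exchange_big; apply: eq_bigr => a _.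
      rewrite exchange_big; apply: eq_bigr => b _.
      rewrite exchange_big; apply: eq_bigr => c _.
      by rewrite exchange_big; apply: eq_bigr => d _.
    by rewrite (eq_bigr _ (fun i _ => e4 _ _ _)) e4.
  rewrite ex; apply: leq_sum4 => a b c d; case E: (A a b c d) => //.
  have [[ab0 cd0 le] _] := hA _ _ _ _ E.
  pose i := trunc_log 2 (maxn a b); pose j := trunc_log 2 (maxn c d).
  have /andP[i1 i2] := trunc_log_bounds (ltnSn 1) ab0.
  have /andP[j1 j2] := trunc_log_bounds (ltnSn 1) cd0.
  have ijn : (i + j <= n)%N.
    by apply: trunc_log_max => //; rewrite expnD (leq_trans _ le) // leq_mul.
  have hi : (i < n.+1)%N by rewrite ltnS (leq_trans _ ijn) // leq_addr.
  have hj : (j < (n - i).+1)%N by rewrite ltnS leq_subRL // -ltnS.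
  rewrite (bigD1 (Ordinal hi)) //= (bigD1 (Ordinal hj)) //= /Q.
  move: i2 j2; rewrite -/i -/j !gtn_max => /andP[-> ->] /andP[-> ->] /=.
  by rewrite mul1n -addnA leq_addr.
rewrite -(ler_nat rat) in dyadic; rewrite -(ler_nat rat); apply: le_trans dyadic _.
have hA' a b c d : A a b c d -> forall p, prime p -> (32 <= p)%N -> ~~ bad e1 e2 p a b c d.
  by move=> h; case: (hA _ _ _ _ h).
pose S : rat := (2 ^ (8 * n0))%:R + m%:R * 2.
have half i : (i <= n)%N -> saving n0 i * 4 ^+ i * \sum_(j < (n - i).+1) 4 ^+ j <= 4 / 3 * 4 ^+ n * saving n0 i.
  move=> le; apply: le_trans (ler_wpM2l _ (sum_geometric4 _)) _.
    by rewrite mulr_ge0 ?saving_ge0 ?exprn_ge0.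
  by rewrite -[in leRHS](subnKC le) exprD le_eqVlt; apply/orP; left; apply/eqP; ring.
have tot : \sum_(i < n.+1) saving n0 i * 4 ^+ i * \sum_(j < (n - i).+1) 4 ^+ j <= 4 / 3 * 4 ^+ n * S.
  apply: le_trans (_ : \sum_(i < n.+1) 4 / 3 * 4 ^+ n * saving n0 i <= _).
    by apply: ler_sum => i _; apply: half; rewrite -ltnS.
  by rewrite -mulr_sumr ler_wpM2l ?mulr_ge0 ?exprn_ge0 // (sum_saving _ _ eq8 mq).
(* The range of (i, j) is symmetric. *)
have sym : \sum_(i < n.+1) \sum_(j < (n - i).+1) 4 ^+ i * 4 ^+ j * saving n0 j =
   \sum_(i < n.+1) \sum_(j < (n - i).+1) 4 ^+ i * 4 ^+ j * saving n0 i.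
  have tri (F : nat -> nat -> rat) : \sum_(i < n.+1) \sum_(j < (n - i).+1) F i j =
     \sum_(i < n.+1) \sum_(j < n.+1 | (i + j <= n)%N) F i j.
    apply: eq_bigr => i _.
    have hi : ((n - i).+1 <= n.+1)%N by rewrite ltnS leq_subr.
    rewrite (big_ord_widen _ (F i) hi); apply: eq_bigl => j /=.
    by rewrite ltnS leq_subRL // -ltnS.
  rewrite (tri (fun i j => 4 ^+ i * 4 ^+ j * saving n0 j)).
  rewrite (tri (fun i j => 4 ^+ i * 4 ^+ j * saving n0 i)).
  rewrite (exchange_big_dep xpredT) //=; apply: eq_bigr => i _.
  by apply: eq_big => [j|j _]; rewrite 1?addnC // [4 ^+ j * _]mulrC.
have lhs : (\sum_(i < n.+1) \sum_(j < (n - i).+1) sum4 (2 ^ i.+1) (2 ^ j.+1) A)%:R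
    <= 32 * (4 / 3 * 4 ^+ n * S).
  rewrite natr_sum.
  apply: le_trans (_ : \sum_(i < n.+1) \sum_(j < (n - i).+1)
     16 * (4 ^+ i * 4 ^+ j * saving n0 i + 4 ^+ i * 4 ^+ j * saving n0 j) <= _).
    apply: ler_sum => i _; rewrite natr_sum; apply: ler_sum => j _.
    apply: le_trans (box_saving i j n33 hA') _.
    by rewrite le_eqVlt; apply/orP; left; apply/eqP; ring.
  have -> : \sum_(i < n.+1) \sum_(j < (n - i).+1)
     16 * (4 ^+ i * 4 ^+ j * saving n0 i + 4 ^+ i * 4 ^+ j * saving n0 j) =
     16 * (\sum_(i < n.+1) \sum_(j < (n - i).+1) 4 ^+ i * 4 ^+ j * saving n0 i
       + \sum_(i < n.+1) \sum_(j < (n - i).+1) 4 ^+ i * 4 ^+ j * saving n0 j).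
    rewrite -big_split mulr_sumr; apply: eq_bigr => i _.
    by rewrite -big_split mulr_sumr; apply: eq_bigr.
  rewrite sym.
  have -> : \sum_(i < n.+1) \sum_(j < (n - i).+1) 4 ^+ i * 4 ^+ j * saving n0 i =
    \sum_(i < n.+1) saving n0 i * 4 ^+ i * \sum_(j < (n - i).+1) 4 ^+ j.
    apply: eq_bigr => i _; rewrite mulr_sumr; apply: eq_bigr => j _.
    by rewrite mulrC mulrA.
  by move: tot; move: (\sum_(_ < _) _) (4 / 3 * _ * _) => ? ? ?; lra.
apply: le_trans lhs _.
have Tn : 4 ^+ n <= (T ^ 2)%:R :> rat.
  rewrite -[4 ^+ n]natrX ler_nat (_ : 4 = 2 ^ 2)%N // -expnM mulnC expnM leq_exp2r //.
  exact: trunc_logP.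
have S0 : 0 <= S by rewrite addr_ge0 ?mulr_ge0 ?ler0n.
rewrite natrM natrM natrD (natrM _ m) -/S.
move: (4 ^+ n) (T ^ 2)%:R Tn (exprn_ge0 n (ler0n rat 4)) => x y xy x0.
have := ler_wpM2r S0 xy; have := mulr_ge0 x0 S0; move: (S) => s; nra.
Qed.

(** * Residue fields *)

Local Open Scope classical_set_scope.

Definition proper_ideal_set (A : comPzRingType) (I : set A) :=
  [/\ forall x y, I x -> I y -> I (x + y), forall r x, I x -> I (r * x) & ~ I 1].

(** Zorn's lemma is applied to the ideals that contain [a] or are empty, so that the
    empty chain needs no separate treatment. *)
Lemma maximal_ideal (A : comPzRingType) (a : A) : (forall b, b * a <> 1) ->
  exists M : set A, [/\ proper_ideal_set M, M a &
    forall x, ~ M x -> exists y, M (1 - y * x)].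
Proof.
move=> na; pose P (I : set A) := proper_ideal_set I /\ forall x, I x -> I a.
have [F FP Ftot|M [[[MD MM M1] Ma] Mmax]] := @Zorn_bigcup A P.
  split; last by move=> x [X FX Xx]; exists X => //; case: (FP _ FX) => _; apply; exact: Xx.
  split=> [x y [X FX Xx] [Y FY Yy]|r x [X FX Xx]|[X FX X1]].
  - have [XY|YX] := Ftot _ _ FX FY.
      by exists Y => //; case: (FP _ FY) => -[YD _ _] _; apply: YD => //; exact: XY.
    by exists X => //; case: (FP _ FX) => -[XD _ _] _; apply: XD => //; exact: YX.
  - by exists X => //; case: (FP _ FX) => -[_ XM _] _; exact: XM.
  - by case: (FP _ FX) => -[_ _ h] _.
have Ma' : M a.
  apply: contrapT => nMa; pose I := [set x | exists b, x = b * a].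
  have I0 : M `<` I.
    split; first by move=> x Mx; case: nMa; apply: Ma Mx.
    by move=> /(_ a (ex_intro _ 1 (esym (mul1r a)))).
  apply: (Mmax _ I0); split; last by move=> _ _; exists 1; rewrite mul1r.
  split=> [x y [b ->] [c ->]|r x [b ->]|[b /esym]]; last exact: na.
    by exists (b + c); rewrite mulrDl.
  by exists (r * b); rewrite mulrA.
exists M; split=> // x nMx; apply: contrapT => nex.
pose I := [set z | exists m y, M m /\ z = m + y * x].
have M0 : M 0 by rewrite -(mul0r a); apply: MM.
have MI : M `<` I.
  split; first by move=> m Mm; exists m, 0; rewrite mul0r addr0.
  by move=> /(_ x) h; apply: nMx; apply: h; exists 0, 1; rewrite mul1r add0r.
apply: (Mmax _ MI); split; last by move=> _ _; exists a, 0; rewrite mul0r addr0.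
split=> [z w [m [y [Mm ->]]] [n [v [Mn ->]]]|r z [m [y [Mm ->]]]|[m [y [Mm e]]]].
- by exists (m + n), (y + v); split; [exact: MD|ring].
- by exists (r * m), (r * y); split; [exact: MM|ring].
- by apply: nex; exists y; rewrite e addrK.
Qed.

Lemma field_of_inverses (Q : comNzRingType) :
  (forall x : Q, x != 0 -> exists y, y * x = 1) ->
  exists K : fieldType, inhabited {rmorphism Q -> K}.
Proof.
move=> hinv.
have /choice[inv invP] : forall x : Q, exists y, (x != 0 -> y * x = 1) /\ (x = 0 -> y = 0).
  move=> x; have [->|x0] := eqVneq x 0; first by exists 0.
  by have [y yx] := hinv x x0; exists y; split=> // x00; rewrite x00 eqxx in x0.
have unit1 : {in (fun x : Q => x != 0), left_inverse 1 inv *%R}.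
  by move=> x x0; case: (invP x) => + _; apply.
have unit2 (x y : Q) : y * x = 1 -> x != 0.
  by move=> e; apply/eqP => x0; move: e; rewrite x0 mulr0 => /esym/eqP; rewrite oner_eq0.
have unit3 : {in [predC (fun x : Q => x != 0)], inv =1 id}.
  by move=> x; rewrite inE /= negbK => /eqP x0; case: (invP x) => _ ->.
pose m1 := GRing.ComNzRing_hasMulInverse.Build Q unit1 unit2 unit3.
pose Q1 : comUnitRingType := HB.pack Q m1.
have fP : GRing.field_axiom Q1 by move=> x x0; exact: x0.
pose m2 := GRing.ComUnitRing_isField.Build Q1 fP.
pose K : fieldType := HB.pack Q1 m2.
by exists K; split; exact: (idfun : {rmorphism Q -> Q}).
Qed.

(** This is how a statement about all the fields under [A], such as the rank condition in
    [is_line], gives a statement about [A]. *)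
Lemma residue_field (A : comPzRingType) (a : A) : (forall b, b * a <> 1) ->
  exists (K : fieldType) (f : {rmorphism A -> K}), f a = 0.
Proof.
move=> /maximal_ideal[M [[MD MM M1] Ma Mmax]].
have n10 : (1 : A) != 0.
  by apply/eqP => e; apply: M1; rewrite e -(mul0r a); exact: MM.
pose m0 := GRing.PzSemiRing_isNonZero.Build A n10.
pose A' : comNzRingType := HB.pack A m0.
pose S : {pred A'} := fun x => `[< M x >].
have Sid : idealr_closed S.
  split.
  - by apply/asboolP; rewrite -(mul0r a); exact: MM.
  - by apply/negP => /asboolP.
  - by move=> r x y /asboolP Mx /asboolP My; apply/asboolP; apply: MD => //; exact: MM.
pose m1 := isIdealr.Build A' S Sid.
pose J : idealr A' := HB.pack S m1.
pose Q : comNzRingType := {ideal_quot J}.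
pose q : {rmorphism A' -> Q} := (\pi_Q)%qT.
have q0 (x : A') : M x -> q x = 0.
  move=> Mx; apply/eqP; rewrite -(rmorph0 q) -[_ == _](Quotient.idealrBE J) subr0.
  exact/asboolP.
have [|K [g]] := @field_of_inverses Q.
  move=> x x0; have ex : q (repr x) = x by exact: reprK.
  have nM : ~ M (repr x) by move=> /q0; rewrite ex => /eqP; apply/negP.
  have [y My] := Mmax _ nM; exists (q y).
  by apply/eqP; rewrite eq_sym -subr_eq0 -[X in _ * X]ex -rmorphM -(rmorph1 q) -rmorphB q0.
exists K, (g \o q : {rmorphism A' -> K}).
by rewrite /= q0 // rmorph0.
Qed.

(** * Lines in a free module *)

(** The determinant of [1 - e] is [1] in every field, hence a unit, and [1 - e] kills
    [e]. *)
Lemma idempotent_eq0 (A : comPzRingType) n (e : 'M[A]_n) : e *m e = e ->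
  (forall (K : fieldType) (f : {rmorphism A -> K}), map_mx f e = 0) -> e = 0.
Proof.
move=> ee e0; have [[b hb]|nu] := pselect (exists b, b * \det (1%:M - e) = 1).
  have h : (1%:M - e) *m e = 0 by rewrite mulmxBl mul1mx ee subrr.
  have : \adj (1%:M - e) *m ((1%:M - e) *m e) = 0 by rewrite h mulmx0.
  rewrite mulmxA mul_adj_mx mul_scalar_mx => h2.
  by rewrite -[LHS]scale1r -hb -scalerA h2 scaler0.
have [|K [f f0]] := @residue_field A (\det (1%:M - e)).
  by move=> b hb; apply: nu; exists b.
have f1 : f (\det (1%:M - e)) = 1.
  by rewrite -det_map_mx map_mxB e0 subr0 map_mx1 det1.
by have := oner_neq0 K; rewrite -f1 f0 eqxx.
Qed.

Lemma row_delta (A : pzRingType) n (x : 'rV[A]_n) i :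
  x *m delta_mx i 0 = (x 0 i)%:M :> 'M_1.
Proof.
apply/matrixP => r s; rewrite !ord1 mxE (bigD1 i) //= !mxE !eqxx mulr1n mulr1.
by rewrite big1 ?addr0 // => j ji; rewrite mxE (negPf ji) mulr0.
Qed.

(** The idempotent [e - e d x], where [d] is the [i]-th basis column, projects the line
    onto its vectors whose [i]-th coordinate is zero. It vanishes over every field since a
    line is generated there by any nonzero vector. *)
Lemma line_generator (A : comPzRingType) n (L : set 'rV[A]_n) i x : is_line L ->
  L x -> x 0 i = 1 -> forall z, L z -> z = z 0 i *: x.
Proof.
case=> e [ee -> rk] [u _ ux] xi z [v _ vz].
have xe : x *m e = x by rewrite -ux -mulmxA ee.
have ze : z *m e = z by rewrite -vz -mulmxA ee.
pose d : 'cV[A]_n := delta_mx i 0; pose e' := e - e *m d *m x.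
have xd : x *m d = 1%:M by rewrite row_delta xi.
have e'0 : e' = 0.
  apply: idempotent_eq0 => [|K f].
    have pe : e *m d *m x *m e = e *m d *m x by rewrite -mulmxA xe.
    have ep : e *m (e *m d *m x) = e *m d *m x by rewrite !mulmxA ee.
    have xp : x *m (e *m d *m x) = x by rewrite !mulmxA xe xd mul1mx.
    have pp : e *m d *m x *m (e *m d *m x) = e *m d *m x by rewrite -[LHS]mulmxA xp.
    by rewrite /e' mulmxBl !mulmxBr ee pe ep pp subrr subr0.
  (* Over K the line is spanned by the image of x, so that e factors through it. *)
  have xm : map_mx f x *m map_mx f d = 1%:M by rewrite -map_mxM xd map_mx1.
  have le : (map_mx f x <= map_mx f e)%MS by rewrite -xe map_mxM submxMl.
  have x0 : map_mx f x != 0.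
    by apply: contraNneq (oner_neq0 K) => /matrixP /(_ 0 i); rewrite !mxE xi rmorph1 => ->.
  have : (map_mx f e <= map_mx f x)%MS.
    by rewrite -(geq_leqif (mxrank_leqif_sup le)) rk lt0n mxrank_eq0.
  case/submxP => D eD; rewrite /e' map_mxB !map_mxM eD -[D *m _ *m map_mx f d]mulmxA xm.
  by rewrite mulmx1 subrr.
have : z *m e' = 0 by rewrite e'0 mulmx0.
rewrite /e' mulmxBr !mulmxA ze row_delta mul_scalar_mx => /eqP.
by rewrite subr_eq0 => /eqP.
Qed.

Definition span1 (A : comPzRingType) n (x : 'rV[A]_n) : set 'rV[A]_n :=
  [set c *: x | c in [set: A]].

Lemma span1_range (A : comPzRingType) n (x : 'rV[A]_n) i : x 0 i = 1 ->
  span1 x = range (fun u : 'rV[A]_n => u *m (delta_mx i 0 *m x)).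
Proof.
move=> xi; apply/seteqP; split=> y [c _ <-].
  by exists (c *: x) => //; rewrite mulmxA row_delta mul_scalar_mx mxE xi mulr1.
by exists (c 0 i) => //; rewrite mulmxA row_delta mul_scalar_mx.
Qed.

Lemma span1_line (A : comPzRingType) n (x : 'rV[A]_n) i : x 0 i = 1 ->
  is_line (span1 x).
Proof.
move=> xi; exists (delta_mx i 0 *m x); split; last 1 first.
- move=> K f; rewrite map_mxM; apply/eqP; rewrite eqn_leq lt0n mxrank_eq0.
  apply/andP; split; first exact: mulmx_max_rank.
  apply: contraNneq (oner_neq0 K) => /matrixP /(_ i i).
  by rewrite !mxE big_ord1 !mxE !eqxx xi rmorph1 mulr1 => ->.
- by rewrite mulmxA -[delta_mx i 0 *m x *m _]mulmxA row_delta xi mulmx1.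
- exact: span1_range.
Qed.

Lemma span1_base_change (A B : comPzRingType) (f : {rmorphism A -> B}) n
    (x : 'rV[A]_n) i : x 0 i = 1 -> base_change f (span1 x) = span1 (map_mx f x).
Proof.
move=> xi; have fxi : (map_mx f x) 0 i = 1 by rewrite mxE xi rmorph1.
rewrite (span1_range xi) (span1_range fxi) base_change_range.
by rewrite map_mxM map_delta_mx.
Qed.

Lemma line_span1 (A : comPzRingType) n (L : set 'rV[A]_n) i x : is_line L ->
  L x -> x 0 i = 1 -> L = span1 x.
Proof.
move=> lL Lx xi; apply/seteqP; split=> z.
  by move=> /(line_generator lL Lx xi) ->; exists (z 0 i).
case: lL Lx => e [ee -> rk] [u _ <-] [c _ <-].
by exists (c *: u) => //; rewrite -scalemxAl.
Qed.

Lemma map_base_change (A B : comPzRingType) (f : {rmorphism A -> B}) n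
    (L : set 'rV[A]_n) x : L x -> base_change f L (map_mx f x).
Proof.
by move=> Lx; exists 1%N, (fun=> 1), (fun=> x); split=> //; rewrite big_ord1 scale1r.
Qed.

(** * The coordinate ring of the chart *)

Lemma rat_rmorphism_eq (B : pzRingType) (f g : {rmorphism rat -> B}) : f =1 g.
Proof.
move=> a; have d0 : (denq a)%:~R != 0 :> rat by rewrite intr_eq0 denq_neq0.
have fg (z : int) : f z%:~R = g z%:~R by rewrite !rmorph_int.
have e : f a * f (denq a)%:~R = g a * f (denq a)%:~R.
  rewrite -rmorphM fg -rmorphM; have -> : a * (denq a)%:~R = (numq a)%:~R.
    by rewrite -{1}(divq_num_den a) divfK.
  exact: fg.
have u : f (denq a)%:~R * f (denq a)%:~R^-1 = 1 by rewrite -rmorphM divff // rmorph1.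
by rewrite -[f a]mulr1 -[g a]mulr1 -u !mulrA e.
Qed.

(** Packs a map that is only known to satisfy the equations of a ring morphism. *)
Lemma make_rmorphism (A B : pzRingType) (f : A -> B) :
  zmod_morphism f -> monoid_morphism f -> exists g : {rmorphism A -> B}, g =1 f.
Proof.
move=> fz fm.
pose m1 := GRing.isZmodMorphism.Build A B f fz.
pose m2 := GRing.isMonoidMorphism.Build A B f fm.
pose g : {rmorphism A -> B} := HB.pack f m1 m2.
by exists g.
Qed.

(** [A] is generated by the [s i] as an algebra over [m]; this is the condition in
    [finitely_generated], with an arbitrary index type. *)
Definition generates (A : comPzRingType) (m : rat -> A) (I : Type) (s : I -> A) :=
  forall P : set A, (forall a, P (m a)) -> (forall i, P (s i)) ->
    (forall a b, P a -> P b -> P (a + b)) ->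
    (forall a b, P a -> P b -> P (a * b)) ->
  forall b, P b.

Lemma generates_eq (A : comPzRingType) (m : {rmorphism rat -> A}) I (s : I -> A)
    (B : pzRingType) (f g : {rmorphism A -> B}) :
  generates m s -> (forall i, f (s i) = g (s i)) -> f =1 g.
Proof.
move=> gen fg; apply: gen => //.
- by move=> a; apply: (rat_rmorphism_eq (f \o m : {rmorphism rat -> B}) (g \o m : {rmorphism rat -> B})).
- by move=> a b fa fb; rewrite /= !rmorphD fa fb.
- by move=> a b fa fb; rewrite /= !rmorphM fa fb.
Qed.

Lemma zero_rmorphism (A B : pzRingType) : (1 : B) = 0 ->
  inhabited {rmorphism A -> B}.
Proof.
move=> e; have B0 (b : B) : b = 0 by rewrite -[b]mulr1 e mulr0.
have [||g _] := @make_rmorphism A B (fun=> 0); last by split.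
- by move=> x y; rewrite subr0.
- by split=> [|x y]; rewrite ?e ?mulr0.
Qed.

(** The evaluation of polynomials requires a nonzero ring; a morphism to the zero ring
    is constant. *)
Lemma poly_rmorphism (P : comNzRingType) (B : comPzRingType) (f : {rmorphism P -> B}) (b : B) :
  exists g : {rmorphism {poly P} -> B}, g 'X = b /\ forall c, g c%:P = f c.
Proof.
have [e|n10] := eqVneq (1 : B) 0.
  have B0 (x : B) : x = 0 by rewrite -[x]mulr1 e mulr0.
  have [g] := zero_rmorphism {poly P} e; exists g; split=> [|c].
    by rewrite (B0 (g 'X)) (B0 b).
  by rewrite (B0 (g _)) (B0 (f c)).
pose m0 := GRing.PzSemiRing_isNonZero.Build B n10.
pose B' : comNzRingType := HB.pack (GRing.ComPzRing.sort B) m0.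
pose f' : {rmorphism P -> B'} := f.
have cf : commr_rmorph f' (b : B') by move=> x; exact: mulrC.
exists (horner_morph cf : {rmorphism {poly P} -> B'}); split=> [|c].
  by rewrite /= horner_morphX.
by rewrite /= horner_morphC.
Qed.

(** The polynomial ring in [n] variables, obtained by adjoining one variable at a time
    and described by its universal property. *)
Lemma free_algebra n : exists (P : comNzRingType) (m : {rmorphism rat -> P})
    (s : 'I_n -> P), generates m s /\
  forall (B : qalg) (b : 'I_n -> B), exists f : {rmorphism P -> B},
    forall i, f (s i) = b i.
Proof.
elim: n => [|n [P [m [s [gen free]]]]].
  exists rat, idfun, (fun=> 0); split; first by move=> Q Qm.
  by move=> B b; exists (qalg_map B) => -[].
exists {poly P}, (polyC \o m : {rmorphism rat -> {poly P}}).
exists (fun i => if unlift ord_max i is Some j then (s j)%:P else 'X); split.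
  move=> Q Qm Qs QD QM.
  have QX : Q 'X by have := Qs ord_max; rewrite unlift_none.
  have QC c : Q c%:P.
    apply: (gen (fun c => Q c%:P)) => [a|i|a b|a b]; first exact: Qm.
    - by have := Qs (lift ord_max i); rewrite liftK.
    - by rewrite polyCD; apply: QD.
    - by rewrite polyCM; apply: QM.
  by elim/poly_ind => [|p c Qp]; [rewrite -polyC0|apply: QD => //; apply: QM].
move=> B b; have [f fs] := free B (fun j => b (lift ord_max j)).
have [g [gX gC]] := poly_rmorphism f (b ord_max).
by exists g => i; case: unliftP => [j ->|->]; rewrite ?gC ?fs.
Qed.

(** The ring [Q[x_1, x_2, x_3, t, 1 / t]], as the quotient of a polynomial ring by
    [t s - 1]. *)
Lemma coordinate_algebra : exists (A : qalg) (x : 'I_3 -> A) (t s : A),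
  [/\ t * s = 1,
      generates (structure_map A) (fun i : 'I_5 => [:: x 0; x 1; x 2; t; s]`_i) &
      forall (B : qalg) (b : 'I_3 -> B) (c d : B), c * d = 1 ->
        exists f : {rmorphism A -> B}, [/\ forall i, f (x i) = b i, f t = c & f s = d]].
Proof.
have [P [m [v [gen free]]]] := free_algebra 5.
pose w : P := v 3 * v 4 - 1.
pose S : {pred P} := fun p => `[< exists q, p = q * w >].
have killed (B : qalg) (f : {rmorphism P -> B}) : f (v 3) * f (v 4) = 1 ->
    forall p, p \in S -> f p = 0.
  move=> f1 p /asboolP[q ->].
  by rewrite rmorphM rmorphB rmorphM rmorph1 f1 subrr mulr0.
have Sid : idealr_closed S.
  split; first by apply/asboolP; exists 0; rewrite mul0r.
    have [f fv] := free Qalg (fun=> 1); apply/negP => /(killed Qalg f).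
    by rewrite !fv mulr1 rmorph1 => /(_ erefl)/eqP; rewrite oner_eq0.
  move=> r x y /asboolP[q ->] /asboolP[q' ->]; apply/asboolP; exists (r * q + q').
  by rewrite mulrDl mulrA.
pose m1 := isIdealr.Build P S Sid.
pose J : idealr P := HB.pack S m1.
pose Q : comNzRingType := {ideal_quot J}.
pose q : {rmorphism P -> Q} := (\pi_Q)%qT.
have q0 (x y : P) : q x = q y <-> x - y \in S.
  have -> : (x - y \in S) = (q x == q y) by exact: (Quotient.idealrBE J).
  by split=> /eqP.
have qK x : q (repr x) = x by exact: reprK.
pose A : qalg := QAlg (q \o m : {rmorphism rat -> Q}).
exists A, (fun i : 'I_3 => q (v (inord i))), (q (v 3)), (q (v 4)); split.
- by rewrite -rmorphM -(rmorph1 q); apply/q0/asboolP; exists 1; rewrite mul1r.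
- move=> R Rm Rs RD RM b; rewrite -(qK b).
  apply: (gen (fun p => R (q p))) => [a|i|x y|x y].
  + exact: Rm.
  + have := Rs i; rewrite [X in R X -> _](_ : _ = q (v i)) //.
    have vi (j k : 'I_5) : j = k :> nat -> q (v j) = q (v k) by move=> /val_inj ->.
    by case: i => -[|[|[|[|[|]]]]] //= i5; apply: vi; rewrite /= ?inordK.
  + by rewrite rmorphD; apply: RD.
  + by rewrite rmorphM; apply: RM.
- move=> B b c d cd.
  have [f fv] := free B (fun i => [:: b 0; b 1; b 2; c; d]`_i).
  have f34 : f (v 3) * f (v 4) = 1 by rewrite !fv.
  have fq x y : q x = q y -> f x = f y.
    by move=> /q0 /(killed _ _ f34) /eqP; rewrite rmorphB subr_eq0 => /eqP.
  have [||g gE] := @make_rmorphism A B (fun x => f (repr x)).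
  + by move=> x y; rewrite -rmorphB; apply: fq; rewrite rmorphB !qK.
  + split; first by rewrite -(rmorph1 f); apply: fq; rewrite qK rmorph1.
    by move=> x y; rewrite -rmorphM; apply: fq; rewrite rmorphM !qK.
  have gq p : g (q p) = f p by rewrite gE; apply: fq; rewrite qK.
  exists g; split=> [i||]; rewrite gq fv //.
  have bi (j k : 'I_3) : j = k :> nat -> b j = b k by move=> /val_inj ->.
  by case: i => -[|[|[|]]] //= i3; rewrite inordK //=; apply: bi.
Qed.

(** * An open subscheme of the total space *)

Lemma X_point_eq (B : qalg) (z w : X B) :
  sval (sval z).1 = sval (sval w).1 -> sval (sval z).2 = sval (sval w).2 -> z = w.
Proof.
case: z w => [[[L lL] [M lM]] h] [[[L' lL'] [M' lM']] h'] /= eL eM.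
by apply: eq_exist; congr pair; apply: eq_exist.
Qed.

(** The open subscheme of [X] where [x_0], [y_1] and [y_3 x_0 ^ 2 + y_1 x_2 ^ 2] are
    invertible, with [x_0] and [y_1] normalised to [1]. *)
Program Definition chart : subfunctor X :=
  SubFunctor (X := X) (fun B z => exists x y w,
    [/\ sval (sval z).1 x, sval (sval z).2 y, x 0 0 = 1, y 0 1 = 1
      & (y 0 3 + x 0 2 ^+ 2) * w = 1]) _.
Next Obligation.
move=> A B f z [x [y [w [Lx My x0 y1 q]]]].
exists (map_mx f x), (map_mx f y), (f w); split; rewrite ?mxE ?x0 ?y1 ?rmorph1 //.
- exact: map_base_change.
- exact: map_base_change.
- by rewrite -rmorphXn -rmorphD -rmorphM q rmorph1.
Qed.

Section IdealSpan.
Variables (A : comPzRingType) (J : set A).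
Definition ideal_span (b : A) :=
  exists n (s c : 'I_n -> A), (forall i, J (s i)) /\ \sum_i c i * s i = b.

Lemma ideal_span0 : ideal_span 0.
Proof. by exists 0%N, (fun=> 0), (fun=> 0); split=> [[]//|]; rewrite big_ord0. Qed.

Lemma ideal_spanD a b : ideal_span a -> ideal_span b -> ideal_span (a + b).
Proof.
move=> [n [s [c [Js <-]]]] [m [t [d [Jt <-]]]].
exists (n + m)%N, (fun i => match fintype.split i with inl j => s j | inr j => t j end),
  (fun i => match fintype.split i with inl j => c j | inr j => d j end); split.
  by move=> i; case: fintype.split.
by rewrite big_split_ord /=; congr (_ + _); apply: eq_bigr => i _;
  rewrite ?(unsplitK (inl i)) ?(unsplitK (inr i)).
Qed.

Lemma ideal_spanM r a : ideal_span a -> ideal_span (r * a).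
Proof.
move=> [n [s [c [Js <-]]]]; exists n, s, (fun i => r * c i); split=> //.
by rewrite mulr_sumr; apply: eq_bigr => i _; rewrite mulrA.
Qed.

Lemma ideal_span_mem a : J a -> ideal_span a.
Proof.
move=> Ja; exists 1%N, (fun=> a), (fun=> 1); split=> //.
by rewrite big_ord1 mul1r.
Qed.
End IdealSpan.

(** A base change consists of linear combinations, so that membership of the values of
    a linear form in an ideal is tested on the original line. *)
Lemma ideal_span_base_change (A B : comPzRingType) (f : {rmorphism A -> B}) n
    (L : set 'rV[A]_n) (J : set B) (h : 'rV[B]_n -> B) :
  h 0 = 0 -> (forall u v, h (u + v) = h u + h v) ->
  (forall c u, h (c *: u) = c * h u) ->
  (forall u, L u -> ideal_span J (h (map_mx f u))) ->
  forall w, base_change f L w -> ideal_span J (h w).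
Proof.
move=> h0 hD hZ hL; apply: base_change_ind => //.
- by rewrite h0; apply: ideal_span0.
- by move=> u v hu hv; rewrite hD; apply: ideal_spanD.
- by move=> c u hu; rewrite hZ; apply: ideal_spanM.
Qed.

(** The product of the three functions to be inverted on the chart. The last one is
    replaced by its polarisation, in order to have an expression that is linear in each of
    five vectors; its value on the diagonal is [x_0 y_1 (y_3 x_0 ^ 2 + y_1 x_2 ^ 2)]. *)
Definition chart_form (B : pzRingType) (x y x' x'' y' : 'rV[B]_4) : B :=
  x 0 0 * (y 0 1 * (y' 0 3 * (x' 0 0 * x'' 0 0) + y' 0 1 * (x' 0 2 * x'' 0 2))).

(** The ideal is generated by the values of [chart_form]. If these generate the unit
    ideal, then so do the coordinates [x_0] of the vectors of the first line, which
    therefore contains a vector with [x_0 = 1], and similarly for [y_1]. *)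
Lemma chart_open : is_open chart.
Proof.
move=> A z; pose L := sval (sval z).1; pose M := sval (sval z).2.
pose J := [set a | exists x y x' x'' y', [/\ L x, M y, L x', L x'' & M y'] /\
  a = chart_form x y x' x'' y'].
have lL : is_line L by exact: svalP.
have lM : is_line M by exact: svalP.
exists J => B f; split.
  move=> [x [y [w [Lx My x0 y1 q]]]].
  suff h : ideal_span (f @` J) (chart_form x y x x y).
    have := ideal_spanM w h.
    rewrite /chart_form x0 y1 !mul1r mulr1 -expr2 mulrC q.
    by [].
  have step x1 y2 x3 x4 y5 : L x1 -> M y2 -> L x3 -> L x4 -> M y5 ->
      ideal_span (f @` J) (chart_form (map_mx f x1) (map_mx f y2) (map_mx f x3) (map_mx f x4) (map_mx f y5)).
    move=> h1 h2 h3 h4 h5; apply: ideal_span_mem.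
    exists (chart_form x1 y2 x3 x4 y5); first by exists x1, y2, x3, x4, y5.
    by rewrite /chart_form !mxE !(rmorphM, rmorphD).
  rewrite -/L in Lx; rewrite -/M in My.
  have s5 x1 y2 x3 x4 y5 : L x1 -> M y2 -> L x3 -> L x4 -> base_change f M y5 ->
      ideal_span (f @` J) (chart_form (map_mx f x1) (map_mx f y2) (map_mx f x3) (map_mx f x4) y5).
    move=> h1 h2 h3 h4.
    apply: (ideal_span_base_change (h := fun v => chart_form _ _ _ _ v)) => [|u v|c u|u hu]; last exact: step.
    1-3: by rewrite /chart_form !mxE; ring.
  have s4 x1 y2 x3 x4 y5 : L x1 -> M y2 -> L x3 -> base_change f L x4 -> base_change f M y5 ->
      ideal_span (f @` J) (chart_form (map_mx f x1) (map_mx f y2) (map_mx f x3) x4 y5).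
    move=> h1 h2 h3 + h5; move: x4.
    apply: (ideal_span_base_change (h := fun v => chart_form _ _ _ v _)) => [|u v|c u|u hu]; last exact: s5.
    1-3: by rewrite /chart_form !mxE; ring.
  have s3 x1 y2 x3 x4 y5 : L x1 -> M y2 -> base_change f L x3 -> base_change f L x4 -> base_change f M y5 ->
      ideal_span (f @` J) (chart_form (map_mx f x1) (map_mx f y2) x3 x4 y5).
    move=> h1 h2 + h4 h5; move: x3.
    apply: (ideal_span_base_change (h := fun v => chart_form _ _ v _ _)) => [|u v|c u|u hu]; last exact: s4.
    1-3: by rewrite /chart_form !mxE; ring.
  have s2 x1 y2 x3 x4 y5 : L x1 -> base_change f M y2 -> base_change f L x3 -> base_change f L x4 -> base_change f M y5 ->
      ideal_span (f @` J) (chart_form (map_mx f x1) y2 x3 x4 y5).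
    move=> h1 + h3 h4 h5; move: y2.
    apply: (ideal_span_base_change (h := fun v => chart_form _ v _ _ _)) => [|u v|c u|u hu]; last exact: s3.
    1-3: by rewrite /chart_form !mxE; ring.
  have s1 x1 y2 x3 x4 y5 : base_change f L x1 -> base_change f M y2 -> base_change f L x3 -> base_change f L x4 -> base_change f M y5 ->
      ideal_span (f @` J) (chart_form x1 y2 x3 x4 y5).
    move=> + h2 h3 h4 h5; move: x1.
    apply: (ideal_span_base_change (h := fun v => chart_form v _ _ _ _)) => [|u v|c u|u hu]; last exact: s2.
    1-3: by rewrite /chart_form !mxE; ring.
  exact: s1.
move=> [n [s [c [Js e]]]].
have /choice[g gP] : forall i, exists g : ('rV[A]_4 * 'rV[A]_4) * ('rV[A]_4 * 'rV[A]_4 * 'rV[A]_4),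
   [/\ L g.1.1, M g.1.2, L g.2.1.1, L g.2.1.2 & M g.2.2] /\
   s i = chart_form (map_mx f g.1.1) (map_mx f g.1.2) (map_mx f g.2.1.1) (map_mx f g.2.1.2) (map_mx f g.2.2).
  move=> i; case: (Js i) => _ [x [y [x' [x'' [y' [h ->]]]]]] <-.
  exists ((x, y), ((x', x''), y')); split=> //=.
  by rewrite /chart_form !mxE !(rmorphM, rmorphD).
pose X1 i := map_mx f (g i).1.1; pose Y1 i := map_mx f (g i).1.2.
pose X2 i := map_mx f (g i).2.1.1; pose X3 i := map_mx f (g i).2.1.2.
pose Y2 i := map_mx f (g i).2.2.
pose q i := Y2 i 0 3 * (X2 i 0 0 * X3 i 0 0) + Y2 i 0 1 * (X2 i 0 2 * X3 i 0 2).
have e1 : \sum_i c i * (X1 i 0 0 * (Y1 i 0 1 * q i)) = 1.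
  by rewrite -e; apply: eq_bigr => i _; case: (gP i) => _ ->.
pose x := \sum_i (c i * (Y1 i 0 1 * q i)) *: X1 i.
pose y := \sum_i (c i * (X1 i 0 0 * q i)) *: Y1 i.
have Lx : base_change f L x.
  by exists n, (fun i => c i * (Y1 i 0 1 * q i)), (fun i => (g i).1.1); split=> // i; case: (gP i) => -[].
have My : base_change f M y.
  by exists n, (fun i => c i * (X1 i 0 0 * q i)), (fun i => (g i).1.2); split=> // i; case: (gP i) => -[].
have x0 : x 0 0 = 1.
  by rewrite -e1 summxE; apply: eq_bigr => i _; rewrite mxE; ring.
have y1 : y 0 1 = 1.
  by rewrite -e1 summxE; apply: eq_bigr => i _; rewrite mxE; ring.
have genL := line_generator (is_line_base_change f lL) Lx x0.
have genM := line_generator (is_line_base_change f lM) My y1.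
exists x, y, (\sum_i c i * (X1 i 0 0 * (Y1 i 0 1 * (Y2 i 0 1 * (X2 i 0 0 * X3 i 0 0))))).
split=> //; rewrite -[RHS]e1 mulr_sumr; apply: eq_bigr => i _.
have [[h1 h2 h3 h4 h5] _] := gP i.
have E2 : X2 i 0 2 = X2 i 0 0 * x 0 2 by have /(congr1 (fun v : 'rV_4 => v 0 2)) := genL _ (map_base_change f h3); rewrite [X in _ = X -> _]mxE; apply.
have E3 : X3 i 0 2 = X3 i 0 0 * x 0 2 by have /(congr1 (fun v : 'rV_4 => v 0 2)) := genL _ (map_base_change f h4); rewrite [X in _ = X -> _]mxE; apply.
have E5 : Y2 i 0 3 = Y2 i 0 1 * y 0 3 by have /(congr1 (fun v : 'rV_4 => v 0 3)) := genM _ (map_base_change f h5); rewrite [X in _ = X -> _]mxE; apply.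
by rewrite /q E2 E3 E5; ring.
Qed.

(** * The chart is affine and smooth *)

Definition chart_x (B : pzRingType) (b : 'I_3 -> B) : 'rV[B]_4 :=
  \row_j [:: 1; b 0; b 1; b 2]`_j.

(** With [c] in the role of [t = y_3 + x_2 ^ 2] and [d] in that of its inverse, [y_2] is the
    solution of the equation of the fibre and [y_0 = y_2 y_3]. *)
Definition chart_y (B : pzRingType) (b : 'I_3 -> B) (c d : B) : 'rV[B]_4 :=
  let y3 := c - b 1 ^+ 2 in
  let y2 := - (b 0 ^+ 2 + y3 * b 2 ^+ 2) * d in
  \row_j [:: y2 * y3; 1; y2; y3]`_j.

Lemma chart_x0 (B : pzRingType) (b : 'I_3 -> B) : chart_x b 0 0 = 1.
Proof. by rewrite mxE. Qed.

Lemma chart_y1 (B : pzRingType) (b : 'I_3 -> B) c d : chart_y b c d 0 1 = 1.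
Proof. by rewrite mxE. Qed.

Lemma map_chart_x (A B : pzRingType) (f : {rmorphism A -> B}) (b : 'I_3 -> A) :
  map_mx f (chart_x b) = chart_x (f \o b).
Proof.
apply/rowP => j; rewrite !mxE.
by case: j => -[|[|[|[|]]]] //= _; rewrite rmorph1.
Qed.

Lemma map_chart_y (A B : pzRingType) (f : {rmorphism A -> B}) (b : 'I_3 -> A) c d :
  map_mx f (chart_y b c d) = chart_y (f \o b) (f c) (f d).
Proof.
apply/rowP => j; rewrite !mxE.
by case: j => -[|[|[|[|]]]] //= _;
  rewrite ?(rmorph1, rmorphM, rmorphN, rmorphD, rmorphB, rmorphXn).
Qed.

Lemma chart_on_X (B : qalg) (b : 'I_3 -> B) (c d : B) : c * d = 1 ->
  on_X (span1 (chart_x b)) (span1 (chart_y b c d)).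
Proof.
move=> cd; split=> [_ _ [k _ <-] [l _ <-]|_ [l _ <-]]; rewrite !mxE /=; last by ring.
set y3 := c - _; pose e := b 0 ^+ 2 + y3 * b 2 ^+ 2.
have h : - e * d * (y3 + b 1 ^+ 2) + e = 0.
  have -> : y3 + b 1 ^+ 2 = c by rewrite /y3 subrK.
  have -> : - e * d * c + e = e - e * (c * d) by ring.
  by rewrite cd mulr1 subrr.
transitivity (l * k ^+ 2 * (- e * d * (y3 + b 1 ^+ 2) + e)); last by rewrite h mulr0.
by rewrite /e; ring.
Qed.

Lemma chart_point (B : qalg) (b : 'I_3 -> B) (c d : B) : c * d = 1 ->
  exists z : X B, sval (sval z).1 = span1 (chart_x b) /\
                  sval (sval z).2 = span1 (chart_y b c d).
Proof.
move=> cd.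
pose L : P3 B := exist _ _ (span1_line (chart_x0 b)).
pose M : P3 B := exist _ _ (span1_line (chart_y1 b c d)).
by exists (exist _ (L, M) (chart_on_X b cd)).
Qed.

Lemma chart_param (B : qalg) (z : X B) : chart B z ->
  exists (b : 'I_3 -> B) (c d : B), [/\ c * d = 1,
    sval (sval z).1 = span1 (chart_x b) & sval (sval z).2 = span1 (chart_y b c d)].
Proof.
move=> [x [y [w [Lx My x0 y1 q]]]].
have lL : is_line (sval (sval z).1) by exact: svalP.
have lM : is_line (sval (sval z).2) by exact: svalP.
exists (fun i => x 0 (lift 0 i)), (y 0 3 + x 0 2 ^+ 2), w; split=> //.
  rewrite (line_span1 lL Lx x0); congr span1; apply/rowP => j; rewrite mxE.
  have xj (k l : 'I_4) : k = l :> nat -> x 0 k = x 0 l by move=> /val_inj ->.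
  by case: j => -[|[|[|[|]]]] //= i; rewrite -1?x0; apply: xj.
rewrite (line_span1 lM My y1); congr span1; apply/rowP => j; rewrite mxE.
have [onX onY] := svalP z.
have e1 := onY _ My; have e2 := onX _ _ Lx My.
rewrite x0 y1 in e1 e2.
have x1 : x 0 (lift 0 0) = x 0 1 by congr (x 0 _); apply: val_inj.
have x2 : x 0 (lift 0 1) = x 0 2 by congr (x 0 _); apply: val_inj.
have x3 : x 0 (lift 0 2) = x 0 3 by congr (x 0 _); apply: val_inj.
rewrite x1 x2 x3 addrK.
have y2 : y 0 2 = - (x 0 1 ^+ 2 + y 0 3 * x 0 3 ^+ 2) * w.
  have e3 : y 0 2 * (y 0 3 + x 0 2 ^+ 2) = - (x 0 1 ^+ 2 + y 0 3 * x 0 3 ^+ 2).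
    apply/eqP; rewrite -subr_eq0 -[X in _ == X]e2 -subr_eq0.
    by rewrite -[y 0 0]mulr1 e1; apply/eqP; ring.
  by rewrite -e3 -mulrA q mulr1.
have yj (k l : 'I_4) : k = l :> nat -> y 0 k = y 0 l by move=> /val_inj ->.
case: j => -[|[|[|[|]]]] //= i.
- by rewrite -y2 -e1 mulr1; apply: yj.
- by rewrite -y1; apply: yj.
- by rewrite -y2; apply: yj.
- exact: yj.
Qed.

Lemma span1_inj (B : comPzRingType) n (x y : 'rV[B]_n) i : x 0 i = 1 -> y 0 i = 1 ->
  span1 x = span1 y -> x = y.
Proof.
move=> xi yi e; have : span1 y x by rewrite -e; exists 1; rewrite ?scale1r.
by case=> c _ h; move: xi; rewrite -h mxE yi mulr1 => ->; rewrite scale1r.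
Qed.

(** An inverse modulo an ideal of square zero is corrected by one Newton step. *)
Lemma square_zero_unit (B C : comPzRingType) (q : {rmorphism B -> C}) (t s : B) :
  (forall a b, q a = 0 -> q b = 0 -> a * b = 0) -> q t * q s = 1 ->
  exists s', t * s' = 1 /\ q s' = q s.
Proof.
move=> q2 ts; pose n := t * s - 1.
have qn : q n = 0 by rewrite rmorphB rmorphM rmorph1 ts subrr.
have nn : n * n = 0 by exact: q2.
exists (s * (1 - n)); split.
  by transitivity (1 - n * n); [rewrite /n; ring|rewrite nn subr0].
by rewrite rmorphM rmorphB qn rmorph1 subr0 mulr1.
Qed.

(** A morphism from the coordinate ring is the choice of three elements and a unit, and
    units lift along an extension by an ideal of square zero. *)
Lemma chart_smooth : exists (A : qalg) (u : X A), affine_open chart u /\ smooth_algebra A.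
Proof.
have [A [x [t [s [ts gen free]]]]] := coordinate_algebra.
have uniq (C : pzRingType) (f g : {rmorphism A -> C}) : (forall i, f (x i) = g (x i)) ->
    f t = g t -> f s = g s -> f =1 g.
  move=> hx ht hs; apply: (generates_eq gen) => i.
  by case: i => -[|[|[|[|[|]]]]] //= _.
have [u [uL uM]] := chart_point x ts.
exists A, u; split; last first.
  split; first by exists 5%N, (fun i : 'I_5 => [:: x 0; x 1; x 2; t; s]`_i).
  move=> B C q qs q2 g.
  have /choice[b bE] : forall i, exists b, q b = g (x i) by move=> i; exact: qs.
  have [c cE] := qs (g t); have [d dE] := qs (g s).
  have [|d' [cd' d'E]] := @square_zero_unit _ _ q c d q2.
    by rewrite cE dE -rmorphM ts rmorph1.
  have [g' [g'x g't g's]] := free B b c d' cd'.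
  exists g'; apply: (uniq _ g (q \o g' : {rmorphism A -> C})) => [i||] /=.
  - by rewrite g'x bE.
  - by rewrite g't cE.
  - by rewrite g's d'E dE.
split; first exact: chart_open.
have uchart : chart A u.
  exists (chart_x x), (chart_y x t s), s; rewrite uL uM.
  by split; rewrite ?chart_x0 ?chart_y1 ?mxE //=;
   [exists 1; rewrite ?scale1r|exists 1; rewrite ?scale1r|rewrite subrK].
have pu (B : qalg) (f : {rmorphism A -> B}) :
    sval (sval (Defs.pmap f u)).1 = span1 (chart_x (f \o x)) /\
    sval (sval (Defs.pmap f u)).2 = span1 (chart_y (f \o x) (f t) (f s)).
  split=> /=.
    by rewrite uL (span1_base_change _ (chart_x0 x)) map_chart_x.
  by rewrite uM (span1_base_change _ (chart_y1 x t s)) map_chart_y.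
split=> // B z /chart_param[b [c [d [cd zL zM]]]].
have [f [fx ft fs]] := free B b c d cd.
have fxb : f \o x = b by apply/funext => i; exact: fx.
exists f; split.
  have [h1 h2] := pu B f; apply: X_point_eq.
    by rewrite h1 zL fxb.
  by rewrite h2 zM fxb ft fs.
move=> g gz; have [h1 h2] := pu B g.
rewrite gz zL in h1; rewrite gz zM in h2.
have ex := span1_inj (chart_x0 _) (chart_x0 _) h1.
have ey := span1_inj (chart_y1 _ _ _) (chart_y1 _ _ _) h2.
have gb i : g (x i) = b i.
  have bj (j k : 'I_3) : j = k :> nat -> b j = g (x k) -> b k = g (x k) by move=> /val_inj ->.
  have /rowP/(_ 1) := ex; have /rowP/(_ 2) := ex; have /rowP/(_ 3) := ex.
  rewrite !mxE /= => e3 e2 e1.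
  have xk (j k : 'I_3) : j = k :> nat -> g (x j) = b j -> g (x k) = b k by move=> /val_inj ->.
  case: i => -[|[|[|]]] //= i3; [apply: (xk 0)|apply: (xk 1)|apply: (xk 2)] => //; exact: esym.
have gt : g t = c.
  have /rowP/(_ 3) := ey; rewrite !mxE /= gb => /(congr1 (fun v => v + b 1 ^+ 2)).
  by rewrite !subrK.
have gs : g s = d.
  have gts : c * g s = 1 by rewrite -gt -rmorphM ts rmorph1.
  by rewrite -[LHS]mulr1 -cd mulrA [_ * c]mulrC gts mul1r.
by apply: uniq => [i||]; rewrite ?gb ?fx ?gt ?ft ?gs ?fs.
Qed.

Lemma chart_sub_smooth_locus (B : qalg) (z : X B) : chart B z -> smooth_locus X B z.
Proof.
move=> cz K f _; have [A [u [oU sA]]] := chart_smooth.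
by exists chart, A, u; split=> //; apply: mem_sub_map.
Qed.

(** * Primitive representatives of rational points *)

(** A line in the sense of [is_line] has rank [1] over the residue field of a nonzero ring. *)
Lemma line_neq0 (A : comPzRingType) n (L : set 'rV[A]_n) : (1 : A) != 0 ->
  is_line L -> exists2 x, L x & x != 0.
Proof.
move=> n10 [e [ee -> rk]].
have [|K [f _]] := @residue_field A 0.
  by move=> b; rewrite mulr0 => /esym/eqP; apply/negP.
have e0 : e != 0.
  by apply/eqP => e0; have := rk K f; rewrite e0 map_mx0 mxrank0.
have [r er] : exists r, row r e != 0.
  apply: contrapT => h; case/eqP: e0; apply/row_matrixP => r; rewrite row0.
  by apply/eqP; apply: contrapT => hr; apply: h; exists r; apply/negP.
by exists (row r e) => //; exists (delta_mx 0 r) => //; rewrite -rowE.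
Qed.

Definition primitive (v : 'rV[int]_4) := \big[gcdn/0%N]_(i < 4) `|v 0%R i|%N = 1%N.

Definition rat_line (v : 'rV[int]_4) : set 'rV[rat]_4 :=
  [set c *: map_mx intr v | c in [set: rat]].

(** A generator with a coordinate equal to [1] is multiplied by the denominators of its
    coordinates, and the result divided by the gcd of its coordinates. *)
Lemma primitive_generator (L : set 'rV[rat]_4) : is_line L ->
  exists v, primitive v /\ L = rat_line v.
Proof.
move=> lL; have [x0 Lx0 x0n] := line_neq0 (oner_neq0 _) lL.
have [i xi] : exists i, x0 0 i != 0.
  apply: contrapT => h; case/eqP: x0n; apply/rowP => i; rewrite mxE.
  by apply/eqP; apply: contrapT => hr; apply: h; exists i; apply/negP.
pose x := (x0 0 i)^-1 *: x0.
have xi1 : x 0 i = 1 by rewrite mxE mulVf.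
have Lx : L x.
  by case: lL Lx0 => e [_ -> _] [u _ ux]; exists ((x0 0 i)^-1 *: u); rewrite -?scalemxAl ?ux.
pose D : int := \prod_j denq (x 0 j).
have D0 : D != 0 by apply/prodf_neq0 => j _; exact: denq_neq0.
pose w j : int := numq (x 0 j) * \prod_(k | k != j) denq (x 0 k).
have wE j : (w j)%:~R = D%:~R * x 0 j.
  by rewrite /w /D [in RHS](bigD1 j) //= !rmorphM /= numqE; ring.
pose g := \big[gcdn/0%N]_(j < 4) `|w j|%N.
have gw j : (g %| `|w j|)%N by rewrite /g (bigD1 j) //= dvdn_gcdl.
have g0 : (0 < g)%N.
  rewrite lt0n; apply/eqP => g0; have := gw i; rewrite g0 dvd0n absz_eq0 => /eqP wi.
  by have := wE i; rewrite wi xi1 mulr1 => /esym/eqP; rewrite intr_eq0 (negPf D0).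
pose v : 'rV[int]_4 := \row_j (w j %/ g)%Z.
have vE j : w j = v 0 j * g by rewrite mxE divzK //; exact: gw.
exists v; split.
  have : (\big[gcdn/0%N]_(j < 4) `|v 0%R j|%N * g = g)%N.
    rewrite (@big_morph _ _ (muln^~ g) 0%N gcdn 0%N gcdn) //; last first.
      by move=> a b; rewrite muln_gcdl.
    by apply: eq_bigr => j _; rewrite vE abszM.
  by rewrite -[X in _ = X -> _]mul1n => /eqP; rewrite eqn_pmul2r // => /eqP.
have gr : g%:~R != 0 :> rat by rewrite intr_eq0 -lt0n.
have Dr : D%:~R != 0 :> rat by rewrite intr_eq0.
have xv : x = (g%:~R / D%:~R) *: map_mx intr v.
  apply/rowP => j; rewrite [RHS]mxE [map_mx _ _ _ _]mxE.
  have := wE j; rewrite vE rmorphM /= => h; apply: (mulfI Dr).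
  by rewrite -h; field.
rewrite (line_span1 lL Lx xi1); apply/seteqP; split=> _ [c _ <-].
  by exists (c * (g%:~R / D%:~R)) => //; rewrite -scalerA -xv.
exists (c * (D%:~R / g%:~R)) => //; rewrite xv scalerA; congr (_ *: _).
by field; apply/andP.
Qed.

(** The denominator of the ratio divides all the coordinates of a primitive vector. *)
Lemma rat_line_dvd v w (c : rat) : primitive w ->
  map_mx intr v = c *: map_mx intr w :> 'rV[rat]_4 -> exists m : int, v = m *: w.
Proof.
move=> pw e; have ei i : v 0 i * denq c = numq c * w 0 i.
  have /rowP/(_ i) := e; rewrite !mxE => h; apply: (@intr_inj rat).
  by rewrite !rmorphM /= h numqE; ring.
have : (`|denq c| %| \big[gcdn/0%N]_(i < 4) `|w 0%R i|)%N.
  apply/dvdn_biggcdP => i _; have := congr1 absz (ei i); rewrite !abszM => h.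
  have : (`|denq c| %| `|numq c| * `|w 0%R i|)%N by rewrite -h dvdn_mull.
  by rewrite Gauss_dvdr // coprime_sym coprime_num_den.
rewrite pw dvdn1 => /eqP d1; have {}d1 : denq c = 1 by have := denq_gt0 c; lia.
by exists (numq c); apply/rowP => i; have := ei i; rewrite d1 mulr1 mxE.
Qed.

Lemma primitive_abs_unique v w : primitive v -> primitive w ->
  rat_line v = rat_line w -> forall i, `|v 0%R i|%N = `|w 0%R i|%N.
Proof.
move=> pv pw e i.
have mem x : rat_line x (map_mx intr x) by exists 1; rewrite ?scale1r.
have [m vm] : exists m : int, v = m *: w.
  by have := mem v; rewrite e => -[c _ /esym]; exact: rat_line_dvd.
have [n wn] : exists n : int, w = n *: v.
  by have := mem w; rewrite -e => -[c _ /esym]; exact: rat_line_dvd.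
have dv (x y : 'rV[int]_4) (k : int) : x = k *: y -> (`|y 0%R i| %| `|x 0%R i|)%N.
  by move=> ->; rewrite mxE abszM dvdn_mull.
by apply/eqP; rewrite eqn_dvd (dv w v n) // (dv v w m).
Qed.

Definition rep (y : Y Qalg) : 'rV[int]_4 := xget 0%R (primitive_repr y).

Lemma rep_primitive y : primitive (rep y) /\ sval (sval y) = rat_line (rep y).
Proof.
suff : primitive_repr y (rep y) by [].
by apply: xgetPex; have [v] := primitive_generator (svalP (sval y)); exists v.
Qed.

Lemma height_eq y : height y = ((\max_(i < 4) `|rep y 0%R i|%N) ^ 2)%N.
Proof. by []. Qed.

Lemma Y_point_eq (B : qalg) (y y' : Y B) : sval (sval y) = sval (sval y') -> y = y'.
Proof.
case: y y' => [[L lL] h] [[L' lL'] h'] /= e.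
by apply: eq_exist; apply: eq_exist.
Qed.

Lemma rep_inj : injective rep.
Proof.
by move=> y y' e; apply: Y_point_eq; rewrite !(proj2 (rep_primitive _)) e.
Qed.

Lemma rep_abs y v : primitive v -> sval (sval y) = rat_line v ->
  forall i, `|rep y 0%R i|%N = `|v 0%R i|%N.
Proof.
move=> pv yv; have [p1 p2] := rep_primitive y.
by apply: primitive_abs_unique => //; rewrite -p2 yv.
Qed.

Lemma rep_on_Y y : rep y 0 0 * rep y 0 1 = rep y 0 2 * rep y 0 3.
Proof.
have [_ e] := rep_primitive y; have := svalP y; rewrite /on_Y /= => h.
have : map_mx intr (rep y) 0 0 * map_mx intr (rep y) 0 1 =
       map_mx intr (rep y) 0 2 * map_mx intr (rep y) 0 3 :> rat.
  by apply: h; rewrite e; exists 1; rewrite ?scale1r.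
by rewrite !mxE -!rmorphM => /intr_inj.
Qed.

(** * Rational points on the lines *)

Definition axis_vector (c d : nat) : 'rV[int]_4 :=
  \row_j [:: 0; d%:Z; 0; c%:Z]`_j.

(** The pair of planes [d x_1 ^ 2 + c x_3 ^ 2 = 0] over [y = (0, d, 0, c)] contains
    [x = (1, 0, 0, 0)], which lies on the chart, where [t] takes the value [c / d]. *)
Lemma axis_point c d : (0 < c)%N -> (0 < d)%N ->
  exists z : X Qalg, smooth_locus X Qalg z /\
    sval (sval z).2 = rat_line (axis_vector c d).
Proof.
move=> c0 d0; have cr : c%:R != 0 :> rat by rewrite pnatr_eq0 -lt0n.
have dr : d%:R != 0 :> rat by rewrite pnatr_eq0 -lt0n.
have e : (c%:R / d%:R : Qalg) * (d%:R / c%:R) = 1 by rewrite mulrA divfK // divff.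
have [z [zL zM]] := chart_point (fun=> 0) e.
exists z; split.
  apply: chart_sub_smooth_locus.
  exists (chart_x (fun=> 0)), (chart_y (fun=> 0) (c%:R / d%:R) (d%:R / c%:R)), (d%:R / c%:R).
  rewrite zL zM; split; rewrite ?chart_x0 ?chart_y1 //.
  - by exists 1; rewrite ?scale1r.
  - by exists 1; rewrite ?scale1r.
  - by rewrite !mxE /= subrK e.
have ey : chart_y (fun=> 0) (c%:R / d%:R : Qalg) (d%:R / c%:R) =
    d%:R^-1 *: map_mx intr (axis_vector c d).
  apply/rowP => j; rewrite !mxE.
  case: j => -[|[|[|[|]]]] //= _.
  - by rewrite expr0n /= mulr0 addr0 oppr0 !mul0r mulr0.
  - by rewrite mulVf.
  - by rewrite expr0n /= mulr0 addr0 oppr0 !mul0r mulr0.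
  - by rewrite expr0n /= subr0 mulrC.
rewrite zM ey; apply/seteqP; split=> _ [k _ <-].
  by exists (k * d%:R^-1) => //; rewrite scalerA.
by exists (k * d%:R) => //; rewrite scalerA mulfK.
Qed.

(** The desingularisation is an isomorphism over the smooth locus, so that the point
    lifts to a rational one. *)
Lemma smooth_point_soluble (R : realType) (X' : qfunctor) (rho : qmor X' X) (z : X Qalg) :
  desingularisation rho -> smooth_locus X Qalg z ->
  everywhere_locally_soluble R (mor_comp pi_XY rho) (pi_XY Qalg z).
Proof.
move=> [_ _ _ _ [_ iso]] sz v.
have [x' [[_ x'z] _]] := iso _ _ sz.
exists (Defs.pmap (structure_map (completion R v)) x').
by rewrite mor_nat /= x'z.
Qed.

Lemma axis_primitive c d : coprime c d -> primitive (axis_vector c d).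
Proof.
rewrite /primitive !big_ord_recl big_ord0 !mxE /= !gcd0n gcdn0.
by rewrite gcdnC => /eqP.
Qed.

Lemma sum_inverse_squares (F : realFieldType) T : (2 <= T)%N ->
  \sum_(2 <= k < T.+1) (k%:R ^+ 2)^-1 <= 3 / 4 - T%:R^-1 :> F.
Proof.
move=> /subnKC <-; elim: (T - 2)%N => [|n]; first by rewrite addn0 big_nat1; lra.
rewrite addnS; move: (2 + n)%N (leq_addr n 2) => {}T T2 IH.
rewrite big_nat_recr /=; last exact: leqW.
have t0 : 0 < T%:R :> F by rewrite ltr0n; lia.
move: IH; set s := \sum_(_ <= _ < _) _; rewrite -[T.+1%:R]natr1; move: (T%:R) t0 => t t0 h.
have e : t^-1 - (t + 1)^-1 - ((t + 1) ^+ 2)^-1 = (t * (t + 1) ^+ 2)^-1.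
  by field; rewrite !gt_eqF //; lra.
have : 0 <= (t * (t + 1) ^+ 2)^-1 by rewrite invr_ge0 mulr_ge0 ?exprn_ge0 //; lra.
by rewrite -e; lra.
Qed.

(** A pair that is not coprime has a common divisor [k >= 2], and the sum of the
    [1 / k ^ 2] for [k >= 2] is less than [3 / 4]. *)
Lemma sum_coprime_pairs T :
  (T ^ 2 <= 4 * \sum_(1 <= c < T.+1) \sum_(1 <= d < T.+1) coprime c d)%N.
Proof.
have [T2|] := leqP 2 T; last first.
  by case: T => [|[|]] // _; rewrite !big_nat1.
set S := (\sum_(_ <= _ < _) _)%N.
have tot : (T ^ 2 <= S + \sum_(2 <= k < T.+1) (T %/ k) ^ 2)%N.
  have e1 : (T ^ 2 = \sum_(1 <= c < T.+1) \sum_(1 <= d < T.+1) 1)%N.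
    by rewrite !sum_nat_const_nat subn1 muln1 mulnn.
  have e2 : (\sum_(2 <= k < T.+1) (T %/ k) ^ 2 =
     \sum_(1 <= c < T.+1) \sum_(1 <= d < T.+1) \sum_(2 <= k < T.+1) (k %| c) * (k %| d))%N.
    transitivity (\sum_(1 <= c < T.+1) \sum_(2 <= k < T.+1) \sum_(1 <= d < T.+1) (k %| c) * (k %| d))%N.
      rewrite exchange_big; apply: eq_bigr => k _.
      rewrite -mulnn {1}divn_count_dvd big_distrl; apply: eq_bigr => c _ /=.
      by rewrite divn_count_dvd big_distrr.
    by apply: eq_bigr => c _; rewrite exchange_big.
  rewrite e1 e2 /S -big_split big_nat_cond [X in (_ <= X)%N]big_nat_cond.
  apply: leq_sum => c /andP[/andP[c0 cT] _] /=.
  rewrite -big_split big_nat_cond [X in (_ <= X)%N]big_nat_cond.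
  apply: leq_sum => d /andP[/andP[d0 dT] _] /=.
  have [//|cd] := boolP (coprime c d); rewrite add0n.
  have g0 : (0 < gcdn c d)%N by rewrite gcdn_gt0 c0.
  have g2 : (1 < gcdn c d)%N by rewrite ltn_neqAle eq_sym cd.
  have gT : (gcdn c d < T.+1)%N by rewrite (leq_ltn_trans _ cT) // dvdn_leq // dvdn_gcdl.
  rewrite (bigD1_seq (gcdn c d)) ?iota_uniq ?mem_index_iota ?g2 //=.
  by rewrite dvdn_gcdl dvdn_gcdr.
have bound : (4 * \sum_(2 <= k < T.+1) (T %/ k) ^ 2 <= 3 * T ^ 2)%N.
  rewrite -(ler_nat rat) (natrM _ 4) (natrM _ 3) natr_sum.
  have t0 : 0 < T%:R :> rat by rewrite ltr0n; lia.
  have : \sum_(2 <= k < T.+1) ((T %/ k) ^ 2)%:R <= T%:R ^+ 2 * \sum_(2 <= k < T.+1) (k%:R ^+ 2)^-1 :> rat.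
    rewrite mulr_sumr; apply: ler_sum_nat => k /andP[k2 _].
    have k0 : 0 < k%:R :> rat by rewrite ltr0n; lia.
    rewrite natrX ler_pdivlMr ?exprn_gt0 // -exprMn lerXn2r ?nnegrE ?mulr_ge0 //.
    by rewrite -natrM ler_nat leq_divM.
  have h := sum_inverse_squares rat T2.
  have i0 : 0 < T%:R^-1 :> rat by rewrite invr_gt0.
  have q0 : 0 <= T%:R ^+ 2 :> rat by rewrite exprn_ge0.
  rewrite natrX; move: (\sum_(_ <= _ < _) _) (\sum_(_ <= _ < _) _) h => s1 s2 h.
  have := ler_wpM2l q0 h; nra.
lia.
Qed.

(** A finite set of codes bounds the cardinal of a set when each code determines its
    element. It also shows that the set is finite, without which [fset_set] would be empty. *)
Lemma fset_set_card_le (T : choiceType) (S : set T) (W : finType) (P : pred W)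
    (r : T -> W -> Prop) :
  (forall y, S y -> exists2 w, P w & r y w) ->
  (forall y y' w, r y w -> r y' w -> y = y') ->
  finite_set S /\ (#|` fset_set S| <= #|P|)%N.
Proof.
move=> hS hr.
have [[y0 Sy0]|S0] := pselect (exists y, S y); last first.
  have -> : S = set0 by apply/seteqP; split=> y // Sy; case: S0; exists y.
  by rewrite fset_set0 cardfs0; split.
have [w0 _ _] := hS _ Sy0.
have /choice[code codeP] : forall y, exists w, S y -> P w /\ r y w.
  move=> y; have [Sy|nS] := pselect (S y); last by exists w0.
  by have [w Pw rw] := hS y Sy; exists w.
have inj y y' : S y -> S y' -> code y = code y' -> y = y'.
  move=> Sy Sy' e; apply: (hr _ _ (code y)).
    by case: (codeP y Sy).
  by rewrite e; case: (codeP y' Sy').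
have fin : finite_set S.
  apply: (@sub_finite_set _ _ ((fun w => xget y0 [set y | S y /\ code y = w]) @` [set: W])).
    move=> y Sy; exists (code y) => //.
    by case: xgetP => [z _ [Sz ez]|/(_ y)]; [exact: inj|case].
  by apply: finite_image; exact: finite_finset.
split=> //; rewrite -(size_map code) cardE; apply: uniq_leq_size.
  rewrite map_inj_in_uniq ?fset_uniq // => y y'.
  by rewrite !in_fset_set // => /set_mem Sy /set_mem Sy'; exact: inj.
move=> w /mapP[y]; rewrite in_fset_set // => /set_mem Sy ->.
by rewrite mem_enum; case: (codeP y Sy).
Qed.

Lemma fset_set_card_ge (T : choiceType) (S : set T) (W : finType) (P : pred W)
    (r : W -> T -> Prop) : finite_set S ->
  (forall w, P w -> exists2 y, S y & r w y) ->
  (forall w w' y, r w y -> r w' y -> w = w') ->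
  (#|P| <= #|` fset_set S|)%N.
Proof.
move=> fin hP hr.
have [->//|] := posnP #|P|; rewrite lt0n => /pred0Pn[w0 Pw0].
have [y0 _ _] := hP _ Pw0.
have /choice[pt ptP] : forall w, exists y, P w -> S y /\ r w y.
  move=> w; have [Pw|nP] := boolP (P w); last by exists y0.
  by have [y Sy ry] := hP w Pw; exists y.
rewrite cardE -(size_map pt); apply: uniq_leq_size.
  rewrite map_inj_in_uniq ?enum_uniq // => w w'; rewrite !mem_enum => Pw Pw' e.
  by apply: (hr _ _ (pt w)); [case: (ptP w Pw)|rewrite e; case: (ptP w' Pw')].
move=> y /mapP[w]; rewrite mem_enum => Pw ->.
by rewrite in_fset_set //; apply/mem_set; case: (ptP w Pw).
Qed.

(** * Local points of the fibres *)

Definition diag_form (R : pzRingType) (v x : 'I_4 -> R) : R :=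
  v 0 * x 0 ^+ 2 + v 1 * x 1 ^+ 2 + v 2 * x 2 ^+ 2 + v 3 * x 3 ^+ 2.

Section Padic.
Variables (p : nat) (pp : prime p).
Local Notation "|[ x ]|" := (padic_abs p x).

Lemma padic_abs_gt0 x : x != 0 -> 0 < |[x]|.
Proof.
by move=> x0; rewrite /padic_abs (negPf x0) exprz_gt0 // ltr0n prime_gt0.
Qed.

(** The absolute value is a power of [p], so that it is at most [p ^ (- k - 1)]. *)
Lemma padic_abs_dvd (m : int) k : |[m%:~R]| < p%:R ^- k -> (p ^ k.+1 %| `|m|)%N.
Proof.
have [->|m0] := eqVneq m 0; first by rewrite dvdn0.
rewrite /padic_abs intr_eq0 (negPf m0) denq_int numq_int /= logn1 sub0r.
have p1 : 1 < p%:R :> rat by rewrite ltr1n prime_gt1.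
rewrite exprnN ltr_eXz2l // ltrN2 ltz_nat => kl.
by rewrite pfactor_dvdn // absz_gt0.
Qed.

Lemma padic_abs_le1_denq x : |[x]| <= 1 -> ~~ (p %| `|denq x|)%N.
Proof.
have [->|x0] := eqVneq x 0; first by rewrite -[0]/(0%:~R) denq_int dvdn1 => _; apply: contraTneq pp => ->.
rewrite /padic_abs (negPf x0) => le; apply/negP => pd.
have pn : ~~ (p %| `|numq x|)%N.
  apply/negP => pn; have := coprime_num_den x; rewrite /coprime => /eqP g.
  have : (p %| gcdn `|numq x| `|denq x|)%N by rewrite dvdn_gcd pn.
  by rewrite g dvdn1 => /eqP e; move: pp; rewrite e.
have n0 : logn p `|numq x| = 0%N by apply/eqP; rewrite -leqn0 leqNgt logn_gt0 mem_primes (negPf pn) !andbF.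
have d0 : (0 < logn p `|denq x|)%N by rewrite logn_gt0 mem_primes pp absz_gt0 denq_neq0.
move: le; rewrite n0 subr0 -exprnP leNgt => /negP; apply.
by rewrite exprn_egt1 -?lt0n // ltr1n prime_gt1.
Qed.

(** Dividing by the largest coordinate makes all the coordinates [p]-integral and one of
    them equal to [1]; the denominators are then prime to [p]. *)
Lemma rescale_zero (v : 'I_4 -> int) (w : 'I_4 -> rat) (e : rat) i : 0 < e ->
  e <= |[w i]| ->
  |[diag_form (fun j => (v j)%:~R) w]| < e ^+ 2 * p%:R ^- 1 ->
  exists x : 'I_4 -> int, (exists j, ~~ (p %| `|x j|)%N) /\
    (p ^ 2 %| `|diag_form v x|)%N.
Proof.
move=> e0 ei Fw.
have [m _ mmax] := @arg_maxP _ rat 'I_4 i xpredT (fun j => |[w j]|) isT.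
have em : e <= |[w m]| by apply: le_trans ei _; exact: mmax.
have m0 : w m != 0.
  by apply: contraTneq em => ->; rewrite padic_abs0 -ltNge.
have am := padic_abs_gt0 m0.
pose w' j := w j / w m.
have w'1 j : |[w' j]| <= 1.
  have : |[w' j]| * |[w m]| <= 1 * |[w m]|.
    by rewrite -padic_absM divfK // mul1r; exact: mmax.
  by rewrite ler_pM2r.
have Fw' : |[diag_form (fun j => (v j)%:~R) w']| < p%:R ^- 1.
  have h : |[diag_form (fun j => (v j)%:~R) w']| * |[w m]| ^+ 2
    = |[diag_form (fun j => (v j)%:~R) w]|.
    rewrite expr2 -!padic_absM; congr padic_abs.
    by rewrite /diag_form /w'; field.
  rewrite -(ltr_pM2r (exprn_gt0 2 am)) h; apply: lt_le_trans Fw _.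
  rewrite mulrC ler_wpM2l ?invr_ge0 ?exprn_ge0 // lerXn2r ?nnegrE //; exact: ltW.
pose D : int := \prod_j denq (w' j).
have [x xE] : exists x : 'I_4 -> int, forall j, (x j)%:~R = D%:~R * w' j.
  exists (fun j => numq (w' j) * \prod_(k | k != j) denq (w' k)) => j.
  by rewrite /D [in RHS](bigD1 j) //= !rmorphM /= numqE; ring.
exists x; split.
  exists m; have -> : x m = D.
    apply: (@intr_inj rat); rewrite xE /w' divff // mulr1 //.
  apply: (big_ind (fun z : int => ~~ (p %| `|z|)%N)).
  - by rewrite dvdn1; apply: contraTneq pp => ->.
  - by move=> y z hy hz; rewrite abszM Euclid_dvdM // negb_or hy.
  - by move=> j _; apply: padic_abs_le1_denq.
apply: padic_abs_dvd.
have -> : (diag_form v x)%:~R = D%:~R ^+ 2 * diag_form (fun j => (v j)%:~R) w' :> rat.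
  by rewrite /diag_form !(rmorphD, rmorphM) /= !xE; ring.
apply: le_lt_trans Fw'; rewrite padic_absM ler_piMl ?padic_abs_ge0 //.
by rewrite -rmorphXn; apply: padic_abs_int.
Qed.

Lemma not_null_often (u : nat -> rat) : ~ padic_null p u ->
  exists2 e : rat, 0 < e & forall N, exists2 n, (N <= n)%N & e <= |[u n]|.
Proof.
move=> nu; apply: contrapT => h; apply: nu => e e0.
apply: contrapT => h2; apply: h; exists e => // N.
apply: contrapT => h3; apply: h2; exists N => n Nn.
by rewrite ltNge; apply/negP => le; apply: h3; exists n.
Qed.

(** The coordinates are represented by Cauchy sequences, of which one is not null while
    the sequence of values of the form is null. A single index far enough gives a rational
    vector. *)
Lemma Qp_zero_dvd (v : 'I_4 -> int) (x : 'I_4 -> Qp p) i : x i != 0 ->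
  diag_form (fun j => rat_Qp p (v j)%:~R) x = 0 ->
  exists x : 'I_4 -> int, (exists j, ~~ (p %| `|x j|)%N) /\
    (p ^ 2 %| `|diag_form v x|)%N.
Proof.
move=> xi Fx; pose u j : cauchy_seq p := repr (x j).
have ux j : (\pi_(Qp p) (u j))%qT = x j by exact: reprK.
have nu : ~ padic_null p (cauchy_val (u i)).
  move=> nu; case/negP: xi; rewrite -ux -(rmorph0 (\pi_(Qp p))%qT).
  rewrite -[_ == _](Quotient.idealrBE (@null_seq p)) subr0.
  by apply/asboolP.
have Fu : padic_null p (fun n => diag_form (fun j => (v j)%:~R) (fun j => cauchy_val (u j) n)).
  have : diag_form (fun j => rat_cauchy p (v j)%:~R) u \in @null_seq p.
    rewrite -[diag_form _ _]subr0 (Quotient.idealrBE (@null_seq p)); apply/eqP.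
    rewrite rmorph0 -[RHS]Fx /diag_form -!ux.
    pose q : {rmorphism cauchy_seq p -> Qp p} := (\pi_(Qp p))%qT.
    by rewrite -[LHS]/(q _) !(rmorphD, rmorphM).
  by move=> /asboolP.
have [e e0 often] := not_null_often nu.
have e1 : 0 < e ^+ 2 * p%:R ^- 1.
  by rewrite mulr_gt0 ?exprn_gt0 // invr_gt0 exprn_gt0 // ltr0n prime_gt0.
have [N hN] := Fu _ e1; have [n Nn en] := often N.
exact: rescale_zero e0 en (hN n Nn).
Qed.
End Padic.

Lemma local_point_dvd p (pp : prime p) (z : X (padic_qalg p)) (v : 'rV[int]_4) :
  sval (sval z).2 = base_change (structure_map (padic_qalg p)) (rat_line v) ->
  exists x : 'I_4 -> int, (exists j, ~~ (p %| `|x j|)%N) /\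
    (p ^ 2 %| `|diag_form (v 0%R) x|)%N.
Proof.
move=> zv; have lL : is_line (sval (sval z).1) by exact: svalP.
have [x Lx x0] := @line_neq0 (padic_qalg p) _ _ (oner_neq0 (Qp p)) lL.
have [i xi] : exists i, x 0 i != 0.
  apply: contrapT => h; case/eqP: x0; apply/rowP => i; rewrite mxE.
  by apply/eqP; apply: contrapT => hr; apply: h; exists i; apply/negP.
have [onX _] := svalP z.
apply: (@Qp_zero_dvd p pp (v 0) (x 0) i xi).
have My : sval (sval z).2 (map_mx (structure_map (padic_qalg p)) (map_mx intr v)).
  by rewrite zv; apply: map_base_change; exists 1; rewrite ?scale1r.
by have := onX _ _ Lx My; rewrite !mxE.
Qed.

(** * The obstruction at a prime *)

Section ResidueObstruction.
Variables (p : nat) (pp : prime p).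
Local Notation "p %|z m" := (dvdz p m) (at level 70).

Lemma prime_dvdzM (a b : int) : (p %| a * b)%Z = (p %| a)%Z || (p %| b)%Z.
Proof. by rewrite !dvdzE abszM Euclid_dvdM. Qed.

(** If [p] does not divide [w], then [s = c z / w] satisfies [s ^ 2 = - c d]. *)
Lemma binary_zero_residue (c d z w : int) : ~~ (p %| c)%Z -> 
  (p %| c * z ^+ 2 + d * w ^+ 2)%Z -> ~~ ((p %| z)%Z && (p %| w)%Z) ->
  exists s : int, (p %| s ^+ 2 + c * d)%Z.
Proof.
move=> pc h nzw.
have pw : ~~ (p %| w)%Z.
  apply: contra nzw => pw; rewrite pw andbT.
  move: h; rewrite rpredDr; last by apply: dvdz_mull; rewrite expr2; apply: dvdz_mull.
  by rewrite prime_dvdzM (negPf pc) /= expr2 prime_dvdzM orbb.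
have [u [k e]] : exists u k : int, u * w + k * p = 1.
  have [u [k e]] := Bezoutz w p; exists u, k; rewrite e.
  by apply/eqP; rewrite gcdzC /gcdz /= eqz_nat -/(coprime _ _) prime_coprime // -dvdzE.
exists (c * z * u).
have -> : (c * z * u) ^+ 2 + c * d =
  c * u ^+ 2 * (c * z ^+ 2 + d * w ^+ 2) + c * d * ((k * p) * (1 + u * w)).
  by have -> : k * p = 1 - u * w; [rewrite -e; ring|ring].
apply: rpredD; first exact: dvdz_mull.
by apply: dvdz_mull; apply: dvdz_mulr; apply: dvdz_mull.
Qed.

(** If [p] does not divide both [z] and [w], the second form vanishes modulo [p] at
    [(z, w)]. Otherwise the second term is divisible by [p ^ 2], and as [p] divides [a] only
    once, the first form vanishes modulo [p] at [(x, y)]. *)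
Lemma quaternary_zero_residue (a b c d x y z w : int) :
  (p %| a)%Z -> ~~ (p ^ 2 %| `|a|)%N -> ~~ (p %| b)%Z -> ~~ (p %| c)%Z ->
  (p ^ 2 %| `|(a * (c * x ^+ 2 + d * y ^+ 2) + b * (c * z ^+ 2 + d * w ^+ 2))%R|)%N ->
  ~~ [&& (p %| x)%Z, (p %| y)%Z, (p %| z)%Z & (p %| w)%Z] ->
  exists s : int, (p %| s ^+ 2 + c * d)%Z.
Proof.
move=> pa pa2 pb pc h nz.
have p2 : ((p ^ 2)%N %| a * (c * x ^+ 2 + d * y ^+ 2) + b * (c * z ^+ 2 + d * w ^+ 2))%Z.
  by rewrite dvdzE.
have [/andP[pz pw]|nzw] := boolP ((p %| z)%Z && (p %| w)%Z); last first.
  apply: binary_zero_residue pc _ nzw.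
  have : (p %| a * (c * x ^+ 2 + d * y ^+ 2) + b * (c * z ^+ 2 + d * w ^+ 2))%Z.
    by apply: dvdz_trans p2; rewrite dvdzE /= dvdn_mulr.
  rewrite rpredDl; last exact: dvdz_mulr.
  by rewrite prime_dvdzM (negPf pb).
have sq (t : int) : (p %| t)%Z -> ((p ^ 2)%N %| t ^+ 2)%Z.
  by move=> pt; rewrite dvdzE abszX dvdn_exp2r.
have nxy : ~~ ((p %| x)%Z && (p %| y)%Z).
  by apply: contra nz => /andP[-> ->]; rewrite pz pw.
apply: binary_zero_residue pc _ nxy.
move: p2; rewrite rpredDr; last first.
  by apply: dvdz_mull; apply: rpredD; apply: dvdz_mull; exact: sq.
rewrite dvdzE abszM /= => h2.
have [a' ea] : exists a' : nat, (`|a| = a' * p)%N by apply/dvdnP.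
have pa' : ~~ (p %| a')%N.
  by apply: contra pa2 => pa'; rewrite ea -mulnn dvdn_mul.
move: h2; rewrite ea -mulnn mulnAC dvdn_pmul2r ?prime_gt0 // Euclid_dvdM //.
by rewrite (negPf pa') /= dvdzE.
Qed.

Lemma not_nonresidue (n : nat) (s : int) : (p %| s ^+ 2 + n%:Z)%Z -> ~~ nonresidue p n.
Proof.
move=> h; have p0 := prime_gt0 pp.
have pz : (p%:Z != 0) by rewrite eqz_nat -lt0n.
have r0 : 0 <= (s %% p)%Z by apply: modz_ge0.
have rp : (`|(s %% p)%Z| < p)%N by rewrite -ltz_nat gez0_abs // ltz_pmod.
rewrite negb_forall; apply/existsP; exists (Ordinal rp); rewrite negbK.
suff : (p %| ((`|(s %% p)%Z| * `|(s %% p)%Z| + n)%N)%:Z)%Z by [].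
rewrite PoszD PoszM gez0_abs //.
move: h; rewrite {1}(divz_eq s p).
have -> : ((s %/ p)%Z * p + (s %% p)%Z) ^+ 2 + n%:Z =
  p%:Z * ((s %/ p)%Z ^+ 2 * p + 2 * (s %/ p)%Z * (s %% p)%Z)
   + ((s %% p)%Z * (s %% p)%Z + n%:Z) by ring.
by rewrite rpredDl //; exact: dvdz_mulr.
Qed.

Definition signed (e : bool) (n : nat) : int := (-1) ^+ e * n%:Z.

Lemma dvdz_signed e n : (p %| signed e n)%Z = (p %| n)%N.
Proof. by rewrite dvdzE /signed abszMsign. Qed.

Lemma twist_not_nonresidue ec ed c d (s : int) :
  (p %| s ^+ 2 + signed ec c * signed ed d)%Z ->
  ~~ nonresidue p (twist (ec (+) ed) p * (c * d)).
Proof.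
move=> h; apply: (@not_nonresidue _ s).
have -> : s ^+ 2 + (twist (ec (+) ed) p * (c * d))%N%:Z =
  (s ^+ 2 + signed ec c * signed ed d) + p%:Z * ((ec (+) ed) * (c * d))%N%:Z.
  rewrite /signed /twist; have ep : p%:Z = p.-1%:Z + 1 by have := prime_gt0 pp; lia.
  clear h; case: ec ed => -[] /=; rewrite ?mul1n ?mul0n ?PoszM ?ep; ring.
by apply: rpredD => //; exact: dvdz_mulr.
Qed.

Definition fibre_coefs (a b c d : int) (j : 'I_4) : int :=
  [:: a * c; b * d; a * d; b * c]`_j.

(** Each of the four cases groups the fibre as
    [A (C x ^ 2 + D y ^ 2) + B (C z ^ 2 + D w ^ 2)], with the variable that [p] divides in the
    place of [A]. *)
Lemma local_zero_not_bad ea eb ec ed a b c d (x : 'I_4 -> int) :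
  (exists j, ~~ (p %| `|x j|)%N) ->
  (p ^ 2 %| `|diag_form (fibre_coefs (signed ea a) (signed eb b) (signed ec c) (signed ed d)) x|)%N ->
  ~~ bad (ec (+) ed) (ea (+) eb) p a b c d.
Proof.
move=> [j xj] h; rewrite /diag_form /fibre_coefs /= in h.
have nz i0 i1 i2 i3 : [\/ j = i0, j = i1, j = i2 | j = i3] ->
    ~~ [&& (p %| x i0)%Z, (p %| x i1)%Z, (p %| x i2)%Z & (p %| x i3)%Z].
  move=> ji; apply: contra xj => /and4P[h0 h1 h2 h3].
  by case: ji => ->; [exact: h0|exact: h1|exact: h2|exact: h3].
have jE : [\/ j = 0, j = 1, j = 2 | j = 3].
  case: j {xj nz} => -[|[|[|[|]]]] // i; [constructor 1|constructor 2|constructor 3|constructor 4];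
    exact: val_inj.
have core A B C D a' i0 i1 i2 i3 : (`|A| = a')%N -> (p %| a')%N -> ~~ (p ^ 2 %| a')%N ->
    ~~ (p %| B)%Z -> ~~ (p %| C)%Z -> [\/ j = i0, j = i1, j = i2 | j = i3] ->
    (p ^ 2 %| `|(A * (C * x i0 ^+ 2 + D * x i1 ^+ 2) + B * (C * x i2 ^+ 2 + D * x i3 ^+ 2))%R|)%N ->
    exists s : int, (p %| s ^+ 2 + C * D)%Z.
  move=> Aa pa pa2 pB pC ji h'; apply: quaternary_zero_residue pB pC h' (nz _ _ _ _ ji).
    by rewrite dvdzE Aa.
  by rewrite Aa.
have sg e n : (`|signed e n| = n)%N by rewrite abszMsign.
set A := signed ea a in h; set B := signed eb b in h.
set C := signed ec c in h; set D := signed ed d in h.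
apply/negP => /or4P[] /and5P[pa pa2 pb pc /andP[pd]]; apply/negP.
- have [||||s] := @core A B C D a 0 2 3 1 (sg ea a) pa pa2.
  + by rewrite dvdz_signed.
  + by rewrite dvdz_signed.
  + by case: jE => ->; [constructor 1|constructor 4|constructor 2|constructor 3].
  + by move: h; congr (_ %| `|_|)%N; ring.
  + exact: twist_not_nonresidue.
- have [||||s] := @core B A C D b 3 1 0 2 (sg eb b) pa pa2.
  + by rewrite dvdz_signed.
  + by rewrite dvdz_signed.
  + by case: jE => ->; [constructor 3|constructor 2|constructor 4|constructor 1].
  + by move: h; congr (_ %| `|_|)%N; ring.
  + exact: twist_not_nonresidue.
- have [||||s] := @core C D A B c 0 3 2 1 (sg ec c) pa pa2.
  + by rewrite dvdz_signed.
  + by rewrite dvdz_signed.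
  + by case: jE => ->; [constructor 1|constructor 4|constructor 3|constructor 2].
  + by move: h; congr (_ %| `|_|)%N; ring.
  + exact: twist_not_nonresidue.
- have [||||s] := @core D C A B d 2 1 0 3 (sg ed d) pa pa2.
  + by rewrite dvdz_signed.
  + by rewrite dvdz_signed.
  + by case: jE => ->; [constructor 3|constructor 2|constructor 1|constructor 4].
  + by move: h; congr (_ %| `|_|)%N; ring.
  + exact: twist_not_nonresidue.
Qed.
End ResidueObstruction.

(** * Counting *)

(** What is kept of the solubility of the fibre at the finite places: a zero modulo
    [p ^ 2] that is nonzero modulo [p], for every prime [p]. *)
Definition zero_mod_squares (y : Y Qalg) := forall p, prime p ->
  exists x : 'I_4 -> int, (exists j, ~~ (p %| `|x j|)%N) /\
    (p ^ 2 %| `|diag_form (rep y 0%R) x|)%N.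

Lemma soluble_zero_mod_squares (R : realType) (X' : qfunctor) (rho : qmor X' X) y :
  everywhere_locally_soluble R (mor_comp pi_XY rho) y -> zero_mod_squares y.
Proof.
move=> els p pp; have [x' x'y] := els (FinitePlace pp).
apply: (@local_point_dvd p pp (rho _ x')).
have [_ <-] := rep_primitive y.
by have := congr1 (fun y => sval (sval y)) x'y.
Qed.

(** With [a] the gcd of [v0] and [v2], the cofactors [c] and [d] are coprime, so that [c]
    divides [v3]. *)
Lemma factor_quadric (v0 v1 v2 v3 : int) : v0 != 0 -> v0 * v1 = v2 * v3 ->
  exists a b c d : int, [/\ v0 = a * c, v1 = b * d, v2 = a * d & v3 = b * c].
Proof.
move=> n0 e; pose g := gcdz v0 v2.
have g0 : g != 0 by rewrite gcdz_eq0 negb_and n0.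
pose c := (v0 %/ g)%Z; pose d := (v2 %/ g)%Z.
have ec : v0 = g * c by rewrite mulrC divzK // dvdz_gcdl.
have ed : v2 = g * d by rewrite mulrC divzK // dvdz_gcdr.
have cd : coprimez c d.
  have := mulz_gcdr g c d; rewrite -ec -ed -/g gez0_abs // => e1.
  by rewrite /coprimez; apply/eqP/(mulfI g0); rewrite e1 mulr1.
have e2 : c * v1 = d * v3 by apply: (mulfI g0); rewrite !mulrA -ec -ed.
have c0 : c != 0 by apply: contraNneq n0 => c0; rewrite ec c0 mulr0.
have /dvdzP[b eb] : (c %| v3)%Z.
  by rewrite -(Gauss_dvdzr _ cd) -e2 dvdz_mulr.
exists g, b, c, d; split=> //.
by apply: (mulfI c0); rewrite e2 eb; ring.
Qed.

Lemma signed_absz (a : int) : signed (a < 0) `|a| = a.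
Proof. by rewrite /signed -intEsign. Qed.

Lemma absz_signedM e f m n : `|(signed e m * signed f n)%R|%N = (m * n)%N.
Proof. by rewrite abszM /signed !abszMsign. Qed.

Definition quad_vector (s : bool * bool * bool * bool) (a b c d : nat) : 'rV[int]_4 :=
  \row_j fibre_coefs (signed s.1.1.1 a) (signed s.1.1.2 b) (signed s.1.2 c) (signed s.2 d) j.

Lemma rep_quad y : rep y 0 0 != 0 -> exists s a b c d, rep y = quad_vector s a b c d.
Proof.
move=> n0; have [a [b [c [d [e0 e1 e2 e3]]]]] := factor_quadric n0 (rep_on_Y y).
exists (a < 0, b < 0, c < 0, d < 0), `|a|%N, `|b|%N, `|c|%N, `|d|%N.
apply/rowP => j; rewrite mxE /fibre_coefs /= !signed_absz.
have rj (k l : 'I_4) : k = l :> nat -> rep y 0 k = rep y 0 l by move=> /val_inj ->.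
by case: j => -[|[|[|[|]]]] //= i; rewrite -1?e0 -1?e1 -1?e2 -1?e3; apply: rj.
Qed.

(** The points are coded by the signs and the absolute values of [a, b, c, d]. *)
Lemma quad_count : exists C : nat, forall T (S : set {classic Y Qalg}), (0 < T)%N ->
  (forall y, S y -> [/\ forall i, (`|rep y 0%R i| <= T)%N, zero_mod_squares y
                      & forall i, rep y 0 i != 0]) ->
  finite_set S /\ (#|` fset_set S| <= C * T ^ 2)%N.
Proof.
have [C hC] := unobstructed_bound.
pose E : finType := (bool * bool * bool * bool)%type.
exists (#|E| * C)%N => T S T0 hS.
pose A (s : E) a b c d : bool := `[< exists2 y, S y & rep y = quad_vector s a b c d >].
have ineq s a b c d : A s a b c d ->
    [/\ [/\ 0 < a, 0 < b, 0 < c & 0 < d], a * c <= T, b * d <= T, a * d <= T & b * c <= T]%N.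
  move=> /asboolP[y Sy e]; have [le _ n0] := hS y Sy.
  have abs i : (`|rep y 0%R i| = `|fibre_coefs (signed s.1.1.1 a) (signed s.1.1.2 b)
     (signed s.1.2 c) (signed s.2 d) i|)%N by rewrite e mxE.
  have := le 0; have := le 1; have := le 2; have := le 3; rewrite !abs /fibre_coefs /=.
  rewrite !absz_signedM => h3 h2 h1 h0.
  have p0 : (0 < a * c)%N by have := n0 0; rewrite -absz_gt0 abs /fibre_coefs /= absz_signedM.
  have p1 : (0 < b * d)%N by have := n0 1; rewrite -absz_gt0 abs /fibre_coefs /= absz_signedM.
  by move: p0 p1; rewrite !muln_gt0 => /andP[-> ->] /andP[-> ->].
pose W : finType := (E * ('I_T.+1 * 'I_T.+1 * 'I_T.+1 * 'I_T.+1))%type.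
pose P (w : W) := A w.1 w.2.1.1.1 w.2.1.1.2 w.2.1.2 w.2.2.
have [||fin le] := @fset_set_card_le {classic Y Qalg} S W P
  (fun y w => rep y = quad_vector w.1 w.2.1.1.1 w.2.1.1.2 w.2.1.2 w.2.2).
- move=> y Sy; have [_ _ n0] := hS y Sy.
  have [s [a [b [c [d e]]]]] := rep_quad (n0 0).
  have As : A s a b c d by apply/asboolP; exists y.
  have [[a0 b0 c0 d0] h0 h1 h2 h3] := ineq _ _ _ _ _ As.
  have aT : (a < T.+1)%N by rewrite ltnS (leq_trans _ h0) // leq_pmulr.
  have bT : (b < T.+1)%N by rewrite ltnS (leq_trans _ h1) // leq_pmulr.
  have cT : (c < T.+1)%N by rewrite ltnS (leq_trans _ h0) // leq_pmull.
  have dT : (d < T.+1)%N by rewrite ltnS (leq_trans _ h1) // leq_pmull.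
  by exists (s, (Ordinal aT, Ordinal bT, Ordinal cT, Ordinal dT)).
- by move=> y y' w e e'; apply: rep_inj; rewrite e e'.
- split=> //; apply: leq_trans le _.
  have -> : #|P| = (\sum_(s : E) sum4 T.+1 T.+1 (A s))%N.
    rewrite -sum1_card big_mkcond /=.
    rewrite (eq_bigr (fun w : W => (A w.1 w.2.1.1.1 w.2.1.1.2 w.2.1.2 w.2.2 : nat))); last first.
      by move=> w _; rewrite unfold_in /P; case: (A _ _ _ _ _).
    rewrite -(pair_bigA _ (fun (s : E) (q : 'I_T.+1 * 'I_T.+1 * 'I_T.+1 * 'I_T.+1) =>
      (A s q.1.1.1 q.1.1.2 q.1.2 q.2 : nat))) /=.
    by apply: eq_bigr => s _; rewrite /sum4 !pair_big.
  rewrite -mulnA -sum_nat_const; apply: leq_sum => -[[[ea eb] ec] ed] _.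
  apply: (hC (ec (+) ed) (ea (+) eb) T) => // a b c d Aq.
  have [[a0 b0 c0 d0] h0 h1 h2 h3] := ineq _ _ _ _ _ Aq; split.
    split; rewrite ?leq_max ?a0 ?c0 ?orTb //.
    by rewrite /maxn; case: ifP; case: ifP.
  move=> p pp _; move/asboolP: Aq => [y Sy e].
  have [_ zm _] := hS y Sy; have [x [xj px]] := zm p pp.
  apply: (local_zero_not_bad pp xj); move: px; congr (_ %| `|_|)%N.
  by rewrite /diag_form e !mxE.
Qed.

(** The points of [Y] with a vanishing coordinate have a vanishing coordinate among the
    first two and another among the last two. The booleans say which ones, and the offset
    [T] makes the two others natural numbers. *)
Definition line_vector T (i j : bool) (m n : nat) : 'rV[int]_4 :=
  \row_k (if i then if j then [:: 0; m%:Z - T%:Z; 0; n%:Z - T%:Z]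
                    else [:: 0; m%:Z - T%:Z; n%:Z - T%:Z; 0]
          else if j then [:: m%:Z - T%:Z; 0; 0; n%:Z - T%:Z]
                    else [:: m%:Z - T%:Z; 0; n%:Z - T%:Z; 0])`_k.

Lemma line_count T (S : set {classic Y Qalg}) : (0 < T)%N ->
  (forall y, S y -> (forall i, (`|rep y 0%R i| <= T)%N) /\ exists i, rep y 0 i = 0) ->
  finite_set S /\ (#|` fset_set S| <= 36 * T ^ 2)%N.
Proof.
move=> T0 hS.
pose W : finType := (bool * bool * 'I_(2 * T).+1 * 'I_(2 * T).+1)%type.
have [||fin le] := @fset_set_card_le {classic Y Qalg} S W xpredT
  (fun y w => rep y = line_vector T w.1.1.1 w.1.1.2 w.1.2 w.2).
- move=> y Sy; have [le [k vk]] := hS y Sy; have e := rep_on_Y y.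
  have rj (k' l : 'I_4) : k' = l :> nat -> rep y 0 k' = rep y 0 l by move=> /val_inj ->.
  have coord l : exists2 m : 'I_(2 * T).+1, rep y 0 l = m%:Z - T%:Z & true.
    have h := le l; have mT : (`|(rep y 0 l + T%:Z)%R| < (2 * T).+1)%N by lia.
    by exists (Ordinal mT) => //=; lia.
  have e01 : rep y 0 0 = 0 \/ rep y 0 1 = 0.
    have : rep y 0 0 * rep y 0 1 = 0.
      move: vk; case: k => -[|[|[|[|]]]] // i vk.
      + by rewrite [rep y 0 0](rj 0 (Ordinal i)) // vk mul0r.
      + by rewrite [rep y 0 1](rj 1 (Ordinal i)) // vk mulr0.
      + by rewrite e [rep y 0 2](rj 2 (Ordinal i)) // vk mul0r.
      + by rewrite e [rep y 0 3](rj 3 (Ordinal i)) // vk mulr0.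
    by move/eqP; rewrite mulf_eq0 => /orP[] /eqP ->; [left|right].
  have e23 : rep y 0 2 = 0 \/ rep y 0 3 = 0.
    have : rep y 0 2 * rep y 0 3 = 0 by rewrite -e; case: e01 => ->; rewrite ?mul0r ?mulr0.
    by move/eqP; rewrite mulf_eq0 => /orP[] /eqP ->; [left|right].
  have [m0 r0 _] := coord 0; have [m1 r1 _] := coord 1.
  have [m2 r2 _] := coord 2; have [m3 r3 _] := coord 3.
  have dec i j (m n : 'I_(2 * T).+1) : rep y 0 0 = line_vector T i j m n 0 0 -> 
     rep y 0 1 = line_vector T i j m n 0 1 -> rep y 0 2 = line_vector T i j m n 0 2 ->
     rep y 0 3 = line_vector T i j m n 0 3 -> 
     exists2 w : W, true & rep y = line_vector T w.1.1.1 w.1.1.2 w.1.2 w.2.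
    move=> h0 h1 h2 h3; exists (i, j, m, n) => //=; apply/rowP => l.
    have lj (a b : 'I_4) : b = a :> nat -> rep y 0 b = line_vector T i j m n 0 b ->
       rep y 0 a = line_vector T i j m n 0 a by move=> /val_inj ->.
    by case: l => -[|[|[|[|]]]] // p; [apply: (lj _ 0)|apply: (lj _ 1)|apply: (lj _ 2)|apply: (lj _ 3)].
  case: e01 => z01; case: e23 => z23.
  + by apply: (dec true true m1 m3); rewrite mxE.
  + by apply: (dec true false m1 m2); rewrite mxE.
  + by apply: (dec false true m0 m3); rewrite mxE.
  + by apply: (dec false false m0 m2); rewrite mxE.
- by move=> y y' w e e'; apply: rep_inj; rewrite e e'.
- split=> //; apply: leq_trans le _; rewrite cardT -cardE.
  rewrite !card_prod !card_ord card_bool.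
  have h : ((2 * T).+1 <= 3 * T)%N by lia.
  apply: (@leq_trans (2 * 2 * (3 * T) * (3 * T))); first by rewrite !leq_mul.
  by rewrite -mulnn; lia.
Qed.

Lemma upper_count : exists C : nat, forall T (S : set {classic Y Qalg}), (0 < T)%N ->
  (forall y, S y -> (forall i, (`|rep y 0%R i| <= T)%N) /\ zero_mod_squares y) ->
  finite_set S /\ (#|` fset_set S| <= C * T ^ 2)%N.
Proof.
have [C hC] := quad_count; exists (C + 36)%N => T S T0 hS.
pose S1 := S `&` [set y : {classic Y Qalg} | forall i, rep y 0 i != 0].
pose S2 := S `&` [set y : {classic Y Qalg} | exists i, rep y 0 i = 0].
have eS : S = S1 `|` S2.
  apply/seteqP; split=> [y Sy|y [[]|[]] //].
  have [[i yi]|h] := pselect (exists i, rep y 0 i = 0); first by right; split=> //; exists i.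
  by left; split=> // i; apply/eqP => yi; apply: h; exists i.
have [|f1 l1] := hC T S1 T0; first by move=> y [Sy n0]; have [? ?] := hS y Sy.
have [|f2 l2] := @line_count T S2 T0; first by move=> y [Sy n0]; have [? ?] := hS y Sy.
rewrite eS; split; first by rewrite finite_setU.
rewrite fset_setU // mulnDl; apply: leq_trans (leq_add l1 l2).
by rewrite (leq_trans (leq_card_fsetU _ _)).
Qed.

(** The points [(0, d, 0, c)] with [c] and [d] coprime and at most [T] are enough. *)
Lemma lower_count (R : realType) (X' : qfunctor) (rho : qmor X' X) T
    (S : set {classic Y Qalg}) : desingularisation rho -> finite_set S ->
  (forall y : Y Qalg, (height y <= T ^ 2)%N ->
     everywhere_locally_soluble R (mor_comp pi_XY rho) y -> S y) ->
  (T ^ 2 <= 4 * #|` fset_set S|)%N.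
Proof.
move=> desing fin hS.
pose W : finType := ('I_T * 'I_T)%type.
pose P : pred W := fun w => coprime w.1.+1 w.2.+1.
apply: leq_trans (sum_coprime_pairs T) _; rewrite leq_mul2l /=.
have -> : (\sum_(1 <= c < T.+1) \sum_(1 <= d < T.+1) coprime c d =
   #|P|)%N.
  rewrite big_add1 big_mkord -sum1_card [RHS]big_mkcond /=.
  rewrite [RHS](eq_bigr (fun w : W => (coprime w.1.+1 w.2.+1 : nat))); last first.
    by move=> w _; rewrite -[w \in _]/(coprime w.1.+1 w.2.+1); case: coprime.
  rewrite -(pair_bigA _ (fun c d : 'I_T => (coprime c.+1 d.+1 : nat))) /=.
  by apply: eq_bigr => c _; rewrite big_add1 big_mkord.
apply: (@fset_set_card_ge {classic Y Qalg} S W P (fun w (y : {classic Y Qalg}) => coprime w.1.+1 w.2.+1 /\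
  sval (sval y) = rat_line (axis_vector w.1.+1 w.2.+1))) => //.
- move=> [c d] /= cd.
  have [z [sz zE]] := axis_point (ltn0Sn c) (ltn0Sn d).
  exists (pi_XY Qalg z); last by split.
  apply: hS; last exact: smooth_point_soluble.
  rewrite height_eq leq_sqr; apply/bigmax_leqP => i _.
  rewrite (@rep_abs _ (axis_vector c.+1 d.+1)) //; last exact: axis_primitive.
  rewrite mxE; have := ltn_ord c; have := ltn_ord d.
  by case: i => -[|[|[|[|]]]].
- move=> [c d] [c' d'] y /= [cd yE] [cd' yE'].
  have r1 := rep_abs (axis_primitive cd) yE; have r2 := rep_abs (axis_primitive cd') yE'.
  have := r1 1; have := r1 3; rewrite r2 r2 !mxE /= => -[ec] -[ed].
  by congr pair; apply: val_inj.
Qed.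

Theorem theorem1p1 (R : realType) (X' : qfunctor) (rho : qmor X' X)
    (desing : desingularisation rho) :
  exists c1 c2 : R, 0 < c1 /\ 0 < c2 /\
    \forall B \near +oo,
      c1 * B <= (N_loc (mor_comp pi_XY rho) B)%:R <= c2 * B.
Proof.
have [C hC] := upper_count.
(* B < (T + 1) ^ 2 <= 4 T ^ 2 for the integral part T of the square root of B. *)
exists 16^-1, C.+1%:R; split; first by rewrite invr_gt0.
split; first by rewrite ltr0n.
exists 1; split; first exact: real1.
move=> B B1; rewrite /N_loc; set S := [set y | _].
have B0 : 0 <= B by apply: ltW; apply: lt_trans B1.
pose T := Num.truncn (Num.sqrt B).
have /andP[T1 T2] := truncn_itv (sqrtr_ge0 B).
have TB : (T ^ 2)%:R <= B.
  rewrite natrX -[leRHS](sqr_sqrtr B0) lerXn2r ?nnegrE ?sqrtr_ge0 //.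
have BT : B < (T.+1 ^ 2)%:R.
  by rewrite natrX -[ltLHS](sqr_sqrtr B0) ltrXn2r ?nnegrE ?sqrtr_ge0.
have T0 : (0 < T)%N.
  by rewrite lt0n; apply/eqP => T0; move: BT; rewrite T0 ltNge ltW.
have [|fin le] := hC T S T0.
  move=> y [hy els]; split; last exact: soluble_zero_mod_squares els.
  move=> i; have := le_lt_trans hy BT; rewrite ltr_nat height_eq ltn_sqr ltnS.
  exact: leq_trans (leq_bigmax i).
apply/andP; split; last first.
  apply: le_trans (_ : (C * T ^ 2)%:R <= _); first by rewrite ler_nat.
  rewrite natrM; apply: le_trans (_ : C%:R * B <= _).
    by rewrite ler_wpM2l.
  by rewrite ler_wpM2r // ler_nat.
have lo := @lower_count R X' rho T S desing fin.
have {}lo : (T ^ 2 <= 4 * #|` fset_set S|)%N.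
  by apply: lo => y hy els; split=> //; apply: le_trans TB; rewrite ler_nat.
have T4 : (T.+1 ^ 2 <= 4 * T ^ 2)%N by rewrite -!mulnn; nia.
have : B <= (16 * #|` fset_set S|)%:R.
  apply: le_trans (ltW BT) _; rewrite ler_nat; apply: leq_trans T4 _; lia.
by rewrite natrM ler_pdivrMl.
Qed.
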